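(* Suppose that $N(m,n)\ge N(m+1,n)$ for all integers $m,n$ with $n\ge 39$ and $0\le m\le n-3$. Then for every integer $n\ge 0$ the quotients $$\frac{\mathrm{rank}_{5,n}^*(\zeta)}{\Phi_5(\zeta)}\qquad\text{and}\qquad\frac{\mathrm{rank}_{7,n}^*(\zeta)}{\Phi_7(\zeta)}$$ are Laurent polynomials in $\zeta$ with non-negative coefficients.
   Context: The rank of a partition is its largest part minus its number of parts. $N(m,n)$ denotes the number of partitions of $n$ with rank $m$, and $\mathrm{rank}_n(\zeta):=\sum_{m\in\mathbb{Z}}N(m,n)\zeta^m$; equivalently $$\sum_{n\ge 0}\mathrm{rank}_n(\zeta)q^n=\sum_{n\ge 0}\frac{q^{n^2}}{\prod_{k=1}^n(1-\zeta q^k)(1-\zeta^{-1}q^k)}.$$ For a prime $\ell$, $\Phi_\ell(\zeta):=1+\zeta+\cdots+\zeta^{\ell-1}$. For $\ell\in\{5,7\}$ put $\beta:=\ell-\frac{\ell^2-1}{24}$ (so $\beta=4$ for $\ell=5$ and $\beta=5$ for $\ell=7$). The modified rank is, for $n\ge 0$, $$\mathrm{rank}_{\ell,n}^*(\zeta):=\mathrm{rank}_{\ell n+\beta}(\zeta)+\zeta^{\ell n+\beta-2}-\zeta^{\ell n+\beta-1}+\zeta^{2-\ell n-\beta}-\zeta^{1-\ell n-\beta}.$$ *)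

(* Defs.v *)
From HB Require Import structures.
From mathcomp Require Import all_boot all_order all_algebra.

Set Implicit Arguments.
Unset Strict Implicit.
Unset Printing Implicit Defensive.

Import Order.TTheory GRing.Theory Num.Theory.

Local Open Scope ring_scope.

Definition is_partition (n : nat) (la : seq nat) : bool :=
  [&& sorted geq la, 0%N \notin la & sumn la == n].

Record partition_of (n : nat) := PartitionOf {
  parts :> seq nat;
  _ : is_partition n parts
}.

HB.instance Definition _ n := [isSub for @parts n].
HB.instance Definition _ n := [Countable of partition_of n by <:].

Section PartitionFinite.
Variable n : nat.

Lemma part_le (la : partition_of n) (i : nat) : i \in parts la -> (i <= n)%N.
Proof.
case: la => la /= /and3P[_ _ /eqP <-].
elim: la => //= j la IH; rewrite inE => /orP[/eqP-> | /IH le_i].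
  exact: leq_addr.
exact: leq_trans le_i (leq_addl _ _).
Qed.

Lemma size_partition (la : partition_of n) : (size (parts la) <= n)%N.
Proof.
case: la => la /= /and3P[_ la0 /eqP <-].
elim: la la0 => //= j la IH; rewrite inE negb_or eq_sym -lt0n => /andP[j0 /IH le_s].
by rewrite -add1n leq_add.
Qed.

Definition bseq_of_partition (la : partition_of n) : n.-bseq 'I_n.+1 :=
  insub_bseq n [seq inord i | i <- parts la].

Definition partition_of_bseq (b : n.-bseq 'I_n.+1) : option (partition_of n) :=
  insub [seq val i | i <- b].

Lemma bseq_of_partitionK : pcancel bseq_of_partition partition_of_bseq.
Proof.
move=> la; rewrite /partition_of_bseq /bseq_of_partition /insub_bseq.
rewrite val_insubd size_map size_partition -map_comp.
rewrite (_ : map _ _ = parts la); first exact: valK.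
by apply: map_id_in => i /part_le le_i /=; rewrite inordK.
Qed.

HB.instance Definition _ : isFinite (partition_of n) :=
  PCanIsFinite bseq_of_partitionK.

End PartitionFinite.

Definition rank (la : seq nat) : int :=
  (\max_(i <- la) i)%N%:Z - (size la)%:Z.

Definition N (m : int) (n : nat) : nat :=
  #|[set la : partition_of n | rank la == m]|.

Lemma N_eq0 (m : int) (n : nat) : n%:Z < `|m| -> N m n = 0%N.
Proof.
move=> lt_nm; apply/eqP; rewrite cards_eq0; apply/eqP/setP=> la.
rewrite !inE; apply/negP => /eqP rk; move: lt_nm; rewrite ltNge -rk.
have mx : (\max_(i <- parts la) i <= n)%N.
  by apply/bigmax_leqP_seq => i /part_le.
rewrite /rank; apply/negP; rewrite negbK ler_norml; apply/andP; split.
  by rewrite -[leLHS]add0r lerD // lerN2 lez_nat size_partition.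
by rewrite -[leRHS]subr0 lerD // lerN2.
Qed.

(* Laurent polynomials in zeta are taken inside the field of rational functions
   in zeta, where the quotients by Phi also live. *)
Definition zeta : {fraction {poly int}} := tofrac 'X.

(* The sum over all integers m is cut to -n <= m <= n, which loses nothing
   by N_eq0. *)
Definition rank_poly (n : nat) : {fraction {poly int}} :=
  \sum_(i < n.*2.+1) (N (i%:Z - n%:Z) n)%:R * zeta ^ (i%:Z - n%:Z).

Definition Phi (l : nat) : {fraction {poly int}} := \sum_(i < l) zeta ^+ i.

Definition beta (l : nat) : nat := (l - (l ^ 2 - 1) %/ 24)%N.

Definition rank_star (l n : nat) : {fraction {poly int}} :=
  let a : int := (l * n + beta l)%N%:Z in
  rank_poly (l * n + beta l)
    + zeta ^ (a - 2) - zeta ^ (a - 1) + zeta ^ (2 - a) - zeta ^ (1 - a).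

Definition nonneg_laurent (f : {fraction {poly int}}) : Prop :=
  exists (k : nat) (p : {poly int}),
    p \is a polyOver Num.nneg /\ f = tofrac p / zeta ^+ k.

(* Main.v *)
(* The ranks of the partitions of l n + beta are equidistributed modulo l
   (Dyson's conjecture for l = 5, 7). Dyson's map gives a recursion for the
   number of partitions of rank at least s, hence the generating functions of
   the rank classes as P(q) = sum p(n) q^n times the Lambert series sum (-1)^n
   q^(n(3n+1)/2 + bn) / (1 - q^(ln)). Split such a series by n mod l: the
   Lagrange interpolation identities at the nodes q^(ln), n in three residue
   classes modulo l and |n| <= M, become for M -> oo linear relations between
   the parts, whose coefficients are theta functions of q^l; a relation between
   logarithmic derivatives of theta functions, and Klein's quartic for l = 7,
   also come from interpolation. They show that P(q) times the sum of l times
   the Lambert series and a constant has no exponent congruent to beta modulo l.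

   The modification of the rank keeps the class sums equal, so Phi_l divides it,
   and it makes the coefficients symmetric and decreasing away from the centre
   when l n + beta >= 39.  The quotient has coefficients
   c_m = sum_(j >= 0) (a_(m-lj) - a_(m-lj-1)) = sum_(j >= 1) (a_(m+lj-1) - a_(m+lj)),
   and one of the two expressions has non-negative terms.  The twelve smaller
   values of l n + beta are computed with Dyson's recursion. *)
Require Import Defs.
From HB Require Import structures.
From mathcomp Require Import all_boot all_order all_algebra.
From mathcomp Require Import boolp.
From mathcomp Require Import zify ring lra.

Set Implicit Arguments.
Unset Strict Implicit.
Unset Printing Implicit Defensive.

Import Order.TTheory GRing.Theory Num.Theory.

Local Open Scope ring_scope.

(** * Laurent series over the rationals *)

(** For fixed [b], let [a] be the residue with 3a = (3l-1)/2 - b modulo l. The exponent n(3n+1)/2 +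
    bn is symmetric about n = a modulo l, so the other residues form pairs i, k with i + k = 2a that
    carry the same power of q modulo l. Interpolation relates the parts of three residues whose sum
    is (3l-1)/2 - b modulo l, and i + a + k is such a sum: each pair merges into the part [a]. The
    pentagonal series, which is 1/P, and the Lambert series obey the same relations up to
    inhomogeneous terms, so in both the part [a] is multiplied by the same [g], up to a monomial. P
    cancels this [g]; only theta quotients remain to be divided by it.

    Three residues are forced by the leading coefficient 3/2: each class of nodes contributes one
    triangular exponent to a Lagrange denominator.

    The constant added to l times the Lambert series is (l-1)/2 - b. Indeed P times that series
    counts, with a minus sign, the non-negative ranks in the classes b+1, ..., l-b-1; by the
    symmetry of ranks they amount to (l-1)/2 - b full classes, which should hold p(n)/l partitions
    each. *)

Record pseries := PSeries { coefs : nat -> rat }.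

HB.instance Definition _ := gen_eqMixin pseries.
HB.instance Definition _ := gen_choiceMixin pseries.

Lemma pseriesP (f g : pseries) : (forall n, coefs f n = coefs g n) -> f = g.
Proof. by case: f g => f [g] /= /funext ->. Qed.

Module PSeriesRing.

Definition zero := PSeries (fun=> 0).
Definition opp f := PSeries (fun n => - coefs f n).
Definition add f g := PSeries (fun n => coefs f n + coefs g n).
Definition one := PSeries (fun n => (n == 0%N)%:R).
Definition mul f g :=
  PSeries (fun n => \sum_(i < n.+1) coefs f i * coefs g (n - i)%N).

Fact addA : associative add.
Proof. by move=> f g h; apply: pseriesP => n /=; rewrite addrA. Qed.
Fact addC : commutative add.
Proof. by move=> f g; apply: pseriesP => n /=; rewrite addrC. Qed.
Fact add0 : left_id zero add.
Proof. by move=> f; apply: pseriesP => n /=; rewrite add0r. Qed.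
Fact addN : left_inverse zero opp add.
Proof. by move=> f; apply: pseriesP => n /=; rewrite addNr. Qed.

HB.instance Definition _ := GRing.isZmodule.Build pseries addA addC add0 addN.

(** Coefficients of a product up to degree [n] depend on these truncations only, so associativity
    and commutativity come from polynomials. *)
Definition trunc n f : {poly rat} := \poly_(i < n.+1) coefs f i.

Lemma coef_trunc n f i : (i <= n)%N -> (trunc n f)`_i = coefs f i.
Proof. by move=> le_in; rewrite coef_poly ltnS le_in. Qed.

Lemma mulE n f g i : (i <= n)%N ->
  coefs (mul f g) i = (trunc n f * trunc n g)`_i.
Proof.
move=> le_in; rewrite coefM; apply: eq_bigr => j _.
have le_ji : (j <= i)%N by rewrite -ltnS.
by rewrite !coef_trunc // ?(leq_trans le_ji) // (leq_trans (leq_subr _ _)).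
Qed.

Lemma mulE_poly n f g (p r : {poly rat}) :
    (forall i, (i <= n)%N -> coefs f i = p`_i) ->
    (forall i, (i <= n)%N -> coefs g i = r`_i) ->
  forall i, (i <= n)%N -> coefs (mul f g) i = (p * r)`_i.
Proof.
move=> fp gr i le_in; rewrite coefM; apply: eq_bigr => j _.
have le_ji : (j <= i)%N by rewrite -ltnS.
by rewrite fp ?gr // ?(leq_trans le_ji) // (leq_trans (leq_subr _ _)).
Qed.

Fact mulA : associative mul.
Proof.
move=> f g h; apply: pseriesP => n.
have tE f' i : (i <= n)%N -> coefs f' i = (trunc n f')`_i.
  by move=> le_in; rewrite coef_trunc.
rewrite (mulE_poly (tE f) (mulE_poly (tE g) (tE h)) (leqnn n)).
by rewrite (mulE_poly (mulE_poly (tE f) (tE g)) (tE h) (leqnn n)) mulrA.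
Qed.
Fact mulC : commutative mul.
Proof.
by move=> f g; apply: pseriesP => n; rewrite !(mulE _ _ (leqnn n)) mulrC.
Qed.
Fact mul1 : left_id one mul.
Proof.
move=> f; apply: pseriesP => n /=; rewrite big_ord_recl /= mul1r subn0.
by rewrite big1 ?addr0 // => i _; rewrite mul0r.
Qed.
Fact mulD : left_distributive mul add.
Proof.
move=> f g h; apply: pseriesP => n /=; rewrite -big_split /=.
by apply: eq_bigr => i _; rewrite mulrDl.
Qed.
Fact one_neq0 : one != zero.
Proof. by apply/eqP => /(congr1 (coefs^~ 0%N))/eqP; rewrite /= oner_eq0. Qed.

HB.instance Definition _ :=
  GRing.Zmodule_isComNzRing.Build pseries mulA mulC mul1 mulD one_neq0.

End PSeriesRing.
HB.export PSeriesRing.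

Lemma coefs0 n : coefs 0 n = 0. Proof. by []. Qed.
Lemma coefs1 n : coefs 1 n = (n == 0%N)%:R. Proof. by []. Qed.
Lemma coefsD f g n : coefs (f + g) n = coefs f n + coefs g n.
Proof. by []. Qed.
Lemma coefsN f n : coefs (- f) n = - coefs f n. Proof. by []. Qed.
Lemma coefsB f g n : coefs (f - g) n = coefs f n - coefs g n.
Proof. by []. Qed.
Lemma coefsM f g n :
  coefs (f * g) n = \sum_(i < n.+1) coefs f i * coefs g (n - i)%N.
Proof. by []. Qed.
Lemma coefs_sum (I : Type) (r : seq I) (P : pred I) (F : I -> pseries) n :
  coefs (\sum_(i <- r | P i) F i) n = \sum_(i <- r | P i) coefs (F i) n.
Proof. by elim/big_rec2: _ => //= i x y _ <-. Qed.

Definition ord_ge k (f : pseries) := forall i, (i < k)%N -> coefs f i = 0.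

Lemma ord_geM j k f g : ord_ge j f -> ord_ge k g -> ord_ge (j + k) (f * g).
Proof.
move=> fj gk i lt_i; rewrite coefsM big1 // => m _.
case: (ltnP m j) => [/fj -> | le_jm]; first by rewrite mul0r.
by rewrite gk ?mulr0 //; have := ltn_ord m; lia.
Qed.

Lemma ord_geX f k : coefs f 0 = 0 -> ord_ge k (f ^+ k).
Proof.
move=> f0; elim: k => // k IH; rewrite exprS -add1n; apply: ord_geM => //.
by case.
Qed.

Lemma ord_ge_coefM k f g h : ord_ge k (f - g) ->
  forall i, (i < k)%N -> coefs (h * f) i = coefs (h * g) i.
Proof.
move=> fg i lt_ik; apply/eqP; rewrite -subr_eq0 -coefsB -mulrBr.
by rewrite (ord_geM (j := 0) (f := h) _ fg).
Qed.

Module PSeriesDomain.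

Definition pdefect (f : pseries) :=
  PSeries (fun n => (n == 0%N)%:R - (coefs f 0)^-1 * coefs f n).

(** The geometric series of [pdefect f], that is 1 - f/f(0). Its [k]-th power has order at least
    [k], so coefficient [n] is already final in the sum cut at [k = n]. *)
Definition pinv (f : pseries) : pseries :=
  PSeries (fun n =>
    (coefs f 0)^-1 * coefs (\sum_(k < n.+1) pdefect f ^+ k) n).

Lemma mulVp f : coefs f 0 != 0 -> pinv f * f = 1.
Proof.
move=> f0; rewrite /pinv; set a := (coefs f 0)^-1; set h := pdefect f.
have h0 : coefs h 0 = 0 by rewrite /= mulVf // subrr.
pose c (x : rat) := PSeries (fun n => x * (n == 0%N)%:R).
have cM x g n : coefs (c x * g) n = x * coefs g n.
  rewrite coefsM big_ord_recl /= mulr1 subn0 big1 ?addr0 // => i _.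
  by rewrite mulr0 mul0r.
have fE : f = c (coefs f 0) * (1 - h).
  apply: pseriesP => n; rewrite cM coefsB coefs1 /= opprB addrC subrK.
  by rewrite mulrA mulfV // mul1r.
pose s n := \sum_(k < n.+1) h ^+ k.
have gE : PSeries (fun n => a * coefs (s n) n)
  = c a * PSeries (fun n => coefs (s n) n).
  by apply: pseriesP => n; rewrite cM.
rewrite {1}gE [X in _ * X]fE mulrACA.
have -> : c a * c (coefs f 0) = 1.
  apply: pseriesP => n; rewrite cM /= mulrA mulVf // mul1r.
  by [].
rewrite mul1r mulrC; apply: pseriesP => n.
have close : ord_ge n.+1 (PSeries (fun n => coefs (s n) n) - s n).
  move=> i lt_i; rewrite coefsB /= -coefsB.
  have -> : s n = s i + \sum_(i.+1 <= k < n.+1) h ^+ k.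
    by rewrite /s -!(big_mkord predT) -big_cat_nat.
  rewrite opprD addNKr coefsN coefs_sum big_nat big1 ?oppr0 // => k /andP[ik _].
  by rewrite (@ord_geX h k).
rewrite (ord_ge_coefM _ close) //.
have -> : (1 - h) * s n = 1 - h ^+ n.+1.
  by rewrite -opprB mulNr -subrX1 opprB.
by rewrite coefsB (@ord_geX h n.+1) ?subr0.
Qed.

Definition punit f := coefs f 0 != 0.
Definition pinv_or f := if coefs f 0 == 0 then f else pinv f.

Fact mulVx : {in punit, left_inverse 1 pinv_or *%R}.
Proof. by move=> f f0; rewrite /pinv_or (negPf f0) mulVp. Qed.

Fact unitPl f g : g * f = 1 -> punit f.
Proof.
move=> /(congr1 (coefs^~ 0%N)); rewrite /punit /= big_ord1 subn0.
by move=> gf; apply/eqP => f0; move/eqP: gf; rewrite f0 mulr0.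
Qed.

Fact inv_out : {in [predC punit], pinv_or =1 id}.
Proof. by move=> f; rewrite inE /= /pinv_or negbK => ->. Qed.

HB.instance Definition _ :=
  GRing.ComNzRing_hasMulInverse.Build pseries mulVx unitPl inv_out.

Lemma neq0_lowest (f : pseries) : f != 0 ->
  exists n, coefs f n != 0 /\ ord_ge n f.
Proof.
move=> nzf; have : exists n, coefs f n != 0.
  apply: contrapT => all0; case/eqP: nzf; apply: pseriesP => n.
  by apply/eqP; apply: contrapT => /negP fn; apply: all0; exists n.
move=> ex; case: (ex_minnP ex) => n fn minn; exists n; split=> // i lt_in.
by apply/eqP; apply: contraTT lt_in => /minn; rewrite -leqNgt.
Qed.

Fact integral : GRing.integral_domain_axiom pseries.
Proof.
move=> f g fg0; apply/norP => -[/neq0_lowest[m [fm mf]] /neq0_lowest[n [gn ng]]].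
have /eqP := congr1 (coefs^~ (m + n)%N) fg0; rewrite coefsM.
have lt_m : (m < (m + n).+1)%N by lia.
rewrite (bigD1 (Ordinal lt_m)) //= big1 ?addr0 => [|i /eqP/val_eqP /= im].
  by rewrite addKn mulf_eq0 (negPf fm) (negPf gn).
case: (ltnP i m) => [/mf -> | le_mi]; first by rewrite mul0r.
by rewrite ng ?mulr0 //; have := ltn_ord i; lia.
Qed.

HB.instance Definition _ := GRing.ComUnitRing_isIntegral.Build pseries integral.

End PSeriesDomain.
HB.export PSeriesDomain.

Lemma pseries_unit f : (f \is a GRing.unit) = (coefs f 0 != 0).
Proof. by []. Qed.

Record fraction_field (R : idomainType) := FractionField {
  frac_sort : fieldType;
  frac_emb : {rmorphism R -> frac_sort};
  frac_inj : injective frac_emb;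
  frac_div : forall x, exists f g, g != 0 /\ x = frac_emb f / frac_emb g
}.

(* The proof is kept opaque: reductions inside [{fraction pseries}] make the
   ring and field tactics diverge. *)
Lemma laurent_field : fraction_field pseries.
Proof.
exists {fraction pseries} (@tofrac pseries).
  by move=> f g /eqP; rewrite tofrac_eq => /eqP.
elim/quotW => r; case: r => -[f g] /= nz; exists f, g; split=> //.
have gK : tofrac g != 0 by rewrite tofrac_eq0.
apply: (mulIf gK); rewrite divfK //; rewrite [LHS]piE [RHS]piE.
apply/eqmodP; rewrite /= FracField.equivfE /FracField.mulf /=.
by rewrite !numden_Ratio ?oner_eq0 ?mulr1 ?mul1r // ?mulf_neq0 // mulrC.
Qed.

Definition K : fieldType := frac_sort laurent_field.
Definition emb : {rmorphism pseries -> K} := frac_emb laurent_field.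
Local Notation "f %:F" := (emb f) : ring_scope.

Lemma emb_eq (f g : pseries) : (f%:F == g%:F) = (f == g).
Proof. exact: inj_eq (@frac_inj _ laurent_field) _ _. Qed.

Lemma emb_eq0 (f : pseries) : (f%:F == 0) = (f == 0).
Proof. by rewrite -emb_eq rmorph0. Qed.

Definition pX := PSeries (fun n => (n == 1%N)%:R).

Lemma coefs_pXM f n : coefs (pX * f) n = if n is m.+1 then coefs f m else 0.
Proof.
rewrite coefsM; case: n => [|n]; first by rewrite big_ord1 mul0r.
rewrite big_ord_recl mul0r add0r big_ord_recl /= mul1r subSS subn0.
by rewrite big1 ?addr0 // => i _; rewrite mul0r.
Qed.

Lemma coefs_pXnM k f n :
  coefs (pX ^+ k * f) n = if (k <= n)%N then coefs f (n - k)%N else 0.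
Proof.
elim: k n => [|k IH] n; first by rewrite mul1r subn0.
by rewrite exprS -mulrA coefs_pXM; case: n => // n; rewrite IH.
Qed.

Lemma ord_geP k f : ord_ge k f -> exists g, f = pX ^+ k * g.
Proof.
move=> fk; exists (PSeries (fun n => coefs f (n + k)%N)); apply: pseriesP => n.
rewrite coefs_pXnM; case: leqP => [le_kn | /fk //]; by rewrite /= subnK.
Qed.

Lemma ord_ge_pXM k f : ord_ge k (pX ^+ k * f).
Proof. by move=> i lt_ik; rewrite coefs_pXnM leqNgt lt_ik. Qed.

Lemma pX_neq0 : pX != 0.
Proof.
by apply/eqP => /(congr1 (coefs^~ 1%N))/eqP; rewrite /= oner_eq0.
Qed.

(** * The valuation at q *)

Definition q : K := pX%:F.

Lemma q_neq0 : q != 0. Proof. by rewrite emb_eq0 pX_neq0. Qed.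

Lemma qD (a b : int) : q ^ (a + b) = q ^ a * q ^ b.
Proof. by rewrite expfzDr // q_neq0. Qed.

Lemma qz_neq0 (a : int) : q ^ a != 0. Proof. exact: expfz_neq0 q_neq0. Qed.

(* The [q]-adic valuation of [x] is at least [k]. *)
Definition V (k : int) (x : K) := exists f, x = q ^ k * f%:F.

Lemma V0 k : V k 0. Proof. by exists 0; rewrite rmorph0 mulr0. Qed.

Lemma V_series f : V 0 f%:F. Proof. by exists f; rewrite mul1r. Qed.

Lemma V_q k : V k (q ^ k). Proof. by exists 1; rewrite rmorph1 mulr1. Qed.

Lemma V1 : V 0 1. Proof. exact: V_q 0. Qed.

Lemma VD k x y : V k x -> V k y -> V k (x + y).
Proof. by case=> f -> [g ->]; exists (f + g); rewrite rmorphD mulrDr. Qed.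

Lemma VN k x : V k x -> V k (- x).
Proof. by case=> f ->; exists (- f); rewrite rmorphN mulrN. Qed.

Lemma VB k x y : V k x -> V k y -> V k (x - y).
Proof. by move=> Vx Vy; apply: VD => //; apply: VN. Qed.

Lemma VM j k x y : V j x -> V k y -> V (j + k) (x * y).
Proof.
by case=> f -> [g ->]; exists (f * g); rewrite rmorphM qD mulrACA.
Qed.

Lemma VM0 k x y : V k x -> V 0 y -> V k (x * y).
Proof. by move=> Vx Vy; rewrite -[k]addr0; apply: VM. Qed.

Lemma V_le j k x : j <= k -> V k x -> V j x.
Proof.
move=> le_jk [f ->]; exists (pX ^+ `|k - j|%N * f).
rewrite rmorphM rmorphXn -/q mulrA; congr (_ * _).
rewrite -[q ^+ _]/(q ^ (`|k - j|%N%:Z)) -qD; congr (_ ^ _); lia.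
Qed.

Lemma V_nat n : V 0 n%:R.
Proof. by rewrite -[n%:R](rmorph_nat emb); apply: V_series. Qed.

Lemma V_sum k (I : Type) (r : seq I) (P : pred I) (F : I -> K) :
  (forall i, P i -> V k (F i)) -> V k (\sum_(i <- r | P i) F i).
Proof.
move=> VF; elim/big_ind: _ => //; [exact: V0 | exact: VD].
Qed.

Lemma V0_prod (I : Type) (r : seq I) (P : pred I) (F : I -> K) :
  (forall i, P i -> V 0 (F i)) -> V 0 (\prod_(i <- r | P i) F i).
Proof.
move=> VF; elim/big_ind: _ => //; [exact: V1 | exact: VM0].
Qed.

Lemma emb_unit f : coefs f 0 != 0 -> (f%:F)^-1 = (f^-1)%:F.
Proof.
move=> f0; have fU : f \is a GRing.unit by rewrite pseries_unit.
have nz : f%:F != 0 by rewrite emb_eq0; apply: contraNneq f0 => ->.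
by apply: (mulfI nz); rewrite mulfV // -rmorphM divrr // rmorph1.
Qed.

Lemma laurentP (x : K) : x != 0 ->
  exists k f, coefs f 0 != 0 /\ x = q ^ k * f%:F.
Proof.
have norm (f : pseries) : f != 0 ->
    exists n (g : pseries), coefs g 0 != 0 /\ f%:F = q ^+ n * g%:F.
  move=> /PSeriesDomain.neq0_lowest[n [fn /ord_geP[g fE]]]; exists n, g; split.
    by move: fn; rewrite fE coefs_pXnM leqnn subnn.
  by rewrite fE rmorphM rmorphXn.
case: (@frac_div _ laurent_field x) => f [g [nzg ->]] nzx.
have nzf : f != 0.
  by apply: contraNneq nzx => ->; rewrite rmorph0 mul0r.
have [m [f' [f0 ->]]] := norm f nzf; have [n [g' [g0 ->]]] := norm g nzg.
exists (m%:Z - n%:Z), (f' / g'); split.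
  by rewrite -pseries_unit unitrM unitrV !pseries_unit f0 g0.
rewrite invfM rmorphM -emb_unit // qD mulrACA; congr (_ * _ * _).
by rewrite exprnN.
Qed.

Lemma V_lb x : exists k, V k x.
Proof.
have [-> | /laurentP[k [f [_ ->]]]] := eqVneq x 0; first by exists 0; apply: V0.
by exists k, f.
Qed.

Lemma V_all_eq0 x : (forall k, V k x) -> x = 0.
Proof.
move=> Vx; apply/eqP; apply: contrapT => /negP /laurentP[k [f [f0 xE]]].
have [g] := Vx (k + 1); rewrite xE qD -mulrA => /(mulfI (qz_neq0 k)).
rewrite expr1z -rmorphM => /eqP; rewrite emb_eq => /eqP fE.
by move: f0; rewrite fE coefs_pXM eqxx.
Qed.

Lemma V0_seriesP x : V 0 x -> exists f, x = f%:F.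
Proof. by case=> f ->; exists f; rewrite mul1r. Qed.

Lemma V_ord_ge k f : V k%:Z f%:F -> ord_ge k f.
Proof.
case=> g; rewrite -exprnP -rmorphXn -rmorphM => /eqP; rewrite emb_eq.
by move=> /eqP ->; apply: ord_ge_pXM.
Qed.

Lemma ord_ge_V k f : ord_ge k f -> V k%:Z f%:F.
Proof. by case/ord_geP => g ->; exists g; rewrite rmorphM rmorphXn. Qed.

Definition one_unit x := V 1 (x - 1).

Lemma one_unitM x y : one_unit x -> one_unit y -> one_unit (x * y).
Proof.
rewrite /one_unit => Vx Vy.
have -> : x * y - 1 = (x - 1) * (y - 1) + (x - 1) + (y - 1) by ring.
apply: VD => //; apply: VD => //; apply: VM0 => //; exact: V_le Vy.
Qed.

Lemma one_unitE x : one_unit x -> exists2 f, coefs f 0 = 1 & x = f%:F.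
Proof.
case=> g; rewrite expr1z => /eqP; rewrite subr_eq => /eqP ->.
exists (pX * g + 1); last by rewrite rmorphD rmorphM rmorph1.
by rewrite coefsD coefs_pXM coefs1 add0r.
Qed.

Lemma one_unitV x : one_unit x -> one_unit x^-1.
Proof.
move=> Ux; case: (one_unitE Ux) => f f0 xE; rewrite /one_unit.
have nz : coefs f 0 != 0 by rewrite f0 oner_eq0.
have nzx : x != 0.
  by rewrite xE emb_eq0; apply: contraNneq nz => ->.
have -> : x^-1 - 1 = (x - 1) * - x^-1 by field; rewrite nzx.
by (apply: VM0 => //; apply: VN; rewrite [in X in V _ X]xE emb_unit //; exact: V_series).
Qed.

Lemma one_unit_neq0 x : one_unit x -> x != 0.
Proof.
case/one_unitE => f f0 ->; rewrite emb_eq0; apply/eqP => fE.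
by move/eqP: f0; rewrite fE eq_sym oner_eq0.
Qed.

Lemma one_unit_V0 x : one_unit x -> V 0 x.
Proof. by case/one_unitE => f _ ->; apply: V_series. Qed.

Lemma one_unit1 : one_unit 1. Proof. by rewrite /one_unit subrr; apply: V0. Qed.

Lemma one_unit_prod (I : Type) (r : seq I) (P : pred I) (F : I -> K) :
  (forall i, P i -> one_unit (F i)) -> one_unit (\prod_(i <- r | P i) F i).
Proof.
move=> VF; elim/big_ind: _ => //; [exact: one_unit1 | exact: one_unitM].
Qed.

(** * Limits for the q-adic topology *)

Definition lim (x : nat -> K) (l : K) :=
  forall k : int, exists M0, forall M, (M0 <= M)%N -> V k (x M - l).

Lemma lim_unique x l l' : lim x l -> lim x l' -> l = l'.
Proof.
move=> xl xl'; apply/eqP; rewrite -subr_eq0; apply/eqP/V_all_eq0 => k.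
have [M Ml] := xl k; have [M' Ml'] := xl' k.
have -> : l - l' = (x (maxn M M') - l') - (x (maxn M M') - l) by ring.
by apply: VB; [apply: Ml'; rewrite leq_maxr | apply: Ml; rewrite leq_maxl].
Qed.

Lemma lim_cst l : lim (fun=> l) l.
Proof. by move=> k; exists 0%N => M _; rewrite subrr; apply: V0. Qed.

Lemma limD x y l m : lim x l -> lim y m -> lim (fun M => x M + y M) (l + m).
Proof.
move=> xl ym k; have [M Ml] := xl k; have [N Nm] := ym k.
exists (maxn M N) => j; rewrite geq_max => /andP[/Ml Vx /Nm Vy].
have -> : x j + y j - (l + m) = (x j - l) + (y j - m) by ring.
exact: VD.
Qed.

Lemma limM x y l m : lim x l -> lim y m -> lim (fun M => x M * y M) (l * m).
Proof.
move=> xl ym k; have [a Va] := V_lb l; have [b Vb] := V_lb m.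
have [M1 x0] := xl 0; have [M Ml] := xl (k - b); have [N Nm] := ym k.
have [N' Nm'] := ym (k - a).
exists (maxn (maxn M1 M) (maxn N N')) => j.
rewrite !geq_max => /andP[/andP[/x0 X0 /Ml X] /andP[/Nm Y /Nm' Y']].
have -> : x j * y j - l * m
  = (y j - m) * (x j - l) + (y j - m) * l + (x j - l) * m by ring.
apply: VD; first apply: VD; first exact: VM0.
  by rewrite -[k](subrK a); apply: VM.
by rewrite -[k](subrK b); apply: VM.
Qed.

Lemma limN x l : lim x l -> lim (fun M => - x M) (- l).
Proof.
by move=> xl k; have [M Ml] := xl k; exists M => j /Ml; rewrite -opprD; apply: VN.
Qed.

Lemma limB x y l m : lim x l -> lim y m -> lim (fun M => x M - y M) (l - m).
Proof. by move=> xl /limN; apply: limD. Qed.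

Lemma lim_ext x y l : (exists N, forall M, (N <= M)%N -> x M = y M) ->
  lim x l -> lim y l.
Proof.
case=> N xy xl k; have [M Ml] := xl k; exists (maxn N M) => j.
by rewrite geq_max => /andP[/xy <- /Ml].
Qed.

Lemma lim_comp x l (s : nat -> nat) : (forall B, exists N, forall M, (N <= M)%N ->
  (B <= s M)%N) -> lim x l -> lim (fun M => x (s M)) l.
Proof.
move=> sB xl k; have [M Ml] := xl k; have [N sN] := sB M.
by exists N => j /sN /Ml.
Qed.

Lemma lim_sum (I : Type) (r : seq I) (P : pred I) (x : I -> nat -> K) (l : I -> K) :
  (forall i, P i -> lim (x i) (l i)) ->
  lim (fun M => \sum_(i <- r | P i) x i M) (\sum_(i <- r | P i) l i).
Proof.
move=> xl; elim: r => [|i r IH].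
  apply: (lim_ext (x := fun=> 0)); first by exists 0%N => M _; rewrite big_nil.
  by rewrite big_nil; apply: lim_cst.
rewrite big_cons; case: ifP => Pi; last first.
  by apply: lim_ext IH; exists 0%N => M _; rewrite big_cons Pi.
apply: lim_ext (limD (xl i Pi) IH).
by exists 0%N => M _; rewrite big_cons Pi.
Qed.

Lemma lim_prod (I : Type) (r : seq I) (P : pred I) (x : I -> nat -> K) (l : I -> K) :
  (forall i, P i -> lim (x i) (l i)) ->
  lim (fun M => \prod_(i <- r | P i) x i M) (\prod_(i <- r | P i) l i).
Proof.
move=> xl; elim: r => [|i r IH].
  apply: (lim_ext (x := fun=> 1)); first by exists 0%N => M _; rewrite big_nil.
  by rewrite big_nil; apply: lim_cst.
rewrite big_cons; case: ifP => Pi; last first.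
  by apply: lim_ext IH; exists 0%N => M _; rewrite big_cons Pi.
apply: lim_ext (limM (xl i Pi) IH).
by exists 0%N => M _; rewrite big_cons Pi.
Qed.

Lemma lim_V k x l : (forall M, V k (x M)) -> lim x l -> V k l.
Proof.
move=> Vx xl; have [M /(_ M (leqnn M)) Ml] := xl k.
have -> : l = x M - (x M - l) by ring.
exact: VB.
Qed.

Lemma limV x l : l != 0 -> lim x l -> lim (fun M => (x M)^-1) l^-1.
Proof.
move=> nzl; have [a [f [f0 lE]]] := laurentP nzl => xl k.
have Vinv : V (- a) l^-1.
  rewrite lE invfM emb_unit // invr_expz; exact: VM0 (V_q _) (V_series _).
have [M1 M1l] := xl (a + 1); have [M2 M2l] := xl (k + a + a).
exists (maxn M1 M2) => j; rewrite geq_max => /andP[/M1l V1x /M2l V2x].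
have Ux : one_unit (x j / l).
  rewrite /one_unit; have -> : x j / l - 1 = (x j - l) * l^-1 by field.
  by have := VM V1x Vinv; congr V; ring.
have nzx : x j != 0.
  by apply: contraTneq (one_unit_neq0 Ux) => ->; rewrite mul0r eqxx.
have -> : (x j)^-1 - l^-1 = - ((x j - l) * l^-1 * l^-1 * (x j / l)^-1).
  by field; rewrite nzl nzx.
apply: VN; apply: VM0; last exact: one_unit_V0 (one_unitV Ux).
have -> : k = k + a + a + - a + - a by ring.
by do 2!apply: VM => //.
Qed.

Lemma lim_exists x :
  (forall k : int, exists M0, forall M, (M0 <= M)%N -> V k (x M.+1 - x M)) ->
  exists l, lim x l.
Proof.
move=> cauchy.
have cauchy2 k : exists M0, forall M N, (M0 <= M)%N -> (M <= N)%N ->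
    V k (x N - x M).
  have [M0 M0P] := cauchy k; exists M0 => M N le0M le_MN.
  rewrite -(subnK le_MN); elim: (N - M)%N => [|d IH]; first by rewrite subrr; apply: V0.
  have -> : x (d.+1 + M)%N - x M = (x (d + M).+1 - x (d + M)%N) + (x (d + M)%N - x M).
    by rewrite addSn; ring.
  by apply: VD => //; apply: M0P; lia.
have /choice[mu muP] : forall k : nat, exists M0, forall M N, (M0 <= M)%N ->
    (M <= N)%N -> V k%:Z (x N - x M) by move=> k; apply: cauchy2.
have /choice[y yP] : forall M, exists f : pseries,
    (mu 0 <= M)%N -> x M - x (mu 0) = f%:F.
  move=> M; case: (leqP (mu 0) M) => [le0M|]; last by exists 0.
  by have /V0_seriesP[f fE] := muP 0%N _ _ (leqnn _) le0M; exists f.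
pose m n := maxn (mu 0) (mu n.+1).
(* From index [mu 0] on, [x M - x (mu 0)] is a power series [y M]. Its coefficient [n] is stationary
   from index [m n] on, and these stationary values make up the limit. *)
pose f := PSeries (fun n => coefs (y (m n)) n).
exists (x (mu 0) + f%:F) => k.
have [n le_kn] : exists n : nat, k <= n%:Z by exists `|k|%N; lia.
exists (\max_(i < n.+1) m i)%N => M leM.
have leM' (i : 'I_n.+1) : (m i <= M)%N by apply: leq_trans leM; apply: leq_bigmax.
have le0M : (mu 0 <= M)%N by apply: leq_trans (leM' ord0); rewrite leq_maxl.
apply: V_le le_kn _; rewrite opprD addrA yP // -rmorphB; apply: ord_ge_V => i lt_in.
have lt_in1 : (i < n.+1)%N by lia.
have le_miM := leM' (Ordinal lt_in1); rewrite /= in le_miM.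
have : V i.+1%:Z (x M - x (m i)) by apply: muP; rewrite // leq_maxr.
have -> : x M - x (m i) = (y M - y (m i))%:F.
  rewrite rmorphB -!yP ?leq_maxl //; ring.
by move=> /V_ord_ge /(_ i (leqnn _)); rewrite !coefsB.
Qed.

(** * Lagrange interpolation *)

Section Lagrange.
Variables (F : fieldType) (I : finType) (p : I -> F).
Hypothesis p_inj : injective p.

Definition lagrange_den i := \prod_(j | j != i) (p i - p j).
Local Notation den := lagrange_den.

Lemma lagrange_den_neq0 i : den i != 0.
Proof.
by apply/prodf_neq0 => j ji; rewrite subr_eq0 (inj_eq p_inj) eq_sym.
Qed.

Lemma size_lagrange_num i : size (\prod_(j | j != i) ('X - (p j)%:P)) = #|I|.
Proof.
have -> : \prod_(j | j != i) ('X - (p j)%:P)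
        = \prod_(j <- enum (predC1 i)) ('X - (p j)%:P) by rewrite big_enum.
by rewrite size_prod_XsubC -cardE cardC1 prednK //; apply/card_gt0P; exists i.
Qed.

Lemma lagrange_interpolation (f : {poly F}) : (size f <= #|I|)%N ->
  f = \sum_i (f.[p i] / den i) *: \prod_(j | j != i) ('X - (p j)%:P).
Proof.
move=> sz_f; apply/eqP; rewrite -subr_eq0; apply/eqP.
apply: (@roots_geq_poly_eq0 _ _ [seq p i | i : I]).
- apply/allP => _ /imageP[i _ ->]; rewrite /root hornerD hornerN horner_sum.
  rewrite (bigD1 i) //= [X in - (_ + X)]big1 ?addr0 => [|j ji].
    rewrite hornerZ horner_prod.
    under eq_bigr do rewrite hornerXsubC.
    by rewrite divfK ?subrr // lagrange_den_neq0.
  rewrite hornerZ horner_prod (bigD1 i) //= 1?eq_sym // hornerXsubC subrr.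
  by rewrite mul0r mulr0.
- by rewrite map_inj_uniq ?enum_uniq.
rewrite size_map -cardE; apply: leq_trans (size_polyD _ _) _.
rewrite geq_max sz_f size_polyN /=; apply: (leq_trans (size_sum _ _ _)).
apply/bigmax_leqP => i _; apply: leq_trans (size_scale_leq _ _) _.
by rewrite size_lagrange_num.
Qed.

(** Compares coefficients of degree [#|I| - 1] in the interpolation formula: that of [f] is zero,
    and each basis product is monic of this degree. *)
Lemma lagrange_sum0 (f : {poly F}) : (size f < #|I|)%N ->
  \sum_i f.[p i] / den i = 0.
Proof.
move=> sz_f; have := congr1 (fun g : {poly F} => g`_(#|I|.-1)) (lagrange_interpolation (ltnW sz_f)).
rewrite nth_default; last by case: #|I| sz_f.
rewrite coef_sum => e; rewrite [RHS]e; apply: eq_bigr => i _.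
rewrite coefZ; suff -> : (\prod_(j | j != i) ('X - (p j)%:P))`_(#|I|.-1) = 1 by rewrite mulr1.
have := monic_prod_XsubC (index_enum I) (fun j => j != i) p.
by rewrite monicE /lead_coef size_lagrange_num => /eqP.
Qed.

Lemma lagrange_eval (f : {poly F}) x : (size f <= #|I|)%N ->
    (forall i, x != p i) ->
  \sum_i f.[p i] / den i / (x - p i) = f.[x] / \prod_i (x - p i).
Proof.
move=> sz_f xp; rewrite {2}(lagrange_interpolation sz_f) horner_sum mulr_suml.
apply: eq_bigr => i _; rewrite hornerZ horner_prod.
have -> : \prod_j (x - p j) = (x - p i) * \prod_(j | j != i) (x - p j).
  by rewrite (bigD1 i).
under [in RHS]eq_bigr do rewrite hornerXsubC.
have nz : \prod_(j | j != i) (x - p j) != 0.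
  by apply/prodf_neq0 => j _; rewrite subr_eq0.
have nzi : x - p i != 0 by rewrite subr_eq0.
by field; rewrite nz nzi lagrange_den_neq0.
Qed.

(** The known root [x0] buys one more degree: interpolation is applied to the cofactor [g], and the
    factors [X - x0] are put back at the nodes and at [x]. *)
Lemma lagrange_eval_root (g : {poly F}) x0 x : (size g <= #|I|)%N ->
    (forall i, x != p i) -> (forall i, x0 != p i) ->
  \sum_i (g * ('X - x0%:P)).[p i] / den i * ((x - x0) / (p i - x0) / (x - p i))
  = (g * ('X - x0%:P)).[x] / \prod_i (x - p i).
Proof.
move=> sz_g xp x0p; rewrite hornerM hornerXsubC mulrAC -lagrange_eval // mulr_suml.
apply: eq_bigr => i _; rewrite hornerM hornerXsubC.
have nz0 : p i - x0 != 0 by rewrite subr_eq0 eq_sym.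
have nzi : x - p i != 0 by rewrite subr_eq0.
by field; rewrite nz0 nzi lagrange_den_neq0.
Qed.

Lemma deriv_prod_XsubC (s : seq F) x : x \notin s ->
  (\prod_(c <- s) ('X - c%:P))^`().[x]
  = \prod_(c <- s) (x - c) * \sum_(c <- s) (x - c)^-1.
Proof.
elim: s => [_|c s IH]; first by rewrite !big_nil derivC horner0 mulr0.
rewrite inE negb_or => /andP[xc /IH IHs]; rewrite !big_cons derivM hornerD.
rewrite !hornerM derivXsubC hornerC hornerXsubC IHs mul1r horner_prod.
under eq_bigr do rewrite hornerXsubC.
have nzc : x - c != 0 by rewrite subr_eq0.
by field.
Qed.

(** Substitute for evaluation at a point that is itself a node: the interpolation formula is
    differentiated at [p i0], and the basis product of [i0] yields the sum of inverses. *)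
Lemma lagrange_double_node (f : {poly F}) i0 : (size f <= #|I|)%N ->
  \sum_(i | i != i0) f.[p i] / den i / (p i0 - p i)
  = f^`().[p i0] / den i0
    - f.[p i0] / den i0 * \sum_(j | j != i0) (p i0 - p j)^-1.
Proof.
move=> sz_f.
have /(congr1 (fun g : {poly F} => g^`().[p i0])) := lagrange_interpolation sz_f.
rewrite linear_sum horner_sum (bigD1 i0) //= => ->.
have -> : (\prod_(j | j != i0) ('X - (p j)%:P))
  = \prod_(c <- [seq p j | j <- enum (predC1 i0)]) ('X - c%:P).
  by rewrite big_map big_enum.
rewrite linearZ hornerZ /= deriv_prod_XsubC; last first.
  apply/mapP => -[j]; rewrite mem_enum inE /= => /negP ji /p_inj ij.
  by apply: ji; rewrite ij.
rewrite !big_map !big_enum /= -/(den i0) mulrDl.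
have nz0 := lagrange_den_neq0 i0.
set S := \sum_(j | _) (p i0 - p j)^-1.
have -> : f.[p i0] / den i0 * (den i0 * S) / den i0 = f.[p i0] / den i0 * S.
  by field.
rewrite [RHS]addrAC subrr add0r mulr_suml.
apply: eq_bigr => i ii0; rewrite linearZ hornerZ /=.
rewrite (bigD1 i0) 1?eq_sym //= derivM hornerD !hornerM derivXsubC hornerC mul1r.
rewrite hornerXsubC subrr mul0r addr0 horner_prod.
under [in RHS]eq_bigr do rewrite hornerXsubC.
have -> : den i0 = (p i0 - p i)
    * \prod_(j | (j != i) && (j != i0)) (p i0 - p j).
  by rewrite /den (bigD1 i) //=; congr (_ * _); apply: eq_bigl => j; apply: andbC.
have nzi : p i0 - p i != 0 by rewrite subr_eq0 (inj_eq p_inj) eq_sym.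
have nz : \prod_(j | (j != i) && (j != i0)) (p i0 - p j) != 0.
  by apply/prodf_neq0 => j /andP[_ ji]; rewrite subr_eq0 (inj_eq p_inj) eq_sym.
by field; rewrite nzi nz lagrange_den_neq0.
Qed.
End Lagrange.

(** * Valuations of the factors 1 - q^a *)

Lemma one_unitBq (a : int) : 0 < a -> one_unit (1 - q ^ a).
Proof.
move=> a0; rewrite /one_unit addrAC subrr add0r; apply: VN.
by apply: V_le (V_q a); lia.
Qed.

Lemma oneBqN (a : int) : 1 - q ^ (- a) = - q ^ (- a) * (1 - q ^ a).
Proof. by rewrite mulrBr mulr1 mulNr -qD addNr expr0z opprK addrC. Qed.

Lemma oneBq_neq0 (a : int) : a != 0 -> 1 - q ^ a != 0.
Proof.
move=> a0; case: (ltrP 0 a) => ha; first exact: one_unit_neq0 (one_unitBq ha).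
rewrite -[a]opprK oneBqN mulf_neq0 ?oppr_eq0 ?qz_neq0 //.
by apply: one_unit_neq0; apply: one_unitBq; lia.
Qed.

(** For [a = 0] the inverse is 0 by convention, so the bound is uniform and a Lambert series simply
    loses its term at the pole. *)
Lemma V_invBq (a : int) : V 0 (1 - q ^ a)^-1.
Proof.
have [-> | a0] := eqVneq a 0; first by rewrite expr0z subrr invr0; apply: V0.
case: (ltrP 0 a) => ha; first exact/one_unit_V0/one_unitV/one_unitBq.
rewrite -[a]opprK oneBqN invfM -[- q ^ _]mulN1r invfM invrN1 invr_expz opprK.
apply: VM0; last by apply/one_unit_V0/one_unitV/one_unitBq; lia.
by rewrite mulN1r; apply/VN/(V_le _ (V_q _)); lia.
Qed.

(** * Theta functions and Lambert series *)

Definition tri (m : int) : int := ((m * (m + 1)) %/ 2)%Z.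

Lemma triE m : tri m * 2 = m * (m + 1).
Proof.
rewrite /tri divzK //; apply/dvdzP.
have := divz_eq m 2; have := ltz_pmod m (erefl : 0 < 2 :> int).
have := modz_ge0 m (erefl : 2 != 0 :> int).
set k := (m %/ 2)%Z; set r := (m %% 2)%Z => r0 r2 mE.
have [rE|rE] : r = 0 \/ r = 1 by lia.
  by exists (k * (m + 1)); rewrite mE rE; ring.
by exists (m * (k + 1)); rewrite mE rE; ring.
Qed.

Definition sgn (m : int) : K := (-1) ^ m.

Lemma sgnB (i M : nat) : sgn (i%:Z - M%:Z) = (-1) ^+ i * (-1) ^+ M.
Proof.
rewrite /sgn expfzDr ?oppr_eq0 ?oner_eq0 // -invr_expz -exprnP -exprVn.
by rewrite invrN1.
Qed.

Lemma V_sgn m : V 0 (sgn m).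
Proof.
rewrite /sgn; case: m => n.
  by rewrite -exprnP -signr_odd; case: odd; [apply/VN/V1 | apply: V1].
rewrite NegzE -invr_expz -exprnP -exprVn invrN1 -signr_odd.
by case: odd; [apply/VN/V1 | apply: V1].
Qed.

(** The partial sums run over -M <= m < M, which is the range of the 2M nodes in one residue
    class. *)
Definition hassum (g : int -> K) (G : K) :=
  lim (fun M => \sum_(j < M) (g j%:Z + g (- j.+1%:Z))) G.

Definition summable (g : int -> K) :=
  forall k : int, exists B : nat, forall m : int, (B <= `|m|)%N -> V k (g m).

Lemma hassum_exists g : summable g -> exists G, hassum g G.
Proof.
move=> sg; apply: lim_exists => k; have [B Bg] := sg k; exists B => M leM.
rewrite big_ord_recr /= addrAC subrr add0r; apply: VD; apply: Bg; lia.
Qed.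

Lemma sum_centered (g : int -> K) M :
  \sum_(i < 2 * M) g (i%:Z - M%:Z) = \sum_(j < M) (g j%:Z + g (- j.+1%:Z)).
Proof.
rewrite -(big_mkord predT (fun i : nat => g (i%:Z - M%:Z))).
rewrite (big_cat_nat (n := M)) //=; last by lia.
rewrite big_split /= addrC; congr (_ + _).
  rewrite -{1}[M]add0n big_addn (_ : 2 * M - M = M)%N; last by lia.
  by rewrite big_mkord; apply: eq_bigr => j _; congr g; lia.
rewrite big_mkord (reindex_inj rev_ord_inj) /=; apply: eq_bigr => j _.
by congr g; have := ltn_ord j; lia.
Qed.

Section Theta.
Variable l : nat.
Hypothesis l_gt0 : (0 < l)%N.

Definition U (z : int) : K := q ^ (l%:Z * z).

Lemma UD a b : U (a + b) = U a * U b. Proof. by rewrite /U mulrDr qD. Qed.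
Lemma U0 : U 0 = 1. Proof. by rewrite /U mulr0. Qed.
Lemma U_neq0 a : U a != 0. Proof. exact: qz_neq0. Qed.
Lemma UN a : U (- a) = (U a)^-1. Proof. by rewrite /U mulrN invr_expz. Qed.
Lemma oneBU_neq0 a : a != 0 -> 1 - U a != 0.
Proof. by move=> a0; apply: oneBq_neq0; lia. Qed.
Lemma U_inj : injective U.
Proof.
move=> a b ab; apply/eqP; rewrite -subr_eq0; apply: contraT => /oneBU_neq0.
by rewrite UD UN ab mulfV ?U_neq0 // subrr eqxx.
Qed.
Lemma V_invBU a : V 0 (1 - U a)^-1. Proof. exact: V_invBq. Qed.
Lemma V_U (k a : int) : k <= a -> 0 <= a -> V k (U a).
Proof. by move=> ka a0; apply: V_le (V_q _); nia. Qed.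

(** The Pochhammer symbol [(u^e; u^l)_B] for [u = q^l]; [Qinf] is its limit. *)
Definition Q (e : int) (B : nat) : K := \prod_(j < B) (1 - U (e + l%:Z * j%:Z)).

Lemma Q0 e : Q e 0 = 1. Proof. exact: big_ord0. Qed.

Lemma QS e B : Q e B.+1 = Q e B * (1 - U (e + l%:Z * B%:Z)).
Proof. exact: big_ord_recr. Qed.

Lemma Q_rec e B : Q e B.+1 = (1 - U e) * Q (e + l%:Z) B.
Proof.
rewrite /Q big_ord_recl mulr0 addr0; congr (_ * _); apply: eq_bigr => j _.
by congr (1 - U _); rewrite /= /bump; lia.
Qed.

Lemma V_invQ e B : V 0 (Q e B)^-1.
Proof.
rewrite /Q -prodfV; apply: V0_prod => j _; exact: V_invBU.
Qed.

Lemma one_unitQ e B : 0 < e -> one_unit (Q e B).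
Proof. by move=> e0; apply: one_unit_prod => j _; apply: one_unitBq; nia. Qed.

Lemma lim_Q_exists e : exists x, lim (Q e) x.
Proof.
have pos f : 0 < f -> exists x, lim (Q f) x.
  move=> f0; apply: lim_exists => k; exists `|k|%N => M le_kM.
  rewrite QS mulrBr mulr1 addrAC subrr add0r; apply: VN; rewrite mulrC.
  apply: VM0; last exact/one_unit_V0/one_unitQ.
  by apply: V_U; nia.
have [N] : exists N : nat, 0 < e + l%:Z * N%:Z by exists `|e|.+1; nia.
elim: N e => [|N IH] e; first by rewrite mulr0 addr0; apply: pos.
move=> eN; have [|x lx] := IH (e + l%:Z); first by lia.
exists ((1 - U e) * x) => k.
have [M Mx] := limM (lim_cst (1 - U e)) lx k.
by exists M.+1 => -[|B] // /Mx; rewrite Q_rec.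
Qed.

Definition Qinf e : K := projT1 (cid (lim_Q_exists e)).

Lemma lim_Q e : lim (Q e) (Qinf e).
Proof. exact: projT2 (cid (lim_Q_exists e)). Qed.

Lemma Qinf_rec e : Qinf e = (1 - U e) * Qinf (e + l%:Z).
Proof.
apply: (lim_unique (x := fun B => Q e B.+1)).
  by apply: lim_comp (lim_Q e) => B; exists B => M; lia.
apply: lim_ext (limM (lim_cst _) (lim_Q (e + l%:Z))).
by exists 0%N => M _; rewrite Q_rec.
Qed.

Lemma one_unit_Qinf e : 0 < e -> one_unit (Qinf e).
Proof.
move=> e0; apply: (lim_V (x := fun B => Q e B - 1)) => [M|].
  exact: one_unitQ.
exact: limB (lim_Q e) (lim_cst 1).
Qed.

Lemma Qinf_neq0 e : (forall j : nat, e + l%:Z * j%:Z != 0) -> Qinf e != 0.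
Proof.
have [N] : exists N : nat, 0 < e + l%:Z * N%:Z by exists `|e|.+1; nia.
elim: N e => [|N IH] e.
  by rewrite mulr0 addr0 => e0 _; apply/one_unit_neq0/one_unit_Qinf.
move=> eN ej; rewrite Qinf_rec mulf_neq0 ?oneBU_neq0 //.
  by have := ej 0%N; rewrite mulr0 addr0.
apply: IH => [|j]; first by lia.
by have := ej j.+1; apply: contraNneq; lia.
Qed.

(* The theta function [(u^d; u^l) (u^(l-d); u^l)], where [u = q^l]. *)
Definition Th (d : int) : K := Qinf d * Qinf (l%:Z - d).
Definition J : K := Qinf l%:Z.

Definition ndvd (d : int) := forall j : int, d != l%:Z * j.

Lemma ndvdN d : ndvd d -> ndvd (- d).
Proof. by move=> nd j; have := nd (- j); apply: contraNneq; lia. Qed.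
Lemma ndvdDl d : ndvd d -> ndvd (l%:Z + d).
Proof. by move=> nd j; have := nd (j - 1); apply: contraNneq; lia. Qed.
Lemma ndvdBl d : ndvd d -> ndvd (l%:Z - d).
Proof. by move/ndvdN/ndvdDl. Qed.
Lemma ndvd_prog d (j : int) : ndvd d -> d + l%:Z * j != 0.
Proof. by move=> nd; have := nd (- j); apply: contraNneq; lia. Qed.
Lemma ndvd_small (d : int) : 0 < d < l%:Z -> ndvd d.
Proof.
move=> /andP[d0 dl] j; apply/eqP => dE.
have [j0|j0] : j <= 0 \/ 1 <= j by lia.
  nia.
nia.
Qed.
Lemma ndvd_opp_small (d : int) : - l%:Z < d < 0 -> ndvd d.
Proof.
by move=> d0; rewrite -[d]opprK; apply/ndvdN/ndvd_small; lia.
Qed.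

Lemma Th_neq0 d : ndvd d -> Th d != 0.
Proof.
move=> nd; rewrite mulf_neq0 // Qinf_neq0 // => j; apply: ndvd_prog => //.
exact: ndvdBl.
Qed.

Lemma J_neq0 : J != 0. Proof. by apply: Qinf_neq0 => j; lia. Qed.

Lemma Th_refl d : Th (l%:Z - d) = Th d.
Proof. by rewrite /Th mulrC; congr (Qinf _ * _); ring. Qed.

Lemma ThN d : ndvd d -> Th (- d) = - U (- d) * Th d.
Proof.
move=> nd; rewrite /Th (Qinf_rec (- d)) (Qinf_rec d) opprK UN.
have -> : - d + l%:Z = l%:Z - d by ring.
have -> : l%:Z + d = d + l%:Z by ring.
by field; rewrite U_neq0.
Qed.

Definition geo (z : int) : K := U z / (1 - U z).

Lemma geoN z : z != 0 -> geo (- z) = - 1 - geo z.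
Proof.
move=> z0; rewrite /geo UN; have := oneBU_neq0 z0; have := U_neq0 z.
move=> nz nz1; field; rewrite nz1 nz /=.
by rewrite -oppr_eq0 opprB.
Qed.

Lemma V_geo (k z : int) : k <= z -> 0 <= z -> V k (geo z).
Proof. by move=> kz z0; apply: VM0 (V_invBU _); apply: V_U. Qed.

Definition Lsum (b : int) (M : nat) : K :=
  \sum_(j < M) (geo (b + l%:Z * j%:Z) - geo (l%:Z - b + l%:Z * j%:Z)).

Lemma lim_L_exists b : exists x, lim (Lsum b) x.
Proof.
apply: lim_exists => k; exists (`|k| + `|b|)%N => M leM.
rewrite /Lsum big_ord_recr /= addrAC subrr add0r.
by apply: VB; apply: V_geo; nia.
Qed.

(* Minus the logarithmic derivative of the theta function [Th] at [u^b], [u = q^l]. *)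
Definition L b : K := projT1 (cid (lim_L_exists b)).

Lemma lim_L b : lim (Lsum b) (L b).
Proof. exact: projT2 (cid (lim_L_exists b)). Qed.

Lemma L_refl b : L (l%:Z - b) = - L b.
Proof.
apply: lim_unique (lim_L _) _; apply: lim_ext (limN (lim_L b)).
exists 0%N => M _; rewrite -sumrN; apply: eq_bigr => j _.
rewrite opprB; congr (geo _ - geo _); ring.
Qed.

(** The shift moves both progressions by one term. At the inner end this leaves -(geo b + geo (-b))
    = 1, and the outer ends vanish in the limit. *)
Lemma L_shift b : ndvd b -> L (b + l%:Z) = L b + 1.
Proof.
move=> nb; apply: lim_unique (lim_L _) _.
have tl : lim (fun M => Lsum b M + 1
    + (geo (b + l%:Z * M%:Z) + geo (- (b - l%:Z * M%:Z)))) (L b + 1 + 0).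
  apply: limD; first exact: limD (lim_L b) (lim_cst 1).
  move=> k; exists (`|k| + `|b|)%N => M leM; rewrite subr0.
  by apply: VD; apply: V_geo; nia.
rewrite addr0 in tl; apply: lim_ext tl; exists 0%N => M _.
elim: M => [|M IH].
  rewrite /Lsum !big_ord0 add0r.
  have -> : b + l%:Z * 0%N%:Z = b by lia.
  have -> : b - l%:Z * 0%N%:Z = b by lia.
  have b0 : b != 0 by have := nb 0; rewrite mulr0.
  by rewrite geoN //; ring.
rewrite /Lsum big_ord_recr [in RHS]big_ord_recr /=.
rewrite -!/(Lsum _ _) -IH.
have -> : b + l%:Z * M.+1%:Z = b + l%:Z + l%:Z * M%:Z by lia.
have -> : l%:Z - (b + l%:Z) + l%:Z * M%:Z = - (b - l%:Z * M%:Z) by lia.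
have -> : - (b - l%:Z * M.+1%:Z) = l%:Z - b + l%:Z * M%:Z by lia.
ring.
Qed.

Lemma L_opp b : ndvd b -> L (- b) = - 1 - L b.
Proof.
move=> nb; have := L_shift (ndvdN nb); have -> : - b + l%:Z = l%:Z - b by ring.
by rewrite L_refl => ->; ring.
Qed.

Lemma prod_U (I : Type) (r : seq I) (P : pred I) (e : I -> int) :
  \prod_(i <- r | P i) U (e i) = U (\sum_(i <- r | P i) e i).
Proof. by rewrite (big_morph U UD U0). Qed.

(** The monomial that turns [i] factors with reversed exponents into a Pochhammer symbol; the
    quadratic exponents of the theta series originate here. *)
Definition sgU (e : int) (i : nat) : K := (-1) ^+ i * U (e * i%:Z - l%:Z * tri i%:Z).

Lemma prod_neg d i : \prod_(j < i) (1 - U (d - l%:Z * j.+1%:Z))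
  = sgU d i * Q (l%:Z - d) i.
Proof.
elim: i => [|i IH].
  by rewrite big_ord0 Q0 mulr1 /sgU mulr0 sub0r expr0 mul1r
    (_ : tri 0 = 0) // mulr0 oppr0 U0.
rewrite big_ord_recr /= IH QS.
have -> : d - l%:Z * i.+1%:Z = - (l%:Z - d + l%:Z * i%:Z) by lia.
set z := l%:Z - d + l%:Z * i%:Z.
have -> : 1 - U (- z) = - U (- z) * (1 - U z).
  by rewrite UN; field; exact: U_neq0.
rewrite /sgU exprS.
have -> : d * i.+1%:Z - l%:Z * tri i.+1%:Z
    = (d * i%:Z - l%:Z * tri i%:Z) + - z.
  have := triE i%:Z; have := triE i.+1%:Z; rewrite /z.
  by move=> h1 h2; apply: (@mulIf _ 2) => //; nia.
rewrite [U (_ + - z)]UD; ring.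
Qed.

Lemma prod_shift d i N : (i <= N)%N ->
  \prod_(j < N) (1 - U (d + l%:Z * (j%:Z - i%:Z)))
  = sgU d i * Q (l%:Z - d) i * Q d (N - i).
Proof.
move=> le_iN; rewrite -prod_neg.
rewrite -(big_mkord predT (fun j : nat => 1 - U (d + l%:Z * (j%:Z - i%:Z)))).
rewrite (big_cat_nat (n := i)) //=; congr (_ * _).
  rewrite big_mkord (reindex_inj rev_ord_inj) /=; apply: eq_bigr => j _.
  by congr (1 - U _); have := ltn_ord j; nia.
rewrite -{1}[i]add0n big_addn big_mkord; apply: eq_bigr => j _.
by congr (1 - U _); lia.
Qed.

Lemma prod_shift_neq i N : (i < N)%N ->
  \prod_(j < N | j != i :> nat) (1 - U (l%:Z * (j%:Z - i%:Z)))
  = sgU 0 i * Q l%:Z i * Q l%:Z (N - i.+1).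
Proof.
move=> lt_iN; have := prod_neg 0 i; rewrite subr0 => <-.
rewrite -(big_mkord (fun j => j != i)
  (fun j : nat => 1 - U (l%:Z * (j%:Z - i%:Z)))).
rewrite (big_cat_nat (n := i)) //=; last exact: ltnW.
rewrite [X in _ * X]big_ltn_cond // eqxx /=; congr (_ * _).
  rewrite big_nat_cond (eq_bigl (fun j => (0 <= j < i)%N)) => [|j]; last first.
    by case: (ltnP j i) => //= ji; rewrite neq_ltn ji.
  rewrite -big_nat big_mkord (reindex_inj rev_ord_inj) /=; apply: eq_bigr => j _.
  by congr (1 - U _); have := ltn_ord j; nia.
rewrite big_nat_cond (eq_bigl (fun j => (i.+1 <= j < N)%N)) => [|j]; last first.
  by case: (ltnP i j) => //= ji; rewrite neq_ltn ji orbT andbT.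
rewrite -big_nat -{1}[i.+1]add0n big_addn big_mkord; apply: eq_bigr => j _.
by congr (1 - U _); nia.
Qed.

(** * Lagrange denominators at nodes in residue classes *)

Section Nodes.
Variables (C : finType) (al : C -> int).
Hypothesis al_ndvd : forall c c', c' != c -> ndvd (al c' - al c).

Definition node M (x : C * 'I_(2 * M)) : K :=
  U (al x.1 + l%:Z * (x.2%:Z - M%:Z)).

Lemma node_inj M : injective (@node M).
Proof.
move=> [c i] [c' j] /U_inj /= e.
have cc : c' = c.
  apply/eqP; apply: contraT => /al_ndvd /(_ (i%:Z - j%:Z)) /eqP; lia.
rewrite cc in e *; congr (_, _); apply: val_inj => /=; nia.
Qed.

(** The inverse Lagrange denominator stripped of its monomials. It has non-negative valuation for
    all [M] and [i], and converges when [i] stays far from both ends. *)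
Definition regular_part c M i : K :=
  (Q l%:Z i * Q l%:Z (2 * M - i.+1) * \prod_(c' | c' != c)
     (Q (l%:Z - (al c' - al c)) i * Q (al c' - al c) (2 * M - i)))^-1.

Lemma node_den M (x : C * 'I_(2 * M)) :
  lagrange_den (@node M) x = node x ^+ (#|C| * (2 * M)).-1
    * (sgU 0 x.2 * \prod_(c' | c' != x.1) sgU (al c' - al x.1) x.2)
    / regular_part x.1 M x.2.
Proof.
case: x => c i /=; rewrite /lagrange_den.
have -> : \prod_(y | y != (c, i)) (node (c, i) - node y)
    = \prod_(y | y != (c, i)) node (c, i)
      * \prod_(y | y != (c, i)) (1 - U (al y.1 - al c + l%:Z * (y.2%:Z - i%:Z))).
  rewrite -big_split; apply: eq_bigr => -[c' j] _.
  rewrite /= mulrBr mulr1 /node -UD; congr (_ - U _); rewrite /=; ring.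
rewrite prodr_const cardC1 card_prod card_ord -mulrA; congr (_ * _).
rewrite (eq_bigl (fun y : C * 'I_(2 * M) => true && ((y.1 != c) || (y.2 != i)))); last first.
  by move=> [c' j]; rewrite /= xpair_eqE negb_and.
rewrite -(pair_big_dep xpredT (fun c' j => (c' != c) || (j != i))
  (fun c' j => 1 - U (al c' - al c + l%:Z * (j%:Z - i%:Z)))) /=.
rewrite (bigD1 c) //= /regular_part invrK.
rewrite [X in X * _](eq_bigl (fun j : 'I_(2 * M) => j != i :> nat)); last first.
  by move=> j; rewrite eqxx.
under eq_bigr do rewrite subrr add0r.
rewrite prod_shift_neq //.
have -> : \prod_(c' | c' != c) \prod_(j < 2 * M | (c' != c) || (j != i))
        (1 - U (al c' - al c + l%:Z * (j%:Z - i%:Z)))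
  = \prod_(c' | c' != c) sgU (al c' - al c) i * \prod_(c' | c' != c)
      (Q (l%:Z - (al c' - al c)) i * Q (al c' - al c) (2 * M - i)).
  rewrite -big_split /=; apply: eq_bigr => c' c'c.
  rewrite (eq_bigl predT) => [|j]; last by rewrite c'c.
  by rewrite prod_shift 1?ltnW // mulrA.
ring.
Qed.

Definition regular_lim c : K :=
  (J * J * \prod_(c' | c' != c) Th (al c' - al c))^-1.

(** Both [s M] and the distance of [s M] to the end of the 2M indices tend to infinity, so all
    Pochhammer symbols in [regular_part] converge. *)
Definition middle (s : nat -> nat) := forall B, exists N, forall M, (N <= M)%N ->
  (B <= s M)%N /\ (B <= 2 * M - (s M).+1)%N.

Lemma V_regular_part c M i : V 0 (regular_part c M i).
Proof.
rewrite /regular_part !invfM -prodfV; apply: VM0.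
  by apply: VM0; apply: V_invQ.
by apply: V0_prod => c' _; rewrite invfM; apply: VM0; apply: V_invQ.
Qed.

Lemma lim_regular_part c s : middle s ->
  lim (fun M => regular_part c M (s M)) (regular_lim c).
Proof.
move=> ms.
have limQ e : lim (fun M => Q e (s M)) (Qinf e).
  apply: lim_comp (lim_Q e) => B; have [N NP] := ms B.
  by exists N => M /NP[].
have limQ1 e : lim (fun M => Q e (2 * M - (s M).+1)) (Qinf e).
  apply: lim_comp (lim_Q e) => B; have [N NP] := ms B.
  by exists N => M /NP[].
have limQ2 e : lim (fun M => Q e (2 * M - s M)) (Qinf e).
  apply: lim_comp (lim_Q e) => B; have [N NP] := ms B.
  by exists N => M /NP[]; lia.
apply: limV.
  rewrite !mulf_neq0 ?J_neq0 //; apply/prodf_neq0 => c' c'c.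
  exact/Th_neq0/al_ndvd.
apply: limM; first exact: limM.
apply: lim_prod => c' _; rewrite /Th mulrC; exact: limM.
Qed.
End Nodes.

(** Dominated convergence: the uniform bound [v] makes the terms far from the centre negligible
    because [g] is summable, and the finitely many central ones lie on middle sequences. *)
Lemma tannery (r : nat -> nat -> K) v rho g G :
    (forall s, middle s -> lim (fun M => r M (s M)) rho) ->
    (forall M i, V v (r M i)) -> summable g -> hassum g G ->
  lim (fun M => \sum_(i < 2 * M) r M i * g (i%:Z - M%:Z)) (rho * G).
Proof.
move=> r_rho Vr sg gG k.
have Vrho : V v rho.
  apply: (lim_V _ (r_rho id _)) => // B; exists B.+1 => M; lia.
have [B1 B1g] := sg (k - v); have [B2 B2G] := gG (k - v).
pose B := maxn B1 B2.
have : lim (fun M => \sum_(j < B) (r M (M + j)%N * g j%:Z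
      + r M (M - j.+1)%N * g (- j.+1%:Z)))
    (\sum_(j < B) (rho * g j%:Z + rho * g (- j.+1%:Z))).
  apply: lim_sum => j _; apply: limD; apply: limM; try exact: lim_cst.
    by apply: (r_rho (fun M => M + j)%N) => A; exists (A + j).+1 => M; lia.
  by apply: (r_rho (fun M => M - j.+1)%N) => A; exists (A + j).+1 => M; lia.
move=> /(_ k)[N NP]; exists (maxn N B) => M; rewrite geq_max => /andP[leN leB].
pose h (m : int) := r M `|(m + M%:Z)%R|%N * g m.
rewrite (eq_bigr (fun i : 'I_(2 * M) => h (i%:Z - M%:Z))); last first.
  by move=> i _; rewrite /h subrK.
rewrite sum_centered -(big_mkord predT (fun j : nat => h j%:Z + h (- j.+1%:Z))).
rewrite (big_cat_nat (n := B)) //= big_mkord.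
have -> : \sum_(j < B) (h j%:Z + h (- j.+1%:Z))
  = \sum_(j < B) (r M (M + j)%N * g j%:Z + r M (M - j.+1)%N * g (- j.+1%:Z)).
  apply: eq_bigr => j _; have ltj := ltn_ord j.
  by congr (r M _ * _ + r M _ * _); lia.
have {}NP := NP M leN.
have {}B2G := B2G B (leq_maxr _ _).
set S := \sum_(j < B) _ in NP *; set T := \sum_(B <= j < M) _.
have VT : V k T.
  rewrite /T big_nat; apply: V_sum => j /andP[leBj _]; rewrite /h.
  have leB1 : (B1 <= B)%N by rewrite leq_maxl.
  apply: VD; rewrite -[k](subrK v) mulrC; apply: VM => //; apply: B1g; lia.
have -> : S + T - rho * G = (S - \sum_(j < B) (rho * g j%:Z + rho * g (- j.+1%:Z)))
  + T + (\sum_(j < B) (g j%:Z + g (- j.+1%:Z)) - G) * rho.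
  under [in RHS]eq_bigr do rewrite -mulrDr.
  by rewrite -mulr_sumr; ring.
apply: VD; first exact: VD.
by rewrite -[k](subrK v); apply: VM.
Qed.

Lemma U_exp n k : U n ^+ k = U (n * k%:Z).
Proof. by elim: k => [|k IH]; rewrite ?mulr0 ?U0 // exprS IH -UD; congr U; lia. Qed.

Lemma tri_ge (c1 c0 k : int) : exists B : nat, forall m : int, (B <= `|m|)%N ->
  k <= 3 * l%:Z * tri m + c1 * m + c0.
Proof.
exists (2 * `|c1| + 2 * `|c0| + 2 * `|k| + 2)%N => m leB.
have := triE m; set t := tri m => tE.
suff : 2 * k <= 3 * l%:Z * (m * m + m) + 2 * c1 * m + 2 * c0.
  have -> : 3 * l%:Z * (m * m + m) = 3 * l%:Z * (t * 2) by rewrite tE; ring.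
  by lia.
have [x [x0 mx xE]] : exists x : int, [/\ 0 <= x, m = x \/ m = - x & `|m|%N%:Z = x].
  by exists `|m|%N%:Z; split=> //; lia.
have [a1 [a1l a1r a1E]] : exists a : int, [/\ c1 <= a, - a <= c1 & `|c1|%N%:Z = a].
  by exists `|c1|%N%:Z; split; lia.
have hx : 2 * a1 + 2 * `|c0|%N%:Z + 2 * `|k|%N%:Z + 2 <= x by lia.
have h1 : - (2 * (a1 * x)) <= 2 * (c1 * m).
  have [] := (ler_wpM2r x0 a1l, ler_wpM2r x0 a1r) => u1 u2.
  by case: mx => ->; lia.
have h2 : 3 * (x * x - x) <= 3 * l%:Z * (m * m + m).
  apply: (@le_trans _ _ (3 * l%:Z * (x * x - x))).
    have : 1 * (x * x - x) <= l%:Z * (x * x - x) by rewrite ler_wpM2r; nia.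
    lia.
  by rewrite ler_wpM2l //; case: mx => ->; lia.
have h3 : x * (2 * a1 + 2 * `|c0|%N%:Z + 2 * `|k|%N%:Z + 2) <= x * x.
  by rewrite ler_wpM2l.
have h4 : 1 * (`|c0|%N%:Z + `|k|%N%:Z) <= x * (`|c0|%N%:Z + `|k|%N%:Z).
  by rewrite ler_wpM2r //; lia.
have h5 : 2 * x <= x * x by rewrite ler_wpM2r //; lia.
lia.
Qed.

(** * Relations from three residue classes *)

Section Triple.
Variables (al : 'I_3 -> int) (d : int).
Hypothesis al_ndvd : forall c c', c' != c -> ndvd (al c' - al c).

Let s0 := \sum_c al c.

(** The limit shape of X^(3M-1-d) over the Lagrange denominator. Each of the three classes
    contributes one [sgU], hence the 3 in front of [tri m]. *)
Definition weight c (m : int) : K :=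
  sgn m * U (3 * l%:Z * tri m - (s0 - 3 * al c) * m - d * (al c + l%:Z * m)).

Let mu M : K := (-1) ^+ M * U (3 * l%:Z * tri M%:Z - s0 * M%:Z).

Let mu_neq0 M : mu M != 0.
Proof. by rewrite mulf_neq0 ?U_neq0 // expf_neq0 // oppr_eq0 oner_eq0. Qed.

Let sgn2 (i : nat) : ((-1) ^+ i * (-1) ^+ i = 1 :> K).
Proof. by rewrite -exprD -signr_odd addnn odd_double. Qed.

Lemma prod_sgU c (i : nat) : \prod_(c' | c' != c) sgU (al c' - al c) i
  = U ((s0 - 3 * al c) * i%:Z - 2 * l%:Z * tri i%:Z).
Proof.
rewrite big_split prodr_const cardC1 card_ord prod_U -[3.-1]/2%N expr2 sgn2 /= mul1r.
congr U; rewrite sumrB -mulr_suml sumrB !sumr_const cardC1 card_ord.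
have -> : s0 = al c + \sum_(c' | c' != c) al c' by rewrite /s0 (bigD1 c).
by rewrite /= !mulr2n; ring.
Qed.

(** The degree [k] is half of the number 6M of nodes, up to a constant. This completes the square:
    the exponent depends on [i - M] alone, apart from the factor [mu M], which is common to all
    nodes and divides out. *)
Lemma node_weight M k (x : 'I_3 * 'I_(2 * M)) :
    (0 < M)%N -> k%:Z = 3 * M%:Z - 1 - d ->
  node al x ^+ k / lagrange_den (@node _ al M) x
  = mu M * weight x.1 (x.2%:Z - M%:Z) * regular_part al x.1 M x.2.
Proof.
case: x => c i M0 kE /=; rewrite node_den // /= prod_sgU card_ord.
rewrite /mu /weight sgnB /node /= !U_exp.
set n := al c + _.
rewrite /sgU mul0r sub0r.
have -> : (-1) ^+ i * U (- (l%:Z * tri i%:Z)) *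
    U ((s0 - 3 * al c) * i%:Z - 2 * l%:Z * tri i%:Z)
    = (-1) ^+ i * U ((s0 - 3 * al c) * i%:Z - 3 * l%:Z * tri i%:Z).
  by rewrite -mulrA -UD; congr (_ * U _); ring.
have sI (j : nat) : ((-1) ^+ j)^-1 = (-1) ^+ j :> K by rewrite -exprVn invrN1.
rewrite !invfM invrK sI -!UN.
set r := regular_part _ _ _ _.
have -> : (-1) ^+ M * U (3 * l%:Z * tri M%:Z - s0 * M%:Z) *
    ((-1) ^+ i * (-1) ^+ M *
     U (3 * l%:Z * tri (i%:Z - M%:Z) - (s0 - 3 * al c) * (i%:Z - M%:Z)
        - d * (al c + l%:Z * (i%:Z - M%:Z))))
  = (-1) ^+ i * U (n * k%:Z - n * (3 * (2 * M)).-1%:Z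
      - ((s0 - 3 * al c) * i%:Z - 3 * l%:Z * tri i%:Z)).
  have := sgn2 M; move: ((-1) ^+ M) ((-1) ^+ i) => sM si sMM.
  rewrite mulrACA [sM * _]mulrCA sMM mulr1 -UD; congr (_ * U _).
  have := triE i%:Z; have := triE M%:Z; have := triE (i%:Z - M%:Z).
  move: (tri i%:Z) (tri M%:Z) (tri (i%:Z - M%:Z)) => ti tM tiM e1 e2 e3.
  have -> : tiM = ti + tM - M%:Z * i%:Z - M%:Z by lia.
  have -> : (3 * (2 * M)).-1%:Z = 6 * M%:Z - 1 by lia.
  by have := congr1 (fun x => l%:Z * x) e2; rewrite kE /n; lia.
rewrite !UD; move: ((-1) ^+ i) => si; ring.
Qed.

Lemma inv_oneBU z : z != 0 -> (1 - U z)^-1 = 1 + geo z.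
Proof. by move=> /oneBU_neq0 nz; rewrite /geo; field. Qed.

Lemma sum_inv_oneBU b M : ndvd b ->
  \sum_(i < 2 * M) (1 - U (b + l%:Z * (i%:Z - M%:Z)))^-1 = M%:R + Lsum b M.
Proof.
move=> nb; rewrite (sum_centered (fun m => (1 - U (b + l%:Z * m))^-1)).
have -> : M%:R = \sum_(j < M) (1 : K) by rewrite sumr_const card_ord.
rewrite -big_split; apply: eq_bigr => j _ /=.
rewrite !inv_oneBU ?ndvd_prog //.
have -> : b + l%:Z * - j.+1%:Z = - (l%:Z - b + l%:Z * j%:Z) by lia.
by rewrite geoN ?ndvd_prog //; [ring | apply: ndvdBl].
Qed.

(** The term [i = M] is the inverse of 0, hence 0: it is the excluded node 1. *)
Lemma sum_inv_oneBU0 M : (0 < M)%N ->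
  \sum_(i < 2 * M) (1 - U (0 + l%:Z * (i%:Z - M%:Z)))^-1
  = M%:R - 1 - geo (l%:Z * M%:Z).
Proof.
rewrite (sum_centered (fun m => (1 - U (0 + l%:Z * m))^-1)).
case: M => // M _; elim: M => [|M IH].
  rewrite big_ord1 mulr0 addr0 U0 subrr invr0 add0r mulrN add0r inv_oneBU; last by lia.
  by rewrite geoN ?subrr; [ring | lia].
rewrite big_ord_recr /= IH !add0r !inv_oneBU; try lia.
have -> : l%:Z * - M.+2%:Z = - (l%:Z * M.+2%:Z) by ring.
rewrite geoN; last by lia.
by rewrite -[M.+2%:R]natr1; ring.
Qed.

Definition pole_weight c m := weight c m / (1 - U (al c + l%:Z * m)).

Lemma V_weight c (k : int) : exists B : nat, forall m : int, (B <= `|m|)%N ->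
  V k (weight c m).
Proof.
have [B BP] := tri_ge (- (s0 - 3 * al c) - d * l%:Z) (- d * al c) `|k|.
exists B => m /BP le_k; rewrite /weight mulrC; apply: VM0 (V_sgn m).
by apply: V_U; lia.
Qed.

Lemma summable_weight c : summable (weight c).
Proof. exact: V_weight. Qed.

Lemma summable_pole_weight c : summable (pole_weight c).
Proof.
move=> k; have [B BP] := V_weight c k; exists B => m /BP Vw.
by apply: VM0 => //; apply: V_invBU.
Qed.

Let degree (M : nat) : nat := `|(3 * M%:Z - 1 - d)%R|%N.
Let large (M : nat) := (`|d| + 1 < M)%N.
Let degreeE M : large M -> (degree M)%:Z = 3 * M%:Z - 1 - d.
Proof. rewrite /large /degree; lia. Qed.
Let size_degree M (F : fieldType) : large M ->
  (size ('X^(degree M) : {poly F}) < #|{: 'I_3 * 'I_(2 * M)}|)%N.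
Proof. by rewrite size_polyXn card_prod !card_ord /large /degree; lia. Qed.

Let weighted_sum (g : 'I_3 -> int -> K) M :=
  \sum_c \sum_(i < 2 * M) regular_part al c M i * g c (i%:Z - M%:Z).

Let lim_weighted g G : (forall c, summable (g c)) -> (forall c, hassum (g c) (G c)) ->
  lim (weighted_sum g) (\sum_c regular_lim al c * G c).
Proof.
move=> sg gG; apply: lim_sum => c _; apply: tannery => //; last first.
  exact: V_regular_part.
by move=> s; apply: lim_regular_part.
Qed.

Theorem theta_relation W : (forall c, hassum (weight c) (W c)) ->
  \sum_c regular_lim al c * W c = 0.
Proof.
move=> hW; have lW := lim_weighted summable_weight hW; apply: (lim_unique lW).
apply: lim_ext (lim_cst 0); exists (`|d| + 2)%N => M leM.
have lM : large M by rewrite /large; lia.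
have M0 : (0 < M)%N by lia.
have := lagrange_sum0 (node_inj al_ndvd (M := M)) (size_degree K lM).
rewrite (eq_bigr (fun x : 'I_3 * 'I_(2 * M) => mu M * (regular_part al x.1 M x.2
    * weight x.1 (x.2%:Z - M%:Z)))); last first.
  by move=> x _; rewrite hornerXn (node_weight _ M0 (degreeE lM)); ring.
rewrite -mulr_sumr => /eqP; rewrite mulf_eq0 (negPf (mu_neq0 M)) /= => /eqP <-.
by rewrite /weighted_sum pair_bigA.
Qed.

(** Interpolation of a power of X at the point 1, where its value is 1: only the product of the
    differences 1 - node survives on the right. *)
Theorem lambert_relation G : (forall c, ndvd (al c)) ->
    (forall c, hassum (pole_weight c) (G c)) ->
  \sum_c regular_lim al c * G c = \prod_c (Th (al c))^-1.
Proof.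
move=> nal hG; have lG := lim_weighted summable_pole_weight hG; apply: (lim_unique lG).
have : lim (fun M => \prod_c (Q (l%:Z - al c) M * Q (al c) M)^-1)
    (\prod_c (Th (al c))^-1).
  apply: lim_prod => c _; apply: limV; first exact: Th_neq0.
  by rewrite /Th mulrC; apply: limM; apply: lim_Q.
apply: lim_ext; exists (`|d| + 2)%N => M leM.
have lM : large M by rewrite /large; lia.
have M0 : (0 < M)%N by lia.
have nodes x : 1 != @node _ al M x.
  by rewrite -subr_eq0 oneBU_neq0 //; apply: ndvd_prog.
have := lagrange_eval (node_inj al_ndvd (M := M)) (ltnW (size_degree K lM)) nodes.
rewrite [X in _ = X / _]hornerXn expr1n mul1r.
rewrite (eq_bigr (fun x : 'I_3 * 'I_(2 * M) => mu M * (regular_part al x.1 M x.2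
    * pole_weight x.1 (x.2%:Z - M%:Z)))); last first.
  by move=> x _; rewrite hornerXn (node_weight _ M0 (degreeE lM)) /pole_weight; ring.
rewrite -mulr_sumr.
have -> : \prod_x (1 - @node _ al M x)
    = \prod_c (sgU (al c) M * Q (l%:Z - al c) M * Q (al c) M).
  rewrite -(pair_bigA _ (fun c (i : 'I_(2 * M)) => 1 - node al (c, i))).
  apply: eq_bigr => c _; rewrite /node /= prod_shift; last by lia.
  by congr (_ * Q _ _); lia.
under [in RHS]eq_bigr do rewrite -mulrA.
rewrite big_split invfM /=.
have -> : (\prod_c sgU (al c) M)^-1 = mu M.
  rewrite big_split prodr_const card_ord prod_U /mu invfM -UN; congr (_ * U _).
    by rewrite -exprVn -exprVn invrN1 !exprS expr0 mulr1 sgn2 mulr1.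
  by rewrite sumrB -mulr_suml sumr_const card_ord -/s0 /= -mulr_natr; ring.
rewrite -prodfV; move/(mulfI (mu_neq0 M)) => <-.
by rewrite /weighted_sum pair_bigA.
Qed.

(** Now 1 is the node of class [c0] with index [M]. The derivative brings the degree 3M - 1 - d, the
    sum of inverses brings 3M - 1 plus partial sums of [L]; each diverges, but their difference
    converges. *)
Theorem degenerate_relation G c0 : al c0 = 0 ->
    (forall c, hassum (pole_weight c) (G c)) ->
  \sum_c regular_lim al c * G c
  = - regular_lim al c0 * (d%:~R + \sum_(c | c != c0) L (al c)).
Proof.
move=> al0 hG.
have al_c c : c != c0 -> ndvd (al c) by move=> /al_ndvd; rewrite al0 subr0.
have lG := lim_weighted summable_pole_weight hG; apply: (lim_unique lG).
have : lim (fun M => - regular_part al c0 M M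
      * (d%:~R + \sum_(c | c != c0) Lsum (al c) M - geo (l%:Z * M%:Z)))
    (- regular_lim al c0 * (d%:~R + \sum_(c | c != c0) L (al c) - 0)).
  apply: limM.
    apply: limN; apply: (@lim_regular_part _ al al_ndvd c0 id) => B.
    by exists B.+1 => M; lia.
  apply: limB; last first.
    move=> k; exists `|k|%N => M leM; rewrite subr0; apply: V_geo; nia.
  apply: limD; first exact: lim_cst.
  by apply: lim_sum => c _; apply: lim_L.
rewrite subr0; apply: lim_ext; exists (`|d| + 2)%N => M leM.
have lM : large M by rewrite /large; lia.
have M0 : (0 < M)%N by lia.
have ltM : (M < 2 * M)%N by lia.
pose x0 : 'I_3 * 'I_(2 * M) := (c0, Ordinal ltM).
have node0 : node al x0 = 1 by rewrite /node /= al0 subrr mulr0 addr0 U0.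
have := lagrange_double_node (node_inj al_ndvd (M := M)) x0 (ltnW (size_degree K lM)).
have w0 : weight c0 (M%:Z - M%:Z) = 1.
  rewrite /weight subrr al0.
  have -> : 3 * l%:Z * tri 0 - (s0 - 3 * 0) * 0 - d * (0 + l%:Z * 0) = 0.
    by have := triE 0; nia.
  by rewrite U0 mulr1.
have den0 : (lagrange_den (@node _ al M) x0)^-1 = mu M * regular_part al c0 M M.
  have := node_weight x0 M0 (degreeE lM).
  by rewrite node0 expr1n mul1r /= w0 mulr1.
rewrite node0 derivXn hornerMn !hornerXn !expr1n mul1r.
have -> : 1 *+ degree M / lagrange_den (@node _ al M) x0
  = mu M * regular_part al c0 M M * (3 * M%:R - 1 - d%:~R).
  rewrite den0 mulrC -[1 *+ _]/((degree M)%:~R) degreeE // !rmorphB rmorphM.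
  by [].
rewrite den0.
have -> : \sum_(x | x != x0) (1 - @node _ al M x)^-1
  = 3 * M%:R - 1 + \sum_(c | c != c0) Lsum (al c) M - geo (l%:Z * M%:Z).
  transitivity (\sum_x (1 - @node _ al M x)^-1).
    by rewrite [RHS](bigD1 x0) //= node0 subrr invr0 add0r.
  rewrite -(pair_bigA _ (fun c (i : 'I_(2 * M)) => (1 - node al (c, i))^-1)) /=.
  rewrite (bigD1 c0) //= (eq_bigr (fun c => M%:R + Lsum (al c) M)) => [|c cc0].
    rewrite /node /= al0 sum_inv_oneBU0 // big_split sumr_const cardC1 card_ord /=.
    by rewrite -mulr_natr; ring.
  by rewrite -sum_inv_oneBU //; apply: al_c.
rewrite (eq_bigr (fun x : 'I_3 * 'I_(2 * M) => mu M * (regular_part al x.1 M x.2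
    * pole_weight x.1 (x.2%:Z - M%:Z)))); last first.
  by move=> x _; rewrite hornerXn (node_weight _ M0 (degreeE lM)) /pole_weight; ring.
rewrite -mulr_sumr => e; apply: (mulfI (mu_neq0 M)).
rewrite /weighted_sum pair_bigA (bigD1 x0) //= {1}/pole_weight al0 subrr mulr0.
rewrite addr0 U0 subrr invr0 !mulr0 add0r e; ring.
Qed.
End Triple.

Lemma V_Q e : exists v, forall B, V v (Q e B).
Proof.
have [N] : exists N : nat, 0 < e + l%:Z * N%:Z by exists `|e|.+1; nia.
elim: N e => [|N IH] e.
  rewrite mulr0 addr0 => e0; exists 0 => B; exact/one_unit_V0/one_unitQ.
move=> eN; have [|v Vv] := IH (e + l%:Z); first by lia.
have [w Vw] := V_lb (1 - U e).
exists (Order.min 0 (w + v)) => -[|B].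
  by rewrite Q0; apply: V_le V1; rewrite ge_min lexx.
by rewrite Q_rec; apply: V_le (VM Vw (Vv B)); rewrite ge_min lexx orbT.
Qed.

Lemma hassum_geoB b b' : ndvd b -> ndvd b' ->
  hassum (fun m => geo (b + l%:Z * m) - geo (b' + l%:Z * m)) (L b - L b').
Proof.
move=> nb nb'; apply: lim_ext (limB (lim_L b) (lim_L b')).
exists 0%N => M _; rewrite [RHS](eq_bigr (fun j : 'I_M =>
    geo (b + l%:Z * j%:Z) - geo (l%:Z - b + l%:Z * j%:Z)
    - (geo (b' + l%:Z * j%:Z) - geo (l%:Z - b' + l%:Z * j%:Z)))).
  by rewrite sumrB.
move=> j _; have E c : c + l%:Z * - j.+1%:Z = - (l%:Z - c + l%:Z * j%:Z) by lia.
by rewrite !E !geoN; [ring | |]; apply: ndvd_prog; apply: ndvdBl.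
Qed.

Lemma summable_geoB b b' : ndvd b -> ndvd b' ->
  summable (fun m => geo (b + l%:Z * m) - geo (b' + l%:Z * m)).
Proof.
move=> nb nb' k; exists (`|k| + `|b| + `|b'|)%N => m le_m.
have [m0|m0] : 0 <= m \/ m < 0 by lia.
  by apply: VB; apply: V_geo; nia.
have -> : geo (b + l%:Z * m) - geo (b' + l%:Z * m)
    = geo (- (b' + l%:Z * m)) - geo (- (b + l%:Z * m)).
  by rewrite !geoN ?ndvd_prog //; ring.
by apply: VB; apply: V_geo; nia.
Qed.

(** * Theta quotients from two residue classes *)

Section Double.
Variables a b : bool -> int.
Hypothesis sum_ab : a true + a false = b true + b false.
Hypothesis b_ndvd : forall c c', c' != c -> ndvd (b c' - b c).
Hypothesis ab_ndvd : forall c c', ndvd (a c' - b c).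
Hypothesis b_ndvd0 : forall c, ndvd (b c).

Let num_part c M i : K :=
  \prod_c' (Q (l%:Z - (a c' - b c)) i * Q (a c' - b c) (2 * M - i)).

Let ratio c M i := num_part c M i * regular_part b c M i.

Let V_ratio c : exists v, forall M i, V v (ratio c M i).
Proof.
rewrite /ratio /num_part.
have [v1 V1] := V_Q (l%:Z - (a true - b c)); have [v2 V2] := V_Q (a true - b c).
have [v3 V3] := V_Q (l%:Z - (a false - b c)); have [v4 V4] := V_Q (a false - b c).
exists ((v1 + v2) + (v3 + v4)) => M i.
apply: VM0; last exact: V_regular_part.
by rewrite big_bool /=; apply: VM; apply: VM.
Qed.

Let ratio_lim c := (\prod_c' Th (a c' - b c)) * regular_lim b c.

Let lim_ratio c s : middle s -> lim (fun M => ratio c M (s M)) (ratio_lim c).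
Proof.
move=> ms; apply: limM; last exact: lim_regular_part.
apply: lim_prod => c' _; rewrite /Th mulrC; apply: limM.
  by apply: lim_comp (lim_Q _) => B; have [N NP] := ms B; exists N => M /NP[].
by apply: lim_comp (lim_Q _) => B; have [N NP] := ms B; exists N => M /NP[]; lia.
Qed.

Let zeros M : {poly K} := \prod_(y : bool * 'I_(2 * M)) ('X - (node a y)%:P).

Let zeros_node M c (i : 'I_(2 * M)) : (zeros M).[node b (c, i)]
  = node b (c, i) ^+ (2 * (2 * M)) * (\prod_c' sgU (a c' - b c) i * num_part c M i).
Proof.
rewrite horner_prod.
have -> : \prod_(y : bool * 'I_(2 * M)) ('X - (node a y)%:P).[node b (c, i)]
  = \prod_(y : bool * 'I_(2 * M)) node b (c, i)
    * \prod_(y : bool * 'I_(2 * M)) (1 - U (a y.1 - b c + l%:Z * (y.2%:Z - i%:Z))).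
  rewrite -big_split; apply: eq_bigr => -[c' j] _; rewrite hornerXsubC.
  rewrite /= mulrBr mulr1 /node -UD; congr (_ - U _); rewrite /=; ring.
rewrite prodr_const card_prod card_bool card_ord; congr (_ * _).
rewrite -(pair_bigA _ (fun c' (j : 'I_(2 * M)) =>
  1 - U (a c' - b c + l%:Z * (j%:Z - i%:Z)))) -big_split /=.
by apply: eq_bigr => c' _; rewrite prod_shift 1?ltnW // mulrA.
Qed.

Let prod_sgU_ab c (i : nat) :
  \prod_c' sgU (a c' - b c) i = sgU 0 i * \prod_(c' | c' != c) sgU (b c' - b c) i.
Proof.
have -> : \prod_(c' | c' != c) sgU (b c' - b c) i = sgU (b (~~ c) - b c) i.
  by rewrite (big_pred1 (~~ c)) // => -[]; case: c.
rewrite big_bool /= /sgU mulrACA [RHS]mulrACA -!UD; congr (_ * U _).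
have : a true + a false = b c + b (~~ c) by rewrite sum_ab; case: c => /=; ring.
by move/(congr1 (fun x => x * i%:Z)); lia.
Qed.

Let zeros_ratio M (x : bool * 'I_(2 * M)) : (0 < M)%N ->
  (zeros M).[node b x] / lagrange_den (@node _ b M) x
  = node b x * ratio x.1 M x.2.
Proof.
case: x => c i M0; rewrite node_den // zeros_node prod_sgU_ab card_bool /=.
set s := sgU 0 i * _; set z := node b (c, i).
have nzz : z != 0 by apply: U_neq0.
have nzs : s != 0.
  by rewrite /s mulf_neq0 //; [|apply/prodf_neq0 => c' _];
     rewrite mulf_neq0 ?U_neq0 // expf_neq0 // oppr_eq0 oner_eq0.
have [k ->] : exists k, (2 * (2 * M) = k.+1)%N by exists (2 * (2 * M)).-1; lia.
rewrite exprS /ratio invfM invrK /= invfM.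
have nzk : z ^+ k != 0 by rewrite expf_neq0.
by field; rewrite nzs nzk.
Qed.

(** Partial fractions of an elliptic function with zeros [a] and poles [b]. By [sum_ab] the
    monomials of zeros and poles cancel, and with them the quadratic exponents that made earlier
    sums converge. Convergence comes instead from subtracting at a known zero, which turns the poles
    into differences of two geometric terms. *)
Lemma theta_quotient :
  \prod_c Th (a c) / \prod_c Th (b c)
  = \sum_c (\prod_c' Th (a c' - b c)) * regular_lim b c
      * (L (b c) - L (b c - a true)).
Proof.
pose g c m := geo (b c + l%:Z * m) - geo (b c - a true + l%:Z * m).
have ba_ndvd c : ndvd (b c - a true).
  by rewrite -opprB; apply/ndvdN/ab_ndvd.
have lim_rhs : lim (fun M => \sum_c \sum_(i < 2 * M) ratio c M i * g c (i%:Z - M%:Z))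
    (\sum_c ratio_lim c * (L (b c) - L (b c - a true))).
  apply: lim_sum => c _; have [v Vv] := V_ratio c; apply: (tannery (v := v)) => //.
  - by move=> s; apply: lim_ratio.
  - exact: summable_geoB.
  - exact: hassum_geoB.
apply/esym/(lim_unique lim_rhs).
have : lim (fun M => \prod_c (Q (l%:Z - a c) M * Q (a c) M)
    / \prod_c (Q (l%:Z - b c) M * Q (b c) M)) (\prod_c Th (a c) / \prod_c Th (b c)).
  apply: limM; [|apply: limV].
  - by apply: lim_prod => c _; rewrite /Th mulrC; apply: limM; apply: lim_Q.
  - by apply/prodf_neq0 => c _; apply: Th_neq0.
  by apply: lim_prod => c _; rewrite /Th mulrC; apply: limM; apply: lim_Q.
apply: lim_ext; exists 1%N => M M0.
have ltM : (M < 2 * M)%N by lia.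
pose y0 : bool * 'I_(2 * M) := (true, Ordinal ltM).
have nodes x : 1 != @node _ b M x.
  by rewrite -subr_eq0 oneBU_neq0 //; apply: ndvd_prog.
have nodes0 (x : bool * 'I_(2 * M)) : node a y0 != node b x.
  apply/eqP => /U_inj /=; have := ab_ndvd x.1 true (x.2%:Z - M%:Z).
  by move/eqP; lia.
pose h : {poly K} := \prod_(y | y != y0) ('X - (@node _ a M y)%:P).
have zerosE : zeros M = h * ('X - (node a y0)%:P).
  by rewrite mulrC /zeros (bigD1 y0).
have sz_h : (size h <= #|{: bool * 'I_(2 * M)}|)%N.
  by rewrite /h size_lagrange_num.
have := lagrange_eval_root (node_inj b_ndvd (M := M)) sz_h nodes nodes0.
rewrite -zerosE.
rewrite (eq_bigr (fun x : bool * 'I_(2 * M) =>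
  ratio x.1 M x.2 * g x.1 (x.2%:Z - M%:Z))); last first.
  move=> x _; rewrite zeros_ratio // mulrAC mulrC; congr (_ * _).
  have x1 := nodes x; have x0 := nodes0 x.
  have -> : g x.1 (x.2%:Z - M%:Z) = node b x / (1 - node b x)
      - (node b x / node a y0) / (1 - node b x / node a y0).
    rewrite /g /geo /node /= subrr mulr0 addr0 -UN -UD.
    by congr (_ - U _ / (1 - U _)); ring.
  have nzy : node a y0 != 0 by apply: U_neq0.
  have nz1 : 1 - node b x != 0 by rewrite subr_eq0.
  have nz0 : node b x - node a y0 != 0 by rewrite subr_eq0 eq_sym.
  have nz0' : node a y0 - node b x != 0 by rewrite subr_eq0.
  by field; rewrite nz1 nz0 nz0' nzy.
have -> : \prod_x (1 - @node _ b M x) = \prod_c sgU (b c) M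
    * \prod_c (Q (l%:Z - b c) M * Q (b c) M).
  rewrite -(pair_bigA _ (fun c (i : 'I_(2 * M)) => 1 - node b (c, i))) -big_split.
  apply: eq_bigr => c _; rewrite /node /= prod_shift; last by lia.
  by rewrite mulrA; congr (_ * Q _ _); lia.
have -> : (zeros M).[1] = \prod_c sgU (a c) M
    * \prod_c (Q (l%:Z - a c) M * Q (a c) M).
  rewrite horner_prod; under eq_bigr do rewrite hornerXsubC.
  rewrite -(pair_bigA _ (fun c (i : 'I_(2 * M)) => 1 - node a (c, i))) -big_split.
  apply: eq_bigr => c _; rewrite /node /= prod_shift; last by lia.
  by rewrite mulrA; congr (_ * Q _ _); lia.
have -> : \prod_c sgU (a c) M = \prod_c sgU (b c) M.
  rewrite !big_bool /= /sgU mulrACA [RHS]mulrACA -!UD; congr (_ * U _).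
  by move: sum_ab => /(congr1 (fun x => x * M%:Z)); lia.
rewrite pair_bigA /= => ->; rewrite invfM mulrACA mulfV ?mul1r //.
by apply/prodf_neq0 => c _; rewrite mulf_neq0 ?U_neq0 // expf_neq0 // oppr_eq0 oner_eq0.
Qed.
End Double.

(** The analogue of the Weierstrass identity expressing zeta(x) + zeta(y) + zeta(z) - zeta(x+y+z) as
    a quotient of sigma functions. *)
Lemma L_relation x y z : ndvd x -> ndvd y -> ndvd z ->
    ndvd (x + y) -> ndvd (y + z) -> ndvd (x + z) -> ndvd (x + y + z) ->
  1 + L x + L y + L z - L (x + y + z)
  = J * J * (Th (x + y) * Th (y + z) * Th (x + z))
    / (Th x * Th y * Th z * Th (x + y + z)).
Proof.
move=> nx ny nz nxy nyz nxz nxyz.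
(* Zeros -(y+z), x+z and poles x, -y have the same sum x - y. The two residues come out opposite, so
   the four values of [L] share one factor. *)
pose a c : int := if c then - (y + z) else x + z.
pose b c : int := if c then x else - y.
have sum_ab : a true + a false = b true + b false by rewrite /a /b /=; ring.
have b_ndvd c c' : c' != c -> ndvd (b c' - b c).
  case: c c' => -[] //= _; last by rewrite opprK.
  by have := ndvdN nxy; congr ndvd; ring.
have ab_ndvd c c' : ndvd (a c' - b c).
  by case: c c' => -[] /=; [have := ndvdN nxyz | have := nz | have := ndvdN nz
    | have := nxyz]; congr ndvd; ring.
have b_ndvd0 c : ndvd (b c) by case: c => //=; apply: ndvdN.
have hT (F : bool -> K) : \prod_(c' | c' != true) F c' = F false.
  by rewrite (big_pred1 false) // => -[].
have hF (F : bool -> K) : \prod_(c' | c' != false) F c' = F true.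
  by rewrite (big_pred1 true) // => -[].
have := theta_quotient sum_ab b_ndvd ab_ndvd b_ndvd0.
rewrite /regular_lim !big_bool /= !hT !hF /a /b /=.
have -> : x - - (y + z) = x + y + z by ring.
have -> : - y - - (y + z) = z by ring.
have -> : - (y + z) - x = - (x + y + z) by ring.
have -> : x + z - x = z by ring.
have -> : - (y + z) - - y = - z by ring.
have -> : x + z - - y = x + y + z by ring.
have -> : - y - x = - (x + y) by ring.
have -> : x - - y = x + y by ring.
rewrite !ThN // L_opp // !opprD !UD.
have := (Th_neq0 nx, Th_neq0 ny, Th_neq0 nz, Th_neq0 nxy).
have := (Th_neq0 nyz, Th_neq0 nxz, Th_neq0 nxyz, J_neq0).
have := (U_neq0 (- x), U_neq0 (- y), U_neq0 (- z)).
set ux := U (- x); set uy := U (- y); set uz := U (- z).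
move: ux uy uz (Th x) (Th y) (Th z) (Th (x + y)) (Th (y + z)) (Th (x + z)).
move=> ux uy uz tx ty tz txy tyz txz; move: (Th (x + y + z)) J => t j.
move=> [[hux huy] huz] [[[h1 h2] h3] h4] [[[h5 h6] h7] h8] e.
have nzT : uz * (t * tz / (j * j * txy)) != 0 by rewrite !(mulf_neq0, invr_neq0).
have huxy : - (ux * uy) != 0 by rewrite oppr_eq0 mulf_neq0.
set S := 1 + _ + _ + _ - _.
have {}e : uz * (t * tz / (j * j * txy)) * S = uz * tyz * txz / (tx * ty).
  transitivity (- (uy * uz) * tyz * txz / (tx * (- uy * ty))).
    by rewrite e /S; field; rewrite h8 h4 huxy.
  by rewrite !mulNr mulrN invrN mulrN opprK; field; rewrite h6 huy h5.
rewrite -[S](mulKf nzT) e; field.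
by rewrite h3 h4 h5 h6 h7 h8 huz.
Qed.
End Theta.

(** * Dyson's map and the recursion for ranks *)

Section DysonMap.
Variables n m : nat.

(* Dyson's map deletes the first column and adds a row of length [size la + m - n];
   the new largest part makes it exchange ranks at most [m - n + 1] on partitions
   of [n] with ranks at least [m - n - 1] on partitions of [m]. *)
Definition dyson_part (la : seq nat) := [seq x.-1 | x <- la & (1 < x)%N].

Definition dyson (la : seq nat) : seq nat :=
  [seq x <- [:: (size la + m - n)%N] | (0 < x)%N] ++ dyson_part la.

(** The head is the added row, so [head 0 nu + n - m] is the number of parts before the map; those
    not accounted for by the tail were equal to 1. *)
Definition dyson_inv (nu : seq nat) : seq nat :=
  [seq x.+1 | x <- behead nu] ++ nseq (head 0 nu + n - m - size (behead nu)) 1%N.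

Lemma partition_ones (la : seq nat) : sorted geq la -> 0%N \notin la ->
  la = [seq x.+1 | x <- dyson_part la] ++ nseq (size la - size (dyson_part la)) 1%N.
Proof.
rewrite /dyson_part; elim: la => //= x la IH; rewrite inE negb_or => x_la.
move=> /andP[x0 la0]; have := IH (path_sorted x_la) la0; case: ltnP => [x1|x1] e /=.
  by rewrite subSS prednK ?(ltnW x1) // -e.
have all1 : all (pred1 1%N) la.
  apply/allP => y yla; have /allP/(_ y yla) := order_path_min (rev_trans leq_trans) x_la.
  by rewrite /= => yx; have : y != 0%N by [apply: contraNneq la0 => <-]; lia.
have -> : [seq y <- la | (1 < y)%N] = [::].
  apply/eqP; rewrite -(negbK (_ == _)) -has_filter -all_predC.
  by apply: sub_all all1 => y /eqP ->.
have x1E : x = 1%N by lia.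
by rewrite x1E subn0 /=; congr (_ :: _); apply/all_pred1P.
Qed.

Lemma sumn_succ (s : seq nat) : sumn [seq x.+1 | x <- s] = (sumn s + size s)%N.
Proof. by elim: s => //= x s ->; lia. Qed.

Lemma dyson_part_sum (la : seq nat) : is_partition n la ->
  (sumn (dyson_part la) + size la = n)%N /\ (size (dyson_part la) <= size la)%N.
Proof.
case/and3P => so z /eqP <-; have sz : (size (dyson_part la) <= size la)%N.
  by rewrite size_map size_filter count_size.
split=> //; rewrite [in RHS](partition_ones so z) sumn_cat sumn_succ sumn_nseq; lia.
Qed.

Lemma dysonP (la : seq nat) : is_partition n la -> rank la <= m%:Z - n%:Z + 1 ->
  [/\ is_partition m (dyson la), m%:Z - n%:Z - 1 <= rank (dyson la)
    & dyson_inv (dyson la) = la].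
Proof.
move=> pla; have [sumA szA] := dyson_part_sum pla; case/and3P: pla => so z /eqP sE.
rewrite /rank => rk.
have le_la x : x \in la -> (x + n <= size la + m + 1)%N.
  move=> xla; have : (x <= \max_(i <- la) i)%N by apply: leq_bigmax_seq.
  by lia.
have h_nat : (n <= size la + m)%N.
  case: la z sE {so rk szA sumA} le_la => [|x la] z sE le_la; first by rewrite -sE.
  have := le_la x (mem_head _ _); have : x != 0%N by apply: contraNneq z => ->; apply: mem_head.
  lia.
have le_A x : x \in dyson_part la -> (0 < x <= size la + m - n)%N.
  by case/mapP => y; rewrite mem_filter => /andP[y1 /le_la ly] ->; lia.
have soA : sorted geq (dyson_part la).
  rewrite sorted_map; apply: sub_sorted (sorted_filter (rev_trans leq_trans) _ so).
  by move=> x y /=; lia.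
rewrite /dyson /=; set A := dyson_part la in sumA szA le_A soA *.
(* If the added row is empty, the rank bound forces [la] to consist of ones and [m = 0]; the filter
   in [dyson] then avoids a zero part. *)
case: (posnP (size la + m - n)) => [h0|hp] /=.
  have A0 : A = [::].
    by case: A le_A {sumA szA soA} => // x A /(_ x (mem_head _ _)); lia.
  have m0 : m = 0%N by rewrite A0 /= in sumA; lia.
  rewrite A0 /dyson_inv /= big_nil m0; split=> //; first by lia.
  have := partition_ones so z; rewrite -/A A0 /= => ->.
  by congr nseq; rewrite A0 /= in sumA; lia.
split; last 1 first.
- rewrite /dyson_inv /= [RHS](partition_ones so z) -/A; congr (_ ++ nseq _ _); lia.
- apply/and3P; split.
  + rewrite /= path_sortedE; last exact: rev_trans leq_trans.
    by rewrite soA andbT; apply/allP => x /le_A /andP[].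
  + rewrite inE negb_or; apply/andP; split; first by lia.
    by apply/negP => /le_A.
  by rewrite /=; lia.
have : (size la + m - n <= \max_(i <- (size la + m - n)%N :: A) i)%N.
  by apply: leq_bigmax_seq; rewrite ?mem_head.
by rewrite /=; lia.
Qed.

Lemma dyson_invP (nu : seq nat) : is_partition m nu -> m%:Z - n%:Z - 1 <= rank nu ->
  [/\ is_partition n (dyson_inv nu), rank (dyson_inv nu) <= m%:Z - n%:Z + 1
    & dyson (dyson_inv nu) = nu].
Proof.
case: nu => [|x B]; rewrite /rank.
  move=> /and3P[_ _ /eqP /= m0] _; rewrite /dyson_inv /= -m0 subn0.
  have -> : (0 + n - 0)%N = n by lia.
  split.
  - apply/and3P; split; last by rewrite sumn_nseq mul1n.
      case: n => //= k; elim: k => //= k ->; by rewrite leqnn.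
    by apply/negP; rewrite mem_nseq => /andP[].
  - rewrite size_nseq; have : (\max_(i <- nseq n 1%N) i <= 1)%N.
      by apply/bigmax_leqP_seq => i; rewrite mem_nseq => /andP[_ /eqP ->].
    by lia.
  rewrite /dyson size_nseq /= -m0 addn0 subnn /=.
  by rewrite /dyson_part; elim: n.
case/and3P => so z /eqP /= sE rk.
have leB y : y \in B -> (0 < y <= x)%N.
  move=> yB; have := order_path_min (rev_trans leq_trans) so.
  move/allP/(_ y yB) => /= ->; rewrite andbT lt0n.
  by apply: contraNneq z => <-; rewrite inE yB orbT.
have x0 : (0 < x)%N.
  by rewrite lt0n; apply: contraNneq z => ->; apply: mem_head.
have szL : (size B <= x + n - m)%N /\ (m <= x + n)%N.
  have : (\max_(i <- x :: B) i <= x)%N.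
    by apply/bigmax_leqP_seq => y; rewrite inE => /orP[/eqP -> //|/leB/andP[]].
  by move: rk => /=; lia.
have sz : size (dyson_inv (x :: B)) = (x + n - m)%N.
  by rewrite /dyson_inv size_cat size_map size_nseq /=; lia.
rewrite /dyson sz; rewrite /dyson_inv /=.
set k := (x + n - m - size B)%N.
have mem_inv y : y \in [seq i.+1 | i <- B] ++ nseq k 1%N -> (0 < y <= x.+1)%N.
  rewrite mem_cat mem_nseq => /orP[/mapP[i /leB iB ->]|/andP[_ /eqP ->]]; lia.
split.
- apply/and3P; split.
  + rewrite (sorted_pairwise (rev_trans leq_trans)) pairwise_cat.
    rewrite -!(sorted_pairwise (rev_trans leq_trans)); apply/and3P; split.
    * by apply/allrelP => y t /mapP[i _ ->]; rewrite mem_nseq => /andP[_ /eqP ->].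
    * by rewrite sorted_map; apply: sub_sorted (path_sorted so).
    by move: (k) => j; elim: j => //= -[].
  + by apply/negP => /mem_inv.
  by rewrite sumn_cat sumn_succ sumn_nseq /k; lia.
- have : (\max_(i <- [seq i.+1 | i <- B] ++ nseq k 1%N) i <= x.+1)%N.
    by apply/bigmax_leqP_seq => y /mem_inv /andP[].
  by lia.
have -> : (x + n - m + m - n)%N = x by lia.
rewrite x0 /=; congr (_ :: _); rewrite /dyson_part filter_cat map_cat.
have -> : [seq y <- nseq k 1%N | (1 < y)%N] = [::] by move: k {mem_inv} => j; elim: j.
rewrite cats0; elim: B leB {so z sE rk szL sz k mem_inv} => //= y B IH leB.
have /andP[y0 _] := leB y (mem_head _ _); rewrite ltnS y0 /= IH // => t tB.
by apply: leB; rewrite inE tB orbT.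
Qed.
End DysonMap.

(** * Recursion and symmetry for the number of partitions with bounded rank *)

Lemma card_partition_le n m (P Q : pred (seq nat)) (f g : seq nat -> seq nat) :
    (forall la, is_partition n la -> P la ->
      [/\ is_partition m (f la), Q (f la) & g (f la) = la]) ->
  (#|[set la : partition_of n | P la]| <= #|[set nu : partition_of m | Q nu]|)%N.
Proof.
move=> fP; rewrite !cardE -(size_map (fun la => f (parts la))).
rewrite -(size_map (@parts m)); apply: uniq_leq_size.
  rewrite map_inj_in_uniq ?enum_uniq // => la nu.
  rewrite !mem_enum !inE => Pla Pnu /(congr1 g).
  have [_ _ ->] := fP _ (valP la) Pla; have [_ _ ->] := fP _ (valP nu) Pnu.
  exact: val_inj.
move=> x /mapP[la]; rewrite mem_enum inE => Pla ->.
have [pf Qf _] := fP _ (valP la) Pla.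
by apply/mapP; exists (PartitionOf pf); rewrite // mem_enum inE.
Qed.

Definition rank_ge n (s : int) := #|[set la : partition_of n | s <= rank la]|.
Definition rank_le n (s : int) := #|[set la : partition_of n | rank la <= s]|.
Definition npart n := #|{: partition_of n}|.

Lemma dyson_card n m : rank_le n (m%:Z - n%:Z + 1) = rank_ge m (m%:Z - n%:Z - 1).
Proof.
apply/eqP; rewrite eqn_leq; apply/andP; split.
  apply: (@card_partition_le n m (fun la => rank la <= m%:Z - n%:Z + 1)
    (fun nu => m%:Z - n%:Z - 1 <= rank nu) (dyson n m) (dyson_inv n m)) => la.
  exact: dysonP.
apply: (@card_partition_le m n (fun nu => m%:Z - n%:Z - 1 <= rank nu)
  (fun la => rank la <= m%:Z - n%:Z + 1) (dyson_inv n m) (dyson n m)) => nu.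
exact: dyson_invP.
Qed.

Lemma rank_ge_le n s : (rank_ge n s + rank_le n (s - 1) = npart n)%N.
Proof.
apply: etrans (cardsC [set la : partition_of n | s <= rank la]).
by congr (_ + _)%N; apply: eq_card => la; rewrite !inE; lia.
Qed.

Lemma N_rank_ge m n : (N m n + rank_ge n (m + 1) = rank_ge n m)%N.
Proof.
rewrite /N /rank_ge -cardsUI addnC.
have -> : [set la : partition_of n | rank la == m]
    :&: [set la : partition_of n | m + 1 <= rank la] = set0.
  by apply/setP => la; rewrite !inE; lia.
rewrite cards0 add0n; apply: eq_card => la; rewrite !inE; lia.
Qed.

Lemma N_rank_le m n : (N (- m) n + rank_le n (- (m + 1)) = rank_le n (- m))%N.
Proof.
rewrite /N /rank_le -cardsUI addnC.
have -> : [set la : partition_of n | rank la == - m]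
    :&: [set la : partition_of n | rank la <= - (m + 1)] = set0.
  by apply/setP => la; rewrite !inE; lia.
rewrite cards0 add0n; apply: eq_card => la; rewrite !inE; lia.
Qed.

(** Dyson's map from [n - s - 1] to [n] matches ranks at most [s + 2] with ranks at least [s]; the
    complement of the former is ranks at least [s + 3]. *)
Lemma rank_ge_rec n (s : nat) : (s < n)%N ->
  (rank_ge n s%:Z + rank_ge (n - s.+1) (s + 3)%:Z = npart (n - s.+1))%N.
Proof.
move=> lt_sn; rewrite -(rank_ge_le _ (s + 3)%:Z) addnC; congr (_ + _)%N.
have := dyson_card (n - s.+1) n.
have -> : n%:Z - (n - s.+1)%N%:Z - 1 = s%:Z by lia.
by move=> <-; congr rank_le; lia.
Qed.

Lemma rank_le_rec n (s : nat) : (s < n)%N ->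
  (rank_le n (- s%:Z) + rank_le (n - s.+1) (- (s + 3)%:Z) = npart (n - s.+1))%N.
Proof.
move=> lt_sn; rewrite -(rank_ge_le _ (- (s + 2)%:Z)); congr (_ + _)%N; last first.
  by congr rank_le; lia.
have := dyson_card n (n - s.+1).
have -> : (n - s.+1)%N%:Z - n%:Z + 1 = - s%:Z by lia.
by move=> ->; congr rank_ge; lia.
Qed.

Lemma max_size_bound (la : seq nat) : 0%N \notin la ->
  (size la <= sumn la)%N /\ (\max_(i <- la) i + size la <= (sumn la).+1)%N.
Proof.
elim: la => [|x la IH]; first by rewrite big_nil.
rewrite inE negb_or big_cons => /andP[x0 /IH[]] /=.
by move: (\max_(i <- la) i) => k; lia.
Qed.

Lemma rank_bound n (la : partition_of n) : (0 < n)%N -> - n%:Z < rank la < n%:Z.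
Proof.
case: la => la /= /and3P[_ z /eqP <-]; have [] := max_size_bound z; rewrite /rank.
case: la z => // x la z; have : (x <= \max_(i <- x :: la) i)%N.
  by apply: leq_bigmax_seq; rewrite ?mem_head.
move: z; rewrite inE negb_or => /andP[x0 _]; move: (\max_(i <- _) i) => k /=; lia.
Qed.

Lemma partition_of0 (la : partition_of 0) : parts la = [::].
Proof.
case: la => la /= /and3P[_ z /eqP sE]; have [] := max_size_bound z; rewrite sE.
by case: la {z sE}.
Qed.

Lemma rank_ge0 n (s : nat) : (n <= s)%N -> (0 < s)%N -> rank_ge n s%:Z = 0%N.
Proof.
move=> le_ns s0; apply/eqP; rewrite cards_eq0; apply/eqP/setP => la; rewrite !inE.
case: n le_ns la => [|n] le_ns la; last by have := rank_bound la isT; lia.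
by rewrite partition_of0 /rank big_nil /=; lia.
Qed.

Lemma rank_le0 n (s : nat) : (n <= s)%N -> (0 < s)%N -> rank_le n (- s%:Z) = 0%N.
Proof.
move=> le_ns s0; apply/eqP; rewrite cards_eq0; apply/eqP/setP => la; rewrite !inE.
case: n le_ns la => [|n] le_ns la; last by have := rank_bound la isT; lia.
by rewrite partition_of0 /rank big_nil /=; lia.
Qed.

Lemma npart0 : npart 0 = 1%N.
Proof.
rewrite /npart -(card_ord 1).
have p0 : is_partition 0 [::] by [].
apply/eqP; rewrite card_ord; apply/fintype1P.
by exists (PartitionOf p0) => la; apply: val_inj; rewrite /= partition_of0.
Qed.

Lemma rank_ge_00 : rank_ge 0 0 = 1%N.
Proof.
rewrite -npart0; apply: eq_card => la; rewrite !inE partition_of0.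
by rewrite /rank big_nil.
Qed.

Lemma rank_le_00 : rank_le 0 0 = 1%N.
Proof.
rewrite -npart0; apply: eq_card => la; rewrite !inE partition_of0.
by rewrite /rank big_nil.
Qed.

(** Both sides obey the same recursion with the same boundary values, by the two directions of
    Dyson's map. This takes the place of conjugation. *)
Lemma rank_ge_sym n (s : nat) : rank_le n (- s%:Z) = rank_ge n s%:Z.
Proof.
elim/ltn_ind: n s => n IH s; case: (ltnP s n) => [lt_sn | le_ns].
  have := rank_ge_rec lt_sn; have := rank_le_rec lt_sn.
  by rewrite (IH (n - s.+1)%N); lia.
case: (posnP s) le_ns => [->|s0] le_ns; last by rewrite rank_ge0 ?rank_le0.
have -> : n = 0%N by lia.
by rewrite oppr0 rank_le_00 rank_ge_00.
Qed.

Lemma N_opp (m : int) n : N (- m) n = N m n.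
Proof.
have pos (k : nat) : N (- k%:Z) n = N k%:Z n.
  have := N_rank_ge k%:Z n; have := N_rank_le k%:Z n.
  have -> : k%:Z + 1 = k.+1%:Z by lia.
  by rewrite !rank_ge_sym; lia.
by case: m => k; rewrite ?NegzE ?opprK pos.
Qed.

Lemma npart_rank n : (rank_ge n 0 + rank_ge n 1 = npart n)%N.
Proof. by rewrite -(rank_ge_le n 0) -(rank_ge_sym n 1). Qed.

(** * Generating functions of ranks *)

Definition gf (a : nat -> nat) : K := emb (PSeries (fun n => (a n)%:R)).

Definition P : K := gf npart.

Definition tail_gf (s : nat) : K := gf (fun n => rank_ge n s%:Z).

Definition pent (n : int) : int := ((n * (3 * n + 1)) %/ 2)%Z.

Lemma pentE n : pent n * 2 = n * (3 * n + 1).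
Proof.
rewrite /pent divzK //; apply/dvdzP.
exists (3 * tri n - n); have := triE n; lia.
Qed.

Lemma q_mul (a : int) (f : pseries) (k : nat) : a = k%:Z ->
  q ^ a * emb f = emb (pX ^+ k * f).
Proof. by move=> ->; rewrite rmorphM rmorphXn. Qed.

Lemma V_gf a : V 0 (gf a). Proof. exact: V_series. Qed.

Lemma gf_eq_V (a b : nat -> nat) M : (forall n, (n < M)%N -> a n = b n) ->
  V M%:Z (gf a - gf b).
Proof.
move=> ab; rewrite /gf -rmorphB; apply: ord_ge_V => i /ab; rewrite coefsB /= => ->.
exact: subrr.
Qed.

(* [tail_gf s] without its constant term, present only for [s = 0]. *)
Definition tail0 s : K := tail_gf s - (s == 0%N)%:R.

(** [rank_ge_rec] requires [s < n]. For [n <= s] all counts vanish except that of the empty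
    partition at [s = 0], whence the subtraction in [tail0]. *)
Lemma tail0_rec s : tail0 s = q ^ s.+1%:Z * (P - tail0 (s + 3)).
Proof.
rewrite /tail0 addn_eq0 andbF subr0 /P /tail_gf /gf -rmorphB (q_mul _ (k := s.+1)) //.
rewrite -(rmorph_nat emb) -rmorphB; congr (emb _); apply: pseriesP => n.
rewrite coefs_pXnM coefsB -(mulr_natr 1) mul1r.
have coefs_nat k : coefs k%:R n = (if n == 0%N then k else 0%N)%:R.
  by elim: k => [|k IH]; [case: eqP | rewrite -natr1 coefsD IH coefs1;
     case: eqP => _; rewrite ?natr1 // addr0].
rewrite coefs_nat; case: (ltnP s n) => [lt_sn | le_ns].
  rewrite coefsB /= -(rank_ge_rec lt_sn) natrD addrK.
  by rewrite gtn_eqF ?subr0 //; lia.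
case: (posnP s) le_ns => [-> | s0] le_ns /=.
  have -> : n = 0%N by lia.
  by rewrite rank_ge_00 subrr.
by rewrite rank_ge0 //; case: (s) s0 => // s' _; case: eqP => _; rewrite subr0.
Qed.

(** The coefficient reached after [k] applications of [tail0_rec]; its exponent is ks plus the
    pentagonal number k(3k-1)/2. *)
Definition euler_term (s k : nat) : K := (-1) ^+ k * q ^ (k%:Z * s%:Z + pent (- k%:Z)).

Lemma euler_term0 s : euler_term s 0 = 1.
Proof.
rewrite /euler_term mul0r expr0 mul1r.
by have -> : 0 + pent (- 0%:Z) = 0 by have := pentE (- 0%:Z); lia.
Qed.

Lemma euler_termS s k : euler_term s k.+1 = - euler_term s k * q ^ (s + 3 * k).+1%:Z.
Proof.
rewrite /euler_term exprS mulN1r !mulNr -mulrA -qD; congr (- (_ * _ ^ _)).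
have := pentE (- k%:Z); have := pentE (- k.+1%:Z); nia.
Qed.

Lemma V_euler_term s k (a : int) : a <= k%:Z -> V a (euler_term s k).
Proof.
move=> ak; rewrite /euler_term mulrC; apply: VM0; last first.
  by rewrite -signr_odd; case: odd; [apply/VN/V1 | apply: V1].
apply: V_le (V_q _); have := pentE (- k%:Z).
have : 0 <= k%:Z * s%:Z by [].
have : k%:Z <= k%:Z * k%:Z by case: k {ak} => // k; nia.
lia.
Qed.

Lemma tail0_expand s B : tail0 s
  = - P * (\sum_(j < B) euler_term s j.+1) + euler_term s B * tail0 (s + 3 * B).
Proof.
elim: B => [|B IH]; first by rewrite big_ord0 mulr0 add0r euler_term0 mul1r addn0.
rewrite {1}IH big_ord_recr /= tail0_rec euler_termS.
have -> : (s + 3 * B + 3 = s + 3 * B.+1)%N by lia.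
ring.
Qed.

Lemma V_tail0 s : V 0 (tail0 s).
Proof. by apply: VB; [apply: V_gf | apply: V_nat]. Qed.

Lemma P_tail0 : P = 1 + tail0 0 + tail0 1.
Proof.
rewrite /tail0 eqxx /= mulr1n mulr0n subr0 [1 + _]addrC subrK.
rewrite /P /tail_gf /gf -rmorphD; congr (emb _).
by apply: pseriesP => n; rewrite coefsD /= -natrD -npart_rank.
Qed.

Definition pent_term (b n : int) : K := sgn n * q ^ (pent n + b * n).

Lemma pent_term_pos b (k : nat) : pent_term b%:Z k%:Z = euler_term b.+1 k.
Proof.
rewrite /pent_term /euler_term /sgn -exprnP; congr (_ * _ ^ _).
have := pentE k%:Z; have := pentE (- k%:Z); nia.
Qed.

Lemma pent_term_neg b (k : nat) : pent_term b (- k%:Z) = (-1) ^+ k * q ^ (pent (- k%:Z) - b * k%:Z).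
Proof.
by rewrite /pent_term /sgn -invr_expz -exprnP -exprVn invrN1 mulrN.
Qed.

Definition centered (g : int -> K) M := \sum_(j < M) (g j%:Z + g (- j.+1%:Z)).

(** Euler's pentagonal number theorem, obtained by expanding both tails in [P_tail0], that is, by
    splitting partitions according to the sign of the rank. The term [euler_term 1 B] corrects for
    the range of [centered], which stops one step earlier on the positive side. *)
Lemma lim_pentagonal : lim (fun B => P * centered (pent_term 0) B) 1.
Proof.
move=> k; exists (`|k|)%N => B leB.
have -> : P * centered (pent_term 0) B - 1
  = euler_term 0 B * tail0 (0 + 3 * B) + euler_term 1 B * tail0 (1 + 3 * B)
    - P * euler_term 1 B.
  have e : P * (1 + \sum_(j < B) (euler_term 0 j.+1 + euler_term 1 j.+1))
      = 1 + euler_term 0 B * tail0 (0 + 3 * B) + euler_term 1 B * tail0 (1 + 3 * B).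
    have := P_tail0; rewrite (tail0_expand 0 B) (tail0_expand 1 B) big_split /=.
    by move/eqP; rewrite -subr_eq0 => /eqP h; apply/eqP; rewrite -subr_eq0;
      apply/eqP; rewrite -[RHS]h; ring.
  have -> : centered (pent_term 0) B
    = 1 + \sum_(j < B) (euler_term 0 j.+1 + euler_term 1 j.+1) - euler_term 1 B.
    elim: {e} B {leB} => [|B IH].
      by rewrite /centered !big_ord0 euler_term0 addr0 subrr.
    rewrite /centered !big_ord_recr /= -/(centered _ _) IH.
    rewrite pent_term_pos pent_term_neg mul0r subr0 /euler_term mulr0 add0r; ring.
  by rewrite mulrBr e; ring.
apply: VB; first apply: VD.
- by apply: VM0 (V_tail0 _); apply: V_euler_term; lia.
- by apply: VM0 (V_tail0 _); apply: V_euler_term; lia.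
by rewrite mulrC; apply: VM0 (V_gf _); apply: V_euler_term; lia.
Qed.

(** * Lambert series of the rank classes *)

Section Classes.
Variable l : nat.
Hypothesis l_gt0 : (0 < l)%N.

(* Ranks of partitions of [n] are at most [n], so the sum over all [j] stops. *)
Definition tail_class s n : nat := (\sum_(j < n.+1) rank_ge n (s + l * j)%N%:Z)%N.

(** Passing from [s] to [s + l j] multiplies the [i]-th Euler term by q^(lij), and the geometric
    series in [j] produces the denominator 1 - q^(li). *)
Lemma lim_tail_class s : (0 < s)%N ->
  lim (fun B => - P * \sum_(j < B) euler_term s j.+1 / (1 - U l j.+1%:Z))
    (gf (tail_class s)).
Proof.
move=> s0 k; exists `|k|%N => B leB.
have step1 : V B%:Z (gf (tail_class s) - \sum_(j < B) tail_gf (s + l * j)).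
  have -> : \sum_(j < B) tail_gf (s + l * j)
      = gf (fun n => \sum_(j < B) rank_ge n (s + l * j)%N%:Z)%N.
    rewrite /tail_gf /gf -rmorph_sum; congr (emb _); apply: pseriesP => n.
    by rewrite coefs_sum /= natr_sum.
  apply: gf_eq_V => n ltnB; rewrite /tail_class.
  rewrite -(big_mkord predT (fun j => rank_ge n (s + l * j)%:Z)).
  rewrite -(big_mkord predT (fun j => rank_ge n (s + l * j)%:Z)).
  rewrite [RHS](big_cat_nat (n := n.+1)) //= [X in (_ + X)%N]big1_seq ?addn0 // => j.
  rewrite mem_index_iota => /and3P[_ nj _]; have lj := leq_pmull j l_gt0.
  by rewrite rank_ge0 //; lia.
have euler_shift j i : euler_term (s + l * j) i = euler_term s i * U l i%:Z ^+ j.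
  rewrite U_exp // /euler_term /U -mulrA -qD; congr (_ * _ ^ _).
  by lia.
have step2 : V B%:Z (\sum_(j < B) tail_gf (s + l * j)
    - - P * \sum_(i < B) \sum_(j < B) euler_term (s + l * j) i.+1).
  rewrite exchange_big mulr_sumr -sumrB; apply: V_sum => j _.
  have -> : tail_gf (s + l * j) = tail0 (s + l * j).
    by rewrite /tail0 gtn_eqF ?subr0 //; lia.
  rewrite (tail0_expand _ B) addrAC subrr add0r.
  by apply: VM0 (V_tail0 _); apply: V_euler_term.
set S := \sum_(j < B) _ / _.
have step3 : V B%:Z (\sum_(i < B) \sum_(j < B) euler_term (s + l * j) i.+1 - S).
  rewrite /S -sumrB; apply: V_sum => i _.
  under eq_bigr do rewrite euler_shift.
  rewrite -mulr_sumr -mulrBr mulrC; apply: VM0; last exact: V_euler_term.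
  have nz : 1 - U l i.+1%:Z != 0 by apply: oneBU_neq0.
  have -> : \sum_(j < B) U l i.+1%:Z ^+ j - (1 - U l i.+1%:Z)^-1
      = - (U l i.+1%:Z ^+ B / (1 - U l i.+1%:Z)).
    have := subrX1 (U l i.+1%:Z) B; set u := U l _ in nz *; set G := \sum_(j < B) _.
    move=> h; have -> : u ^+ B = 1 - (1 - u) * G by rewrite -[LHS](subrK 1) h; ring.
    by field.
  apply: VN; apply: VM0 (V_invBU _ _); rewrite U_exp //; apply: V_U => //; nia.
have -> : - P * S - gf (tail_class s)
  = P * (\sum_(i < B) \sum_(j < B) euler_term (s + l * j) i.+1 - S)
    - (\sum_(j < B) tail_gf (s + l * j)
       - - P * \sum_(i < B) \sum_(j < B) euler_term (s + l * j) i.+1)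
    - (gf (tail_class s) - \sum_(j < B) tail_gf (s + l * j)) by ring.
have le_kB : k <= B%:Z by lia.
apply: VB; last exact: V_le step1.
apply: VB; last exact: V_le step2.
by rewrite mulrC; apply: VM0 (V_gf _); apply: V_le step3.
Qed.

Definition lambert_term (b : nat) (n : int) : K := pent_term b%:Z n / (1 - U l n).

(** Positive [n] give the tail at [b + 1]. For negative [n], 1/(1 - q^(-lk)) = -q^(lk)/(1 - q^(lk))
    changes the sign and turns [-b] into [l - b]. The term [n = 0] is an inverse of 0 and drops
    out. *)
Lemma lim_lambert b : (b < l)%N ->
  lim (fun B => P * centered (lambert_term b) B)
    (gf (tail_class (l - b)) - gf (tail_class b.+1)).
Proof.
move=> lt_bl.
have lb0 : (0 < l - b)%N by lia.
have := limB (lim_tail_class lb0) (lim_tail_class (ltn0Sn b)).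
have lim0 : lim (fun B => P * (euler_term b.+1 B / (1 - U l B%:Z))) 0.
  move=> k; exists `|k|%N => B leB; rewrite subr0 mulrC.
  by apply: VM0 (V_gf _); apply: VM0 (V_invBU _ _); apply: V_euler_term; lia.
move=> /limB /(_ lim0); rewrite subr0; apply: lim_ext; exists 1%N => B B1.
case: B B1 => // B _; rewrite /centered big_split [X in _ = _ * (X + _)]big_ord_recl /=.
have -> : lambert_term b 0 = 0 by rewrite /lambert_term U0 subrr invr0 mulr0.
have -> : \sum_(i < B) lambert_term b (bump 0 i)%:Z
    = \sum_(i < B) euler_term b.+1 i.+1 / (1 - U l i.+1%:Z).
  by apply: eq_bigr => i _; rewrite /lambert_term pent_term_pos.
have -> : \sum_(i < B.+1) lambert_term b (- i.+1%:Z)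
    = - \sum_(i < B.+1) euler_term (l - b) i.+1 / (1 - U l i.+1%:Z).
  rewrite -sumrN; apply: eq_bigr => i _; rewrite /lambert_term pent_term_neg.
  have nz : 1 - U l i.+1%:Z != 0 by apply: oneBU_neq0.
  have -> : 1 - U l (- i.+1%:Z) = - U l (- i.+1%:Z) * (1 - U l i.+1%:Z).
    by rewrite UN; field; exact: U_neq0.
  have -> : q ^ (pent (- i.+1%:Z) - b%:Z * i.+1%:Z)
     = q ^ (i.+1%:Z * (l - b)%N%:Z + pent (- i.+1%:Z)) * U l (- i.+1%:Z).
    by rewrite /U -qD; congr (_ ^ _); rewrite -subzn; [ring | exact: ltnW].
  rewrite /euler_term; have := U_neq0 l (- i.+1%:Z).
  move: (U l (- i.+1%:Z)) (1 - U l i.+1%:Z) nz => x y y0 x0.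
  by field; rewrite ?oppr_eq0 ?x0 ?y0.
rewrite [X in _ - - _ * X]big_ord_recr /=; ring.
Qed.
End Classes.

(** * Dissection modulo l *)

Section Grading.
Variable l : nat.
Hypothesis l_gt0 : (0 < l)%N.

Definition res (r n : int) := exists k : int, n = r + l%:Z * k.

(** Satisfied by a residue class and also by the complement of one; the complement is used to say
    that a class of exponents is absent. *)
Definition periodic (R : int -> Prop) := forall n m, res 0 (n - m) -> R n -> R m.

Lemma res_periodic r : periodic (res r).
Proof. by move=> n m [k kE] [j jE]; exists (j - k); lia. Qed.

Lemma res_compl_periodic r : periodic (fun n => ~ res r n).
Proof. by move=> n m [k kE] nr [j jE]; apply: nr; exists (j + k); lia. Qed.

Definition supp (R : int -> Prop) (f : pseries) :=
  forall n : nat, coefs f n != 0 -> R n%:Z.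

(* A grading modulo [l] of the whole field rather than of the power series:
   theta functions of [q^l], which occur in denominators, have degree [0]. *)
Definition graded (R : int -> Prop) (x : K) :=
  exists f g, [/\ g != 0, supp (res 0) g, supp R f & x = emb f / emb g].

Definition cls r := graded (res r).

Lemma supp1 : supp (res 0) 1.
Proof. by case=> [_|n]; [exists 0; lia | rewrite coefs1 eqxx]. Qed.

Lemma suppM r s f g : supp (res r) f -> supp (res s) g -> supp (res (r + s)) (f * g).
Proof.
move=> fr gs n; rewrite coefsM => nz.
have [i] : exists i : 'I_n.+1, coefs f i * coefs g (n - i)%N != 0.
  apply: contrapT => no; move/negP: nz; apply; apply/eqP; apply: big1 => i _.
  by apply/eqP; apply: contrapT => /negP ?; apply: no; exists i.
rewrite mulf_eq0 negb_or => /andP[/fr[j jE] /gs[k kE]].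
by exists (j + k); have := ltn_ord i; lia.
Qed.

Lemma suppM0 R f g : periodic R -> supp R f -> supp (res 0) g -> supp R (f * g).
Proof.
move=> pR fr g0 n; rewrite coefsM => nz.
have [i] : exists i : 'I_n.+1, coefs f i * coefs g (n - i)%N != 0.
  apply: contrapT => no; move/negP: nz; apply; apply/eqP; apply: big1 => i _.
  by apply/eqP; apply: contrapT => /negP ?; apply: no; exists i.
rewrite mulf_eq0 negb_or => /andP[/fr Ri /g0[k kE]].
by apply: pR Ri; exists (- k); have := ltn_ord i; lia.
Qed.

Lemma suppD R f g : supp R f -> supp R g -> supp R (f + g).
Proof.
move=> fR gR n; rewrite coefsD => nz; case: (eqVneq (coefs f n) 0) => [f0|/fR //].
by apply: gR; move: nz; rewrite f0 add0r.
Qed.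

(** The part [h'] of [h] outside [R] satisfies h' g = 0, because multiplication by [g] mixes no
    residues; as [g] is nonzero in a domain, h' = 0. *)
Lemma supp_proj R h g : periodic R -> g != 0 -> supp (res 0) g ->
  supp R (h * g) -> supp R h.
Proof.
move=> pR nzg g0 hgR.
pose h' := PSeries (fun n => if `[< R n%:Z >] then 0 else coefs h n).
suff h'0 : h' = 0.
  move=> n nz; apply: contrapT => nR; move/eqP: nz; apply.
  have := congr1 (coefs^~ n) h'0; rewrite /= asboolF //.
apply/eqP; rewrite -(mulIr_eq0 _ (mulIf nzg)); apply/eqP; apply: pseriesP => n.
rewrite coefs0 coefsM; have [Rn|nRn] := pselect (R n%:Z).
  apply: big1 => i _ /=; case: asboolP => Ri; first by rewrite mul0r.
  case: (eqVneq (coefs g (n - i)%N) 0) => [->|/g0 [k kE]]; first by rewrite mulr0.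
  case: Ri; apply: pR Rn; exists k; have := ltn_ord i; lia.
have hg0 : coefs (h * g) n = 0 by apply: contrapT => /eqP /hgR.
rewrite -[RHS]hg0 coefsM; apply: eq_bigr => i _ /=; case: asboolP => // Ri.
case: (eqVneq (coefs g (n - i)%N) 0) => [->|/g0 [k kE]]; first by rewrite !mulr0.
by case: nRn; apply: pR Ri; exists (- k); have := ltn_ord i; lia.
Qed.

Lemma graded_emb R h : periodic R -> graded R (emb h) -> supp R h.
Proof.
move=> pR [f [g [nzg g0 fR hE]]]; apply: (supp_proj pR nzg g0).
suff -> : h * g = f by [].
apply/eqP; rewrite -emb_eq rmorphM hE divfK //.
by rewrite emb_eq0.
Qed.

Lemma emb_graded R h : supp R h -> graded R (emb h).
Proof.
by move=> hR; exists h, 1; split; rewrite ?oner_eq0 ?rmorph1 ?divr1 //; apply: supp1.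
Qed.

Lemma gradedD R x y : periodic R -> graded R x -> graded R y -> graded R (x + y).
Proof.
move=> pR [f [g [nzg g0 fR ->]]] [f' [g' [nzg' g'0 f'R ->]]].
exists (f * g' + f' * g), (g * g'); split.
- by rewrite mulf_neq0.
- by rewrite -[0]addr0; apply: suppM.
- by apply: suppD; apply: suppM0.
by rewrite rmorphD !rmorphM addf_div ?emb_eq0.
Qed.

Lemma graded0 R : graded R 0.
Proof. by rewrite -[0](rmorph0 emb); apply: emb_graded => n; rewrite coefs0 eqxx. Qed.

Lemma clsM r s x y : cls r x -> cls s y -> cls (r + s) (x * y).
Proof.
move=> [f [g [nzg g0 fR ->]]] [f' [g' [nzg' g'0 f'R ->]]].
exists (f * f'), (g * g'); split; first by rewrite mulf_neq0.
- by rewrite -[0]addr0; apply: suppM.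
- exact: suppM.
by rewrite !rmorphM mulf_div.
Qed.

Lemma cls_res r s x : res r s -> cls r x -> cls s x.
Proof.
move=> [k kE] [f [g [nzg g0 fR ->]]]; exists f, g; split=> // n /fR [j jE].
by exists (j - k); lia.
Qed.

Lemma clsD0 x y : cls 0 x -> cls 0 y -> cls 0 (x + y).
Proof. exact/gradedD/res_periodic. Qed.

Lemma clsM0 x y : cls 0 x -> cls 0 y -> cls 0 (x * y).
Proof. by move=> cx cy; rewrite -[0]addr0; apply: clsM. Qed.

Lemma cls1 : cls 0 1.
Proof. by rewrite -(rmorph1 emb); apply/emb_graded/supp1. Qed.

Lemma clsN r x : cls r x -> cls r (- x).
Proof.
move=> [f [g [nzg g0 fR ->]]]; exists (- f), g; split=> //; last first.
  by rewrite rmorphN mulNr.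
by move=> n; rewrite coefsN oppr_eq0 => /fR.
Qed.

Lemma clsB0 x y : cls 0 x -> cls 0 y -> cls 0 (x - y).
Proof. by move=> cx /clsN; apply: clsD0. Qed.

Lemma cls_nat n : cls 0 n%:R.
Proof.
elim: n => [|n IH]; first exact: graded0.
by rewrite -natr1; apply: clsD0 => //; apply: cls1.
Qed.

Lemma clsV0 x : cls 0 x -> cls 0 x^-1.
Proof.
have [-> _|nzx] := eqVneq x 0; first by rewrite invr0; apply: graded0.
move=> [f [g [nzg g0 fR xE]]]; exists g, f; split=> //; last by rewrite xE invf_div.
by apply: contraNneq nzx => f0; rewrite xE f0 rmorph0 mul0r.
Qed.

Lemma clsX0 x n : cls 0 x -> cls 0 (x ^+ n).
Proof. by move=> cx; elim: n => [|n IH]; [apply: cls1 | rewrite exprS; apply: clsM0]. Qed.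

Lemma cls_qn (n : nat) : cls n%:Z (q ^+ n).
Proof.
rewrite /q -rmorphXn; apply: emb_graded => i; rewrite -[pX ^+ n]mulr1 coefs_pXnM.
by case: leqP => [le_ni|]; rewrite ?eqxx // coefs1 subn_eq0 pnatr_eq0 eqb0 negbK => h;
   exists 0; lia.
Qed.

Lemma cls_q (n : int) : cls n (q ^ n).
Proof.
case: n => n; first exact: cls_qn.
have [f [g [nzg g0 fR qE]]] := cls_qn (n.+1 * l.-1).
(* A negative power must become a fraction whose denominator has exponents divisible by [l]. *)
have -> : q ^ (Negz n) = q ^+ (n.+1 * l.-1) / q ^+ (n.+1 * l).
  rewrite NegzE -exprnN; apply: (mulIf (expf_neq0 (n.+1 * l) q_neq0)).
  rewrite divfK ?expf_neq0 ?q_neq0 // mulrC.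
  have -> : (n.+1 * l = n.+1 * l.-1 + n.+1)%N by case: (l) l_gt0 => // k _; lia.
  by rewrite exprD mulfK // expf_neq0 ?q_neq0.
rewrite -[Negz n]subr0; apply: (cls_res (r := (n.+1 * l.-1)%N%:Z + 0)).
  by exists (- n.+1%:Z); case: (l) l_gt0 => // k _; lia.
apply: clsM; first exact: cls_qn.
apply: clsV0; apply: (cls_res (r := (n.+1 * l)%N%:Z)); last exact: cls_qn.
by exists (- n.+1%:Z); lia.
Qed.

Lemma cls_U z : cls 0 (U l z).
Proof. by apply: cls_res (cls_q _); exists (- z); lia. Qed.

(** A power of q^l, which has degree 0, moves the limit into the power series; there each
    coefficient equals that of a late enough term. *)
Lemma cls_lim r x y : (forall M, cls r (x M)) -> lim x y -> cls r y.
Proof.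
move=> cx xy; have [a Va] := V_lb y.
have [c ac] : exists c : nat, - (l%:Z * c%:Z) <= a by exists `|a|%N; nia.
have [h hE] : exists h, y * q ^ (l%:Z * c%:Z) = emb h.
  apply: V0_seriesP; have := VM (V_le ac Va) (V_q (l%:Z * c%:Z)).
  by rewrite addNr.
have ch : supp (res r) h.
  move=> n nz; have [M /(_ M (leqnn M)) VxM] := xy (n.+1%:Z - l%:Z * c%:Z).
  have {}VxM : V n.+1%:Z (x M * q ^ (l%:Z * c%:Z) - emb h).
    by rewrite -hE -mulrBl -[n.+1%:Z](subrK (l%:Z * c%:Z)); apply: VM (V_q _).
  have [g gE] : exists g, x M * q ^ (l%:Z * c%:Z) = emb g.
    apply: V0_seriesP; rewrite -[x M * _](subrK (emb h)).
    by apply: VD; [apply: V_le VxM | apply: V_series].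
  have sg : supp (res r) g.
    apply: graded_emb; first exact: res_periodic.
    by rewrite -gE -[r]addr0; apply: clsM => //; exact: (cls_U c%:Z).
  apply: sg; rewrite gE -rmorphB in VxM; have := V_ord_ge VxM (ltnSn n).
  by rewrite coefsB => /eqP; rewrite subr_eq0 => /eqP ->.
have -> : y = emb h * q ^ (l%:Z * - c%:Z).
  by rewrite -hE -mulrA -qD mulrN addrN mulr1.
by rewrite -[r]addr0; apply: clsM; [apply: emb_graded | exact: (cls_U (- c%:Z))].
Qed.

Lemma cls_Qinf e : cls 0 (Qinf l_gt0 e).
Proof.
apply: cls_lim (lim_Q l_gt0 e) => M; rewrite /Q; elim/big_rec: _ => [|j x _ cx].
  exact: cls1.
by apply: clsM0 => //; apply: clsB0 (cls_U _); apply: cls1.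
Qed.

Lemma cls_Th d : cls 0 (Th l_gt0 d).
Proof. by apply: clsM0; apply: cls_Qinf. Qed.

Lemma cls_hassum r g G : (forall m, cls r (g m)) -> hassum g G -> cls r G.
Proof.
move=> cg gG; apply: (cls_lim _ gG) => M.
elim/big_rec: _ => [|j x _ cx]; first exact: graded0.
have pR := @res_periodic r.
by apply: (gradedD pR _ cx); apply: (gradedD pR (cg _) (cg _)).
Qed.

Lemma cls_sgn m : cls 0 (sgn m).
Proof.
have sg n : cls 0 ((-1) ^+ n) by apply/clsX0/clsN/cls1.
by case: m => n; [|rewrite NegzE /sgn -invr_expz; apply: clsV0]; apply: sg.
Qed.

Variable h : int.
Hypothesis hE : 2 * h = 3 * l%:Z - 1.

(** The term at [n = a + l m] of the pentagonal-type series without its factor [class_factor b a].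
    The number [h] is the gap between the linear coefficients of [3 l tri m] and of
    [pent (l m) / l]. *)
Definition tau (b a m : int) : K :=
  sgn m * U l (3 * l%:Z * tri m - (h - b - 3 * a) * m).

Definition tau_pole b a m : K := tau b a m / (1 - U l (a + l%:Z * m)).

Lemma summable_tau b a : summable (tau b a).
Proof.
move=> k; have [B BP] := tri_ge l_gt0 (- (h - b - 3 * a)) 0 `|k|.
exists B => m /BP le_k; rewrite /tau mulrC; apply: VM0 (V_sgn m).
by apply: V_U => //; lia.
Qed.

Lemma summable_tau_pole b a : summable (tau_pole b a).
Proof.
move=> k; have [B BP] := summable_tau b a k; exists B => m /BP Vt.
by apply: VM0 => //; apply: V_invBU.
Qed.

Definition theta_sum b a : K := projT1 (cid (hassum_exists (summable_tau b a))).
Definition lambert_sum b a : K :=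
  projT1 (cid (hassum_exists (summable_tau_pole b a))).

Lemma theta_sumP b a : hassum (tau b a) (theta_sum b a).
Proof. exact: projT2 (cid (hassum_exists (summable_tau b a))). Qed.
Lemma lambert_sumP b a : hassum (tau_pole b a) (lambert_sum b a).
Proof. exact: projT2 (cid (hassum_exists (summable_tau_pole b a))). Qed.

Lemma cls_tau b a m : cls 0 (tau b a m).
Proof. by apply: clsM0; [apply: cls_sgn | apply: cls_U]. Qed.

Lemma cls_theta_sum b a : cls 0 (theta_sum b a).
Proof. by apply: cls_hassum (theta_sumP b a); apply: cls_tau. Qed.

Lemma cls_lambert_sum b a : cls 0 (lambert_sum b a).
Proof.
apply: cls_hassum (lambert_sumP b a) => m; apply: clsM0; first exact: cls_tau.
by apply/clsV0/clsB0; [apply: cls1 | apply: cls_U].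
Qed.

Definition class_factor (b a : int) : K := sgn a * q ^ (pent a + b * a).

Lemma pent_term_class b a m :
  pent_term b (a + l%:Z * m) = class_factor b a * tau b a m.
Proof.
have lE : odd l by lia.
rewrite /pent_term /class_factor /tau mulrACA /U -qD; congr (_ * _ ^ _).
  rewrite /sgn expfzDr ?oppr_eq0 ?oner_eq0 // -exprz_exp -[(-1) ^ l%:Z]/((-1) ^+ l).
  by rewrite -signr_odd lE expr1.
have := pentE (a + l%:Z * m); have := pentE a; have := triE m => e1 e2 e3.
have := congr1 (fun x => 3 * (l%:Z * l%:Z) * x) e1 => e4.
have := congr1 (fun x => l%:Z * m * x) hE => e5.
lia.
Qed.

(** The half-open range from -lM to lM - 1 splits evenly: in each class [m] runs from -M to M -
    1. *)
Lemma centered_classes g M :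
  centered g (l * M) = \sum_(a < l) centered (fun m => g (a%:Z + l%:Z * m)) M.
Proof.
rewrite /centered -sum_centered.
under [RHS]eq_bigr do rewrite -(sum_centered (fun m => g (_ + l%:Z * m))).
have -> : (2 * (l * M) = l * (2 * M))%N by lia.
have : forall N, \sum_(i < l * N) g (i%:Z - (l * M)%N%:Z)
  = \sum_(a < l) \sum_(j < N) g (a%:Z + l%:Z * (j%:Z - M%:Z)); last by apply.
elim=> [|N IH].
  by rewrite muln0 big_ord0 big1 // => a _; rewrite big_ord0.
under [RHS]eq_bigr do rewrite big_ord_recr /=.
rewrite big_split -IH mulnS addnC big_split_ord /=; congr (_ + _).
by apply: eq_bigr => a _; congr g; lia.
Qed.

Lemma lim_classes b g G : (forall a, hassum (g a) (G a)) ->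
    (forall a m, cls 0 (g a m)) ->
  lim (fun M => \sum_(a < l) class_factor b a%:Z * centered (g a%:Z) M)
    (\sum_(a < l) class_factor b a%:Z * G a%:Z).
Proof.
move=> gG _; apply: lim_sum => a _; apply: limM; first exact: lim_cst.
exact: gG.
Qed.

Lemma pentagonal_classes :
  P * \sum_(a < l) class_factor 0 a%:Z * theta_sum 0 a%:Z = 1.
Proof.
have l1 := limM (lim_cst P) (lim_classes 0 (theta_sumP 0) (cls_tau 0)).
apply: (lim_unique l1).
have l2 : lim (fun M => P * centered (pent_term 0) (l * M)) 1.
  apply: (lim_comp (s := fun M => l * M)%N) lim_pentagonal => B.
  by exists B => M leB; apply: leq_trans leB _; apply: leq_pmull.
apply: lim_ext l2; exists 0%N => M _; rewrite centered_classes; congr (_ * _).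
apply: eq_bigr => a _; rewrite /centered mulr_sumr; apply: eq_bigr => j _.
by rewrite !pent_term_class mulrDr.
Qed.

Lemma lambert_classes (b : nat) : (b < l)%N ->
  P * \sum_(a < l) class_factor b%:Z a%:Z * lambert_sum b%:Z a%:Z
  = gf (tail_class l (l - b)) - gf (tail_class l b.+1).
Proof.
move=> lt_bl.
have cp a m : cls 0 (tau_pole b%:Z a m).
  apply: clsM0; first exact: cls_tau.
  by apply/clsV0/clsB0; [apply: cls1 | apply: cls_U].
have l1 := limM (lim_cst P) (lim_classes b%:Z (lambert_sumP b%:Z) cp).
apply: (lim_unique l1).
have l2 : lim (fun M => P * centered (lambert_term l b) (l * M))
    (gf (tail_class l (l - b)) - gf (tail_class l b.+1)).
  apply: (lim_comp (s := fun M => l * M)%N) (lim_lambert l_gt0 lt_bl) => B.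
  by exists B => M leB; apply: leq_trans leB _; apply: leq_pmull.
apply: lim_ext l2; exists 0%N => M _; rewrite centered_classes; congr (_ * _).
apply: eq_bigr => a _; rewrite /centered mulr_sumr; apply: eq_bigr => j _.
by rewrite /lambert_term !pent_term_class mulrDr /tau_pole !mulrA.
Qed.

Section Explicit.
Variables (b d : int) (i j k : nat).
Hypothesis ijk : (i < j < k)%N && (k < l)%N.
Hypothesis sum_ijk : i%:Z + j%:Z + k%:Z = h - b - d * l%:Z.

Let al (c : 'I_3) : int := (nth 0%N [:: i; j; k] c)%:Z.

Let al_ndvd c c' : c' != c -> ndvd l (al c' - al c).
Proof.
have nd (x y : nat) : (x < y < l)%N -> ndvd l (y%:Z - x%:Z) /\ ndvd l (x%:Z - y%:Z).
  by move=> xy; split; [apply: ndvd_small | apply: ndvd_opp_small]; lia.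
have [ij ji] := nd i j ltac:(lia); have [ik ki] := nd i k ltac:(lia).
have [jk kj] := nd j k ltac:(lia).
by case: c c' => -[|[|[|]]] //= ? [[|[|[|]]]].
Qed.

Let t (x y : nat) : K := Th l_gt0 (y%:Z - x%:Z).

(** The three-term combination after clearing the squared [J] and the three theta values; the signs
    and the powers of [u] come from [ThN]. *)
Definition triple (X : int -> K) : K :=
  t j k * U l (- d * i%:Z) * X i%:Z
  - t i k * U l (j%:Z - i%:Z - d * j%:Z) * X j%:Z
  + t i j * U l (2 * k%:Z - i%:Z - j%:Z - d * k%:Z) * X k%:Z.

(** The condition on i + j + k serves here: it makes s0 - 3 al c + d l equal to h - b - 3 al c, so
    the interpolation weights are the terms of the dissected series. *)
Let weightE c m : weight l al d c m = U l (- d * al c) * tau b (al c) m.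
Proof.
rewrite /weight /tau mulrCA -UD; congr (_ * U _ _).
rewrite !big_ord_recl big_ord0 /al /=; have := congr1 (fun x => x * m) sum_ijk; lia.
Qed.

Let t_neq0 x y : (x < y < l)%N -> t x y != 0.
Proof. by move=> xy; apply/Th_neq0/ndvd_small; lia. Qed.

Let regular_sum (X : int -> K) :
  \sum_c regular_lim l_gt0 al c * (U l (- d * al c) * X (al c))
  = triple X / (J l_gt0 * J l_gt0 * t i j * t i k * t j k).
Proof.
have tij : t i j != 0 by apply: t_neq0; lia.
have tik : t i k != 0 by apply: t_neq0; lia.
have tjk : t j k != 0 by apply: t_neq0; lia.
have opp x y : (x < y < l)%N -> Th l_gt0 (x%:Z - y%:Z) = - U l (x%:Z - y%:Z) * t x y.
  move=> xy; have -> : x%:Z - y%:Z = - (y%:Z - x%:Z) by ring.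
  by rewrite ThN //; apply: ndvd_small; lia.
rewrite /regular_lim !big_ord_recl big_ord0 addr0.
rewrite !(big_mkcond (fun c' => c' != _)) !big_ord_recl !big_ord0 /= /al /=.
rewrite !mulr1 !mul1r /triple.
rewrite (opp i j) ?(opp i k) ?(opp j k); try lia.
rewrite -/(t i j) -/(t i k) -/(t j k).
have -> : U l (j%:Z - i%:Z - d * j%:Z) = (U l (i%:Z - j%:Z))^-1 * U l (- d * j%:Z).
  by rewrite -UN -UD; congr U; ring.
have -> : U l (2 * k%:Z - i%:Z - j%:Z - d * k%:Z)
    = (U l (i%:Z - k%:Z))^-1 * (U l (j%:Z - k%:Z))^-1 * U l (- d * k%:Z).
  by rewrite -!UN -!UD; congr U; ring.
have Jn := J_neq0 l_gt0.
have uij := U_neq0 l (i%:Z - j%:Z); have uik := U_neq0 l (i%:Z - k%:Z).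
have ujk := U_neq0 l (j%:Z - k%:Z).
move: (t i j) (t i k) (t j k) (J l_gt0) (U l (i%:Z - j%:Z)) (U l (i%:Z - k%:Z))
  (U l (j%:Z - k%:Z)) tij tik tjk Jn uij uik ujk.
move=> xij xik xjk jj yij yik yjk h1 h2 h3 h4 h5 h6 h7.
by field; rewrite ?oppr_eq0 h1 h2 h3 h4 h5 h6 h7.
Qed.

Let JJ_neq0 : J l_gt0 * J l_gt0 * t i j * t i k * t j k != 0.
Proof.
have tij : t i j != 0 by apply: t_neq0; lia.
have tik : t i k != 0 by apply: t_neq0; lia.
have tjk : t j k != 0 by apply: t_neq0; lia.
have := J_neq0 l_gt0; move: (t i j) (t i k) (t j k) (J l_gt0) tij tik tjk.
by move=> x y z w *; rewrite !mulf_neq0.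
Qed.

Lemma theta_triple : triple (theta_sum b) = 0.
Proof.
have hs c : hassum (weight l al d c) (U l (- d * al c) * theta_sum b (al c)).
  have := limM (lim_cst (U l (- d * al c))) (theta_sumP b (al c)).
  apply: lim_ext; exists 0%N => M _; rewrite mulr_sumr; apply: eq_bigr => m _.
  by rewrite !weightE mulrDr.
have := theta_relation l_gt0 al_ndvd hs; rewrite regular_sum => /eqP.
by rewrite mulf_eq0 invr_eq0 (negPf JJ_neq0) orbF => /eqP.
Qed.

Let lambert_hassum c :
  hassum (pole_weight l al d c) (U l (- d * al c) * lambert_sum b (al c)).
Proof.
have := limM (lim_cst (U l (- d * al c))) (lambert_sumP b (al c)).
apply: lim_ext; exists 0%N => M _; rewrite mulr_sumr; apply: eq_bigr => m _.
by rewrite /pole_weight !weightE mulrDr /tau_pole !mulrA.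
Qed.

Lemma lambert_triple : (0 < i)%N -> triple (lambert_sum b)
  = J l_gt0 * J l_gt0 * t i j * t i k * t j k
    / (Th l_gt0 i%:Z * Th l_gt0 j%:Z * Th l_gt0 k%:Z).
Proof.
move=> i0; have al_nd c : ndvd l (al c).
  by apply: ndvd_small; case: c => -[|[|[|]]] //=; rewrite /al /=; lia.
have := lambert_relation l_gt0 al_ndvd al_nd lambert_hassum; rewrite regular_sum.
move=> /(canRL (divfK JJ_neq0)) ->.
by rewrite !big_ord_recl big_ord0 /al /= mulr1 -!invfM mulrC mulrA.
Qed.

Lemma degenerate_triple : i = 0%N -> triple (lambert_sum b)
  = - t j k * (d%:~R + L l_gt0 j%:Z + L l_gt0 k%:Z).
Proof.
move=> i0; have al0 : al ord0 = 0 by rewrite /al /= i0.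
have := degenerate_relation l_gt0 al_ndvd al0 lambert_hassum; rewrite regular_sum.
move=> /(canRL (divfK JJ_neq0)) ->.
rewrite /regular_lim !(big_mkcond (fun c' => c' != _)) !big_ord_recl !big_ord0 /= /al /=.
rewrite -/(t i j) -/(t i k) mul1r mulr1 add0r addr0.
have := J_neq0 l_gt0; have /t_neq0 : (i < j < l)%N by lia.
have /t_neq0 : (i < k < l)%N by lia.
move: (t i j) (t i k) (J l_gt0) => x y z x0 y0 z0.
by field; rewrite x0 y0 z0.
Qed.
End Explicit.
End Grading.

(** * From absent exponents to linear relations between counts *)

Section ClassExtract.
Variable l : nat.
Hypothesis l_gt0 : (0 < l)%N.
Variable h : int.
Hypothesis hE : 2 * h = 3 * l%:Z - 1.

Lemma U1E z : U l z = U l 1 ^ z.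
Proof. by rewrite /U exprz_exp mulr1. Qed.

Lemma sgn_nat (a : nat) : sgn a%:Z = (-1) ^+ odd a.
Proof. by rewrite signr_odd. Qed.

Lemma class_factorE b (a r E : nat) : pent a%:Z + b * a%:Z = r%:Z + l%:Z * E%:Z ->
  class_factor b a%:Z = (-1) ^+ odd a * U l 1 ^+ E * q ^+ r.
Proof.
move=> e; rewrite /class_factor sgn_nat e -mulrA; congr (_ * _).
by rewrite qD mulrC; congr (_ * _); rewrite -[LHS]/(U l E%:Z) U1E.
Qed.

Lemma tripleE d (i j k : nat) X (ti tj tk : nat) (pi pj pk : int) : (i < j < k)%N ->
    ti = (k - j)%N -> tj = (k - i)%N -> tk = (j - i)%N ->
    pi = - d * i%:Z -> pj = j%:Z - i%:Z - d * j%:Z ->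
    pk = 2 * k%:Z - i%:Z - j%:Z - d * k%:Z ->
  triple l_gt0 d i j k X = Th l_gt0 ti%:Z * (U l 1 ^ pi * X i%:Z)
    - Th l_gt0 tj%:Z * (U l 1 ^ pj * X j%:Z)
    + Th l_gt0 tk%:Z * (U l 1 ^ pk * X k%:Z).
Proof.
move=> /andP[ij jk] -> -> -> -> -> ->; have ik := ltn_trans ij jk.
by rewrite /triple -!U1E -!subzn ?(ltnW ij) ?(ltnW jk) ?(ltnW ik) // !mulrA.
Qed.

Definition lambert_total (b : nat) : K :=
  \sum_(a < l) class_factor b%:Z a%:Z * lambert_sum l_gt0 hE b%:Z a%:Z.

Lemma extract_class b c (beta n m : nat) : (b < l)%N -> n = (l * m + beta)%N ->
    graded l (fun k => ~ res l beta%:Z k) (P * (l%:R * lambert_total b + c%:R)) ->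
  l%:Z * ((tail_class l (l - b) n)%:Z - (tail_class l b.+1 n)%:Z) + (c * npart n)%N%:Z = 0.
Proof.
move=> lt_bl nE.
have -> : P * (l%:R * lambert_total b + c%:R)
    = l%:R * (gf (tail_class l (l - b)) - gf (tail_class l b.+1)) + c%:R * P.
  by rewrite -(lambert_classes l_gt0 hE lt_bl) -/(lambert_total b); ring.
rewrite /P /gf -rmorphB -!(rmorph_nat emb) -!rmorphM -rmorphD => /graded_emb sp.
have {sp} := sp l_gt0 (res_compl_periodic l_gt0 (r := _)) n.
set s := coefs _ n; case: (eqVneq s 0) => [s0 _|_ /(_ isT)[]]; last first.
  by exists m%:Z; lia.
have natM k f : coefs (k%:R * f) n = k%:R * coefs f n.
  elim: k => [|k IH]; first by rewrite !mul0r.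
  by rewrite -!natr1 !mulrDl coefsD IH !mul1r.
apply/eqP; rewrite -(intr_eq0 rat); apply/eqP; rewrite -[RHS]s0 /s coefsD !natM coefsB /=.
by rewrite rmorphD rmorphM rmorphB -[X in _ + X = _]/((c * npart n)%N%:R) natrM.
Qed.
End ClassExtract.

Lemma graded_res l (l_gt0 : (0 < l)%N) (r s : int) x : ~ res l s r -> cls l r x ->
  graded l (fun k => ~ res l s k) x.
Proof.
move=> nrs [f [g [nzg g0 fR ->]]]; exists f, g; split=> // n /fR [k kE] [m mE].
by apply: nrs; exists (m - k); lia.
Qed.

Lemma graded_monomial l (l_gt0 : (0 < l)%N) (s : int) (r : nat) a : ~ res l s r%:Z ->
  cls l 0 a -> graded l (fun k => ~ res l s k) (a * q ^+ r).
Proof.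
move=> nrs ca; apply: (graded_res l_gt0 nrs).
by rewrite -[r%:Z]add0r; apply: clsM => //; apply: cls_qn.
Qed.

Ltac prove_cls0 := by repeat first [eassumption | exact: cls_nat | exact: cls1
  | apply: clsM0 | apply: clsB0 | apply: clsD0 | apply: clsN | apply: clsV0 | apply: clsX0].

Ltac prove_monomial :=
  apply: graded_monomial => //; first [by case=> k; lia | prove_cls0].

(** * Modulus 5 *)

Section Mod5.
Let l5 : (0 < 5)%N := isT.
Let h5 : 2 * 7 = 3 * 5%:Z - 1 :> int := erefl.

Let x := Th l5 1.
Let y := Th l5 2.
Let u := U 5 1.
Let j := J l5 * J l5.
Let L1 := L l5 1.
Let L2 := L l5 2.
Let F (a : int) := theta_sum l5 h5 0 a.
Let T (b a : int) := lambert_sum l5 h5 b a.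

Let x0 : x != 0. Proof. by apply/Th_neq0/ndvd_small. Qed.
Let y0 : y != 0. Proof. by apply/Th_neq0/ndvd_small. Qed.
Let u0 : u != 0. Proof. exact: U_neq0. Qed.
Let q5 : q ^+ 5 = u. Proof. by rewrite /u /U mulr1. Qed.
Let Th3 : Th l5 3 = y. Proof. exact: (Th_refl l5 2). Qed.
Let Th4 : Th l5 4 = x. Proof. exact: (Th_refl l5 1). Qed.
Let Th6 : Th l5 6 = - u^-1 * x.
Proof. rewrite (Th_refl l5 (- 1)) ThN; [by rewrite UN | exact: ndvd_small]. Qed.
Let L3 : L l5 3 = - L2. Proof. exact: (L_refl l5 2). Qed.
Let L4 : L l5 4 = - L1. Proof. exact: (L_refl l5 1). Qed.
Let L6 : L l5 6 = L1 + 1. Proof. by apply: (@L_shift 5 l5 1); apply: ndvd_small. Qed.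

Let W1 : 1 + 3 * L1 + L2 = j * y ^+ 2 / x ^+ 3.
Proof.
have nd1 := @ndvd_small 5 isT 1 isT; have nd2 := @ndvd_small 5 isT 2 isT.
have nd3 := @ndvd_small 5 isT 3 isT.
have := @L_relation 5 l5 1 1 1 nd1 nd1 nd1 nd2 nd2 nd2 nd3.
rewrite -[1 + 1 + 1 : int]/(3 : int) L3 Th3 -[1 + 1 : int]/(2 : int).
rewrite -/x -/y -/L1 -/j => e.
transitivity (1 + L1 + L1 + L1 - - L2); first by ring.
by rewrite e; field; rewrite x0 y0.
Qed.

Let W2 : 3 * L2 - L1 = - (j * u * x ^+ 2 / y ^+ 3).
Proof.
have nd2 := @ndvd_small 5 isT 2 isT; have nd4 := @ndvd_small 5 isT 4 isT.
have nd6 : ndvd 5 6 by move=> k; apply/eqP; lia.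
have := @L_relation 5 l5 2 2 2 nd2 nd2 nd2 nd4 nd4 nd4 nd6.
rewrite -[2 + 2 + 2 : int]/(6 : int) L6 Th6 -[2 + 2 : int]/(4 : int) Th4.
rewrite -/y -/L2 -/j => e.
transitivity (1 + L2 + L2 + L2 - (L1 + 1)); first by ring.
by rewrite e; field; rewrite x0 y0 u0 oppr_eq0 oner_eq0.
Qed.

Let A := y / x.
(** Ramanujan's 5-dissection of Euler's product, up to a factor in q^5; [q / A] is the
    Rogers-Ramanujan continued fraction at q^5. *)
Let g := A - q - q ^+ 2 / A.

Let pentagonal5 : P * (- (u ^+ 5 * F 4) * g) = 1.
Proof.
have R1 : x * F 0 - x * (u ^+ 3 * F 3) + y * (u ^+ 5 * F 4) = 0.
  have := @theta_triple 5 l5 7 h5 0 0 0 3 4 isT erefl.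
  by rewrite (@tripleE 5 l5 0 0 3 4 _ 1 4 3 0 3 5) // Th3 Th4 expr0z mul1r.
have R2 : y * F 1 - y * (u * F 2) + x * (u ^+ 5 * F 4) = 0.
  have := @theta_triple 5 l5 7 h5 0 0 1 2 4 isT erefl.
  by rewrite (@tripleE 5 l5 0 1 2 4 _ 2 3 1 0 1 5) // Th3 expr0z mul1r.
have := pentagonal_classes l5 h5; rewrite !big_ord_recl big_ord0 /=.
rewrite (@class_factorE 5 0 0 0 0) // (@class_factorE 5 0 1 2 0) //.
rewrite (@class_factorE 5 0 2 2 1) // (@class_factorE 5 0 3 0 3) //.
rewrite (@class_factorE 5 0 4 1 5) //= => <-; congr (_ * _).
rewrite -/u -[theta_sum l5 h5 0 _]/(F 0) -[theta_sum l5 h5 0 1]/(F 1).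
rewrite -[theta_sum l5 h5 0 2]/(F 2) -[theta_sum l5 h5 0 3]/(F 3).
rewrite -[theta_sum l5 h5 0 4]/(F 4).
move: (F 0) (F 1) (F 2) (F 3) (F 4) R1 R2 => f0 f1 f2 f3 f4 R1 R2.
have -> : f0 = u ^+ 3 * f3 - A * (u ^+ 5 * f4).
  apply: (mulfI x0); apply/eqP; rewrite -subr_eq0 -R1; apply/eqP; rewrite /A.
  by field.
have -> : f1 = u * f2 - (u ^+ 5 * f4) / A.
  apply: (mulfI y0); apply/eqP; rewrite -subr_eq0 -R2; apply/eqP; rewrite /A.
  by field; rewrite x0 y0.
by rewrite /g /A; field; rewrite x0 y0.
Qed.

Let cls_x : cls 5 0 x. Proof. exact: cls_Th. Qed.
Let cls_y : cls 5 0 y. Proof. exact: cls_Th. Qed.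
Let cls_u : cls 5 0 u. Proof. exact: cls_U. Qed.
Let cls_j : cls 5 0 j. Proof. exact: (clsM0 l5 (cls_Qinf l5 5) (cls_Qinf l5 5)). Qed.
Let cls_F a : cls 5 0 (F a). Proof. exact: cls_theta_sum. Qed.
Let cls_T b a : cls 5 0 (T b a). Proof. exact: cls_lambert_sum. Qed.

Let divide_pentagonal5 z : P * (g * z) = - (u ^+ 5 * F 4)^-1 * z.
Proof.
have nz : u ^+ 5 * F 4 != 0.
  apply: contra_eq_neq pentagonal5 => ->.
  by rewrite oppr0 mul0r mulr0 eq_sym oner_eq0.
transitivity (P * (- (u ^+ 5 * F 4) * g) * (- (u ^+ 5 * F 4)^-1 * z)).
  by move: (u ^+ 5 * F 4) nz => w nz; field.
by rewrite pentagonal5 mul1r.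
Qed.

(** The triples are those of [pentagonal5], so the remaining unknown [T 0 4] is again multiplied by
    [g]. The bracket behind [j] is the quotient of the inhomogeneous terms by [g]. Modulo 5, where
    the Lambert total disappears, its coefficients 2, 2, -1, 1 are twice the 1, 1, 2, -2 of the next
    lemma, as the constants 2 and 1 require. *)
Lemma lambert5_0 : 5%:R * lambert_total l5 h5 0 + 2%:R
  = g * (- 5%:R * (u ^+ 5 * T 0 4)
         + j * ((2%:R * A + 2%:R * q - q ^+ 2 / A + q ^+ 3 / A ^+ 2) / x)).
Proof.
have R1 : x * T 0 0 - x * (u ^+ 3 * T 0 3) + y * (u ^+ 5 * T 0 4) = x * (L2 + L1).
  have := @degenerate_triple 5 l5 7 h5 0 0 0 3 4 isT erefl erefl.
  rewrite (@tripleE 5 l5 0 0 3 4 _ 1 4 3 0 3 5) // Th3 Th4 expr0z mul1r => ->.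
  by rewrite L3 L4 -/x; ring.
have R2 : y * T 0 1 - y * (u * T 0 2) + x * (u ^+ 5 * T 0 4) = j * y / x.
  have := @lambert_triple 5 l5 7 h5 0 0 1 2 4 isT erefl isT.
  rewrite (@tripleE 5 l5 0 1 2 4 _ 2 3 1 0 1 5) // Th3 Th4 expr0z mul1r => ->.
  by rewrite -/x -/y -/j; field; rewrite x0 y0.
rewrite /lambert_total !big_ord_recl big_ord0 /=.
rewrite (@class_factorE 5 0 0 0 0) // (@class_factorE 5 0 1 2 0) //.
rewrite (@class_factorE 5 0 2 2 1) // (@class_factorE 5 0 3 0 3) //.
rewrite (@class_factorE 5 0 4 1 5) //=.
rewrite -/u -[lambert_sum _ _ _ _]/(T 0 0) -[lambert_sum _ _ _ 1]/(T 0 1).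
rewrite -[lambert_sum _ _ _ 2]/(T 0 2) -[lambert_sum _ _ _ 3]/(T 0 3).
rewrite -[lambert_sum _ _ _ 4]/(T 0 4).
move: (T 0 0) (T 0 1) (T 0 2) (T 0 3) (T 0 4) R1 R2 => f0 f1 f2 f3 f4 R1 R2.
have -> : f0 = u ^+ 3 * f3 - A * (u ^+ 5 * f4) + (L2 + L1).
  apply: (mulfI x0); apply/eqP; rewrite mulrDr -R1 -subr_eq0 /A; apply/eqP.
  by field.
have -> : f1 = u * f2 - (u ^+ 5 * f4) / A + j / x.
  apply: (mulfI y0); apply/eqP; rewrite mulrDr; have -> : y * (j / x) = j * y / x by ring.
  by rewrite -R2 -subr_eq0 /A; apply/eqP; field; rewrite x0 y0.
(* The constant 2 is exactly what turns the degenerate term into a combination of [W1] and [W2],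
   hence into theta quotients. *)
have key : 5%:R * (L2 + L1) + 2%:R = j * (2%:R * y ^+ 2 / x ^+ 3 - q ^+ 5 * x ^+ 2 / y ^+ 3).
  transitivity (2%:R * (1 + 3 * L1 + L2) + (3 * L2 - L1)); first by ring.
  by rewrite W1 W2 q5; ring.
transitivity (- 5%:R * (u ^+ 5 * f4) * g + (5%:R * (L2 + L1) + 2%:R)
   - 5%:R * q ^+ 2 * j / x).
  by rewrite /g /A; field; rewrite x0 y0.
by rewrite key /g /A; field; rewrite x0 y0.
Qed.

Lemma lambert5_1 : 5%:R * lambert_total l5 h5 1 + 1%:R
  = g * (- 5%:R * (q ^+ 3 * (u * T 1 2))
         + j * ((A + q + 2%:R * q ^+ 2 / A - 2%:R * q ^+ 3 / A ^+ 2) / x)).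
Proof.
have R1 : y * T 1 0 - x * (u ^+ 2 * T 1 2) + y * (u ^+ 6 * T 1 4) = y * (L1 - L2).
  have := @degenerate_triple 5 l5 7 h5 1 0 0 2 4 isT erefl erefl.
  rewrite (@tripleE 5 l5 0 0 2 4 _ 2 4 2 0 2 6) // Th4 expr0z mul1r => ->.
  by rewrite L4 -/y -/L2; ring.
have R2 : x * T 1 1 - y * (u * T 1 2) + x * (u ^+ 3 * T 1 3) = j * x / y.
  have := @lambert_triple 5 l5 7 h5 1 0 1 2 3 isT erefl isT.
  rewrite (@tripleE 5 l5 0 1 2 3 _ 1 2 1 0 1 3) // Th3 expr0z mul1r => ->.
  by rewrite -/x -/y -/j; field; rewrite x0 y0.
rewrite /lambert_total !big_ord_recl big_ord0 /=.
rewrite (@class_factorE 5 1 0 0 0) // (@class_factorE 5 1 1 3 0) //.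
rewrite (@class_factorE 5 1 2 4 1) // (@class_factorE 5 1 3 3 3) //.
rewrite (@class_factorE 5 1 4 0 6) //=.
rewrite -/u -[lambert_sum _ _ _ _]/(T 1 0) -[lambert_sum _ _ _ 1]/(T 1 1).
rewrite -[lambert_sum _ _ _ 2]/(T 1 2) -[lambert_sum _ _ _ 3]/(T 1 3).
rewrite -[lambert_sum _ _ _ 4]/(T 1 4).
move: (T 1 0) (T 1 1) (T 1 2) (T 1 3) (T 1 4) R1 R2 => f0 f1 f2 f3 f4 R1 R2.
have -> : f0 = u ^+ 2 * f2 / A - u ^+ 6 * f4 + (L1 - L2).
  apply: (mulfI y0); apply/eqP; rewrite mulrDr -R1 -subr_eq0 /A; apply/eqP.
  by field; rewrite x0 y0.
have -> : f1 = A * (u * f2) - u ^+ 3 * f3 + j / y.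
  apply: (mulfI x0); apply/eqP; rewrite mulrDr; have -> : x * (j / y) = j * x / y by ring.
  by rewrite -R2 -subr_eq0 /A; apply/eqP; field.
have key : 5%:R * (L1 - L2) + 1%:R
    = j * (y ^+ 2 / x ^+ 3 + 2%:R * q ^+ 5 * x ^+ 2 / y ^+ 3).
  transitivity (1 + 3 * L1 + L2 - 2%:R * (3 * L2 - L1)); first by ring.
  by rewrite W1 W2 q5; ring.
transitivity (- 5%:R * (q ^+ 3 * (u * f2)) * (A - q) + 5%:R * u ^+ 2 * f2 / A
   + (5%:R * (L1 - L2) + 1%:R) - 5%:R * q ^+ 3 * j / y).
  by rewrite /g /A; field; rewrite x0 y0.
by rewrite key -q5 /g /A; field; rewrite x0 y0.
Qed.

Lemma class5_0 n m : n = (5 * m + 4)%N ->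
  5 * ((tail_class 5 5 n)%:Z - (tail_class 5 1 n)%:Z) + (2 * npart n)%N%:Z = 0.
Proof.
move=> nE; have := @extract_class 5 l5 7 h5 0 2 4 n m isT nE; apply.
rewrite lambert5_0 divide_pentagonal5.
set c := - (u ^+ 5 * F 4)^-1.
(* Sorted by powers of q with coefficients of degree 0 modulo 5: the exponents are 0 to 3, never
   4. *)
have -> : c * (- 5%:R * (u ^+ 5 * T 0 4)
         + j * ((2%:R * A + 2%:R * q - q ^+ 2 / A + q ^+ 3 / A ^+ 2) / x))
  = c * (- 5%:R * (u ^+ 5 * T 0 4) + j * (2%:R * A / x)) * q ^+ 0
    + c * (j * (2%:R / x)) * q ^+ 1 + c * - (j / A / x) * q ^+ 2
    + c * (j / A ^+ 2 / x) * q ^+ 3.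
  by rewrite expr0 expr1; ring.
have cc : cls 5 0 c by prove_cls0.
have cA : cls 5 0 A by prove_cls0.
have cT := cls_T 0 4.
have pR := res_compl_periodic l5 (r := 4).
repeat (apply: (gradedD l5 pR); last by prove_monomial).
by prove_monomial.
Qed.

Lemma class5_1 n m : n = (5 * m + 4)%N ->
  5 * ((tail_class 5 4 n)%:Z - (tail_class 5 2 n)%:Z) + (1 * npart n)%N%:Z = 0.
Proof.
move=> nE; have := @extract_class 5 l5 7 h5 1 1 4 n m isT nE; apply.
rewrite lambert5_1 divide_pentagonal5.
set c := - (u ^+ 5 * F 4)^-1.
have -> : c * (- 5%:R * (q ^+ 3 * (u * T 1 2))
         + j * ((A + q + 2%:R * q ^+ 2 / A - 2%:R * q ^+ 3 / A ^+ 2) / x))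
  = c * (j * (A / x)) * q ^+ 0 + c * (j / x) * q ^+ 1
    + c * (j * (2%:R / A / x)) * q ^+ 2
    + c * (- 5%:R * (u * T 1 2) - j * (2%:R / A ^+ 2 / x)) * q ^+ 3.
  by rewrite expr0 expr1; ring.
have cc : cls 5 0 c by prove_cls0.
have cA : cls 5 0 A by prove_cls0.
have cT := cls_T 1 2.
have pR := res_compl_periodic l5 (r := 4).
repeat (apply: (gradedD l5 pR); last by prove_monomial).
by prove_monomial.
Qed.
End Mod5.

(** * Modulus 7 *)

Section Mod7.
Let l7 : (0 < 7)%N := isT.
Let h7 : 2 * 10 = 3 * 7%:Z - 1 :> int := erefl.

Let x := Th l7 1.
Let y := Th l7 2.
Let z := Th l7 3.
Let u := U 7 1.
Let j := J l7 * J l7.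
Let L1 := L l7 1.
Let L2 := L l7 2.
Let L3 := L l7 3.
Let F (a : int) := theta_sum l7 h7 0 a.
Let T (b a : int) := lambert_sum l7 h7 b a.

Let x0 : x != 0. Proof. by apply/Th_neq0/ndvd_small. Qed.
Let y0 : y != 0. Proof. by apply/Th_neq0/ndvd_small. Qed.
Let z0 : z != 0. Proof. by apply/Th_neq0/ndvd_small. Qed.
Let u0 : u != 0. Proof. exact: U_neq0. Qed.
Let j0 : j != 0. Proof. by rewrite mulf_neq0 ?J_neq0. Qed.
Let q7 : q ^+ 7 = u. Proof. by rewrite /u /U mulr1. Qed.
Let Th4 : Th l7 4 = z. Proof. exact: (Th_refl l7 3). Qed.
Let Th5 : Th l7 5 = y. Proof. exact: (Th_refl l7 2). Qed.
Let Th6 : Th l7 6 = x. Proof. exact: (Th_refl l7 1). Qed.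
Let Th_1 : Th l7 (- 1) = - u^-1 * x.
Proof. rewrite ThN; [by rewrite UN | exact: ndvd_small]. Qed.
Let Th8 : Th l7 8 = - u^-1 * x.
Proof. by rewrite (Th_refl l7 (- 1)) Th_1. Qed.
Let L4 : L l7 4 = - L3. Proof. exact: (L_refl l7 3). Qed.
Let L5 : L l7 5 = - L2. Proof. exact: (L_refl l7 2). Qed.
Let L6 : L l7 6 = - L1. Proof. exact: (L_refl l7 1). Qed.
Let L_1 : L l7 (- 1) = - 1 - L1. Proof. by apply: (@L_opp 7 l7 1); apply: ndvd_small. Qed.
Let L8 : L l7 8 = L1 + 1. Proof. by apply: (@L_shift 7 l7 1); apply: ndvd_small. Qed.

Let W1 : 1 + 2%:R * L1 + L2 + L3 = j * z / x ^+ 2.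
Proof.
have := @L_relation 7 l7 1 1 2
    ltac:(exact: ndvd_small) ltac:(exact: ndvd_small) ltac:(exact: ndvd_small)
    ltac:(exact: ndvd_small) ltac:(exact: ndvd_small) ltac:(exact: ndvd_small)
    ltac:(exact: ndvd_small).
rewrite -[1 + 1 + 2 : int]/(4 : int) L4 Th4 -[1 + 2 : int]/(3 : int).
rewrite -[1 + 1 : int]/(2 : int) -/x -/y -/z -/L1 -/L2 -/j => e.
transitivity (1 + L1 + L1 + L2 - - L3); first by ring.
by rewrite e; field; rewrite x0 y0 z0.
Qed.

Let W2 : 2%:R * L2 - L1 - L3 = - (j * u * x / y ^+ 2).
Proof.
have nd1 : ndvd 7 (- 1) by apply: ndvd_opp_small.
have := @L_relation 7 l7 2 2 (- 1)
    ltac:(exact: ndvd_small) ltac:(exact: ndvd_small) nd1 ltac:(exact: ndvd_small)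
    ltac:(exact: ndvd_small) ltac:(exact: ndvd_small) ltac:(exact: ndvd_small).
rewrite -[2 + 2 - 1 : int]/(3 : int) L_1 Th_1 -[2 - 1 : int]/(1 : int).
rewrite -[2 + 2 : int]/(4 : int) Th4 -/x -/y -/z -/L1 -/L2 -/L3 -/j => e.
transitivity (1 + L2 + L2 + (- 1 - L1) - L3); first by ring.
by rewrite e; field; rewrite ?oppr_eq0 ?oner_eq0 x0 y0 z0 u0.
Qed.

Let W3 : L2 + 2%:R * L3 - L1 = - (j * u * y / z ^+ 2).
Proof.
have nd8 : ndvd 7 8 by move=> k; apply/eqP; lia.
have := @L_relation 7 l7 2 3 3
    ltac:(exact: ndvd_small) ltac:(exact: ndvd_small) ltac:(exact: ndvd_small)
    ltac:(exact: ndvd_small) ltac:(exact: ndvd_small) ltac:(exact: ndvd_small) nd8.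
rewrite -[2 + 3 + 3 : int]/(8 : int) L8 Th8 -[2 + 3 : int]/(5 : int) Th5.
rewrite -[3 + 3 : int]/(6 : int) Th6 -/x -/y -/z -/L1 -/L2 -/L3 -/j => e.
transitivity (1 + L2 + L3 + L3 - (L1 + 1)); first by ring.
by rewrite e; field; rewrite ?oppr_eq0 ?oner_eq0 x0 y0 z0 u0.
Qed.

(* Klein's quartic. *)
Let klein : u = (y ^+ 3 * z - x * z ^+ 3) / (x ^+ 3 * y).
Proof.
have := @L_relation 7 l7 1 1 1
    ltac:(exact: ndvd_small) ltac:(exact: ndvd_small) ltac:(exact: ndvd_small)
    ltac:(exact: ndvd_small) ltac:(exact: ndvd_small) ltac:(exact: ndvd_small)
    ltac:(exact: ndvd_small).
rewrite -[1 + 1 + 1 : int]/(3 : int) -[1 + 1 : int]/(2 : int).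
rewrite -/x -/y -/z -/L1 -/L3 -/j => e.
have : j * (y ^+ 3 / (x ^+ 3 * z)) = j * (z / x ^+ 2 + u * y / z ^+ 2).
  transitivity (1 + L1 + L1 + L1 - L3).
    by rewrite e; field; rewrite x0 z0.
  transitivity (1 + 2%:R * L1 + L2 + L3 - (L2 + 2%:R * L3 - L1)); first by ring.
  by rewrite W1 W3; ring.
move/(mulfI j0) => {}e.
have -> : u = (z / x ^+ 2 + u * y / z ^+ 2 - z / x ^+ 2) * z ^+ 2 / y.
  by field; rewrite x0 y0 z0.
by rewrite -e; field; rewrite x0 y0 z0.
Qed.

Let A := y / x.
Let B := z / y.
Let C := x / z.
(** The 7-dissection of Euler's product, up to a factor in q^7; 0, 1, 2, 5 are the residues of the
    pentagonal numbers. Note A B C = 1. *)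
Let g := A - q * B - q ^+ 2 + q ^+ 5 * C.

Let pentagonal7 : P * (F 1 * g) = 1.
Proof.
have R1 : x * F 0 - y * F 1 + x * (u * F 2) = 0.
  have := @theta_triple 7 l7 10 h7 0 1 0 1 2 isT erefl.
  by rewrite (@tripleE 7 l7 1 0 1 2 _ 1 2 1 0 0 1) // !expr0z !mul1r.
have R2 : z * F 1 - y * (u ^+ 2 * F 3) + y * (u ^+ 8 * F 6) = 0.
  have := @theta_triple 7 l7 10 h7 0 0 1 3 6 isT erefl.
  by rewrite (@tripleE 7 l7 0 1 3 6 _ 3 5 2 0 2 8) // Th5 !expr0z !mul1r.
have R3 : x * F 1 - z * (u ^+ 3 * F 4) + z * (u ^+ 5 * F 5) = 0.
  have := @theta_triple 7 l7 10 h7 0 0 1 4 5 isT erefl.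
  by rewrite (@tripleE 7 l7 0 1 4 5 _ 1 4 3 0 3 5) // Th4 !expr0z !mul1r.
have := pentagonal_classes l7 h7; rewrite !big_ord_recl big_ord0 /=.
rewrite (@class_factorE 7 0 0 0 0) // (@class_factorE 7 0 1 2 0) //.
rewrite (@class_factorE 7 0 2 0 1) // (@class_factorE 7 0 3 1 2) //.
rewrite (@class_factorE 7 0 4 5 3) // (@class_factorE 7 0 5 5 5) //.
rewrite (@class_factorE 7 0 6 1 8) //= => <-; congr (_ * _).
rewrite -/u -[theta_sum _ _ 0 _]/(F 0) -[theta_sum _ _ 0 1]/(F 1).
rewrite -[theta_sum _ _ 0 2]/(F 2) -[theta_sum _ _ 0 3]/(F 3).
rewrite -[theta_sum _ _ 0 4]/(F 4) -[theta_sum _ _ 0 5]/(F 5) -[theta_sum _ _ 0 6]/(F 6).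
move: (F 0) (F 1) (F 2) (F 3) (F 4) (F 5) (F 6) R1 R2 R3 => f0 f1 f2 f3 f4 f5 f6 R1 R2 R3.
have -> : f0 = A * f1 - u * f2.
  apply: (mulfI x0); apply/eqP; rewrite -subr_eq0 -R1; apply/eqP; rewrite /A.
  by field.
transitivity (A * f1 - q * B * f1 - q ^+ 2 * f1 + q ^+ 5 * C * f1
    + q / y * (z * f1 - y * (u ^+ 2 * f3) + y * (u ^+ 8 * f6))
    - q ^+ 5 / z * (x * f1 - z * (u ^+ 3 * f4) + z * (u ^+ 5 * f5))).
  by rewrite R2 R3 /g; ring.
by rewrite /B /C; field; rewrite y0 z0.
Qed.

Let cls_x : cls 7 0 x. Proof. exact: cls_Th. Qed.
Let cls_y : cls 7 0 y. Proof. exact: cls_Th. Qed.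
Let cls_z : cls 7 0 z. Proof. exact: cls_Th. Qed.
Let cls_u : cls 7 0 u. Proof. exact: cls_U. Qed.
Let cls_j : cls 7 0 j.
Proof. exact: (clsM0 l7 (cls_Qinf l7 7) (cls_Qinf l7 7)). Qed.
Let cls_F a : cls 7 0 (F a). Proof. exact: cls_theta_sum. Qed.
Let cls_T b a : cls 7 0 (T b a). Proof. exact: cls_lambert_sum. Qed.

Let divide_pentagonal7 t : P * (g * t) = (F 1)^-1 * t.
Proof.
have nz : F 1 != 0.
  apply: contra_eq_neq pentagonal7 => ->.
  by rewrite mul0r mulr0 eq_sym oner_eq0.
transitivity (P * (F 1 * g) * ((F 1)^-1 * t)).
  by move: (F 1) nz => w nz; field.
by rewrite pentagonal7 mul1r.
Qed.

(** The exponent 5 is left out. Modulo 7 the Lambert totals disappear, so the weights used below are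
    3, 2 and 1 times (1, 1, 2, 3, 5, 4) there, in accordance with the added constants. *)
Let wseries (w0 w1 w2 w3 w4 w6 : K) : K :=
  w0 * (z / (x * y)) + w1 * (q / x) + w2 * (q ^+ 2 * y / (x * z))
  + w3 * (q ^+ 3 / y) + w4 * (q ^+ 4 / z) + w6 * (q ^+ 6 * x / (y * z)).

Lemma lambert7_0 : 7%:R * lambert_total l7 h7 0 + 3%:R
  = g * (7%:R * T 0 1 + j * wseries (- 4%:R) 3%:R (- 1) 2%:R 1 (- 2%:R)).
Proof.
have R1 : x * T 0 0 - y * T 0 1 + x * (u * T 0 2) = - x * (1 + L1 + L2).
  have := @degenerate_triple 7 l7 10 h7 0 1 0 1 2 isT erefl erefl.
  by rewrite (@tripleE 7 l7 1 0 1 2 _ 1 2 1 0 0 1) // !expr0z !mul1r.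
have R2 : z * T 0 1 - y * (u ^+ 2 * T 0 3) + y * (u ^+ 8 * T 0 6) = j * y ^+ 2 / x ^+ 2.
  have := @lambert_triple 7 l7 10 h7 0 0 1 3 6 isT erefl isT.
  rewrite (@tripleE 7 l7 0 1 3 6 _ 3 5 2 0 2 8) // Th5 Th6 !expr0z !mul1r => ->.
  by rewrite -/x -/y -/z -/j; field; rewrite x0 z0.
have R3 : x * T 0 1 - z * (u ^+ 3 * T 0 4) + z * (u ^+ 5 * T 0 5) = j * z / y.
  have := @lambert_triple 7 l7 10 h7 0 0 1 4 5 isT erefl isT.
  rewrite (@tripleE 7 l7 0 1 4 5 _ 1 4 3 0 3 5) // Th4 Th5 !expr0z !mul1r => ->.
  by rewrite -/x -/y -/z -/j; field; rewrite x0 y0 z0.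
rewrite /lambert_total !big_ord_recl big_ord0 /=.
rewrite (@class_factorE 7 0 0 0 0) //=.
rewrite (@class_factorE 7 0 1 2 0) //=.
rewrite (@class_factorE 7 0 2 0 1) //=.
rewrite (@class_factorE 7 0 3 1 2) //=.
rewrite (@class_factorE 7 0 4 5 3) //=.
rewrite (@class_factorE 7 0 5 5 5) //=.
rewrite (@class_factorE 7 0 6 1 8) //=.
rewrite -/u -[lambert_sum _ _ _ _]/(T 0 0) -[lambert_sum _ _ _ 1]/(T 0 1)
  -[lambert_sum _ _ _ 2]/(T 0 2) -[lambert_sum _ _ _ 3]/(T 0 3)
  -[lambert_sum _ _ _ 4]/(T 0 4) -[lambert_sum _ _ _ 5]/(T 0 5)
  -[lambert_sum _ _ _ 6]/(T 0 6).
move: (T 0 0) (T 0 1) (T 0 2) (T 0 3) (T 0 4) (T 0 5) (T 0 6) R1 R2 R3.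
move=> f0 f1 f2 f3 f4 f5 f6 R1 R2 R3.
have key : - 7%:R * (1 + L1 + L2) + 3%:R
    = j * (- 4%:R * z / x ^+ 2 + 2%:R * u * x / y ^+ 2 - u * y / z ^+ 2).
  transitivity (- 4%:R * (1 + 2%:R * L1 + L2 + L3) - 2%:R * (2%:R * L2 - L1 - L3)
    + (L2 + 2%:R * L3 - L1)); first by ring.
  by rewrite W1 W2 W3; ring.
transitivity (7%:R * (f1 * (A - q * B - q ^+ 2 + q ^+ 5 * C)) + (- 7%:R * (1 + L1
  + L2) + 3%:R) + 7%:R * (j * (q * y / x ^+ 2 - q ^+ 5 / y))).
  (* Each relation enters as a zero, scaled to eliminate the two unknowns other than [f1]. *)
  transitivity (7%:R * (f1 * (A - q * B - q ^+ 2 + q ^+ 5 * C)) + (- 7%:R * (1 + L1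
    + L2) + 3%:R) + 7%:R * (j * (q * y / x ^+ 2 - q ^+ 5 / y)) + 7%:R * ((x * f0
    - y * f1 + x * (u * f2) - - x * (1 + L1 + L2)) / x + q * ((z * f1
    - y * (u ^+ 2 * f3) + y * (u ^+ 8 * f6) - j * y ^+ 2 / x ^+ 2) / y)
    - q ^+ 5 * ((x * f1 - z * (u ^+ 3 * f4) + z * (u ^+ 5 * f5) - j * z / y) / z))).
    by rewrite /A /B /C; field; rewrite x0 y0 z0.
  by rewrite R1 R2 R3 !(subrr, mul0r, mulr0, addr0).
have sE : f1 * (A - q * B - q ^+ 2 + q ^+ 5 * C) = g * f1.
  by rewrite -?q7 /g; ring.
rewrite sE key [g * (_ + _)]mulrDr [g * (7%:R * _)]mulrCA -addrA; congr (_ + _).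
pose ex := (y ^+ 3 * z - x * z ^+ 3) / (x ^+ 3 * y).
(* The identity holds only modulo Klein's quartic. The products in g times [wseries] of degree at
   least 7 in q are collected in [k] with q^7 divided out; subtracting k (q^7 - ex) reduces them,
   and the rest is a rational identity. *)
pose k := C * (- 1) * (y / (x * z)) + C * 2%:R * (q / y) + C * 1 * (q ^+ 2 / z)
  + C * (- 2%:R) * (q ^+ 4 * x / (y * z))
  - B * (- 2%:R) * (x / (y * z)) - (- 2%:R) * (q * x / (y * z)).
transitivity (g * (j * wseries (- 4%:R) 3%:R (- 1) 2%:R 1 (- 2%:R))
  - j * k * (q ^+ 7 - ex)); last first.
  by have -> : q ^+ 7 - ex = 0; [apply/eqP; rewrite subr_eq0 q7 [u]klein | rewrite mulr0 subr0].
rewrite klein /k /ex /g /wseries /A /B /C; field.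
by rewrite x0 y0 z0.
Qed.

Lemma lambert7_1 : 7%:R * lambert_total l7 h7 1 + 2%:R
  = g * (7%:R * (q ^+ 2 * (u ^+ 2 * T 1 3)) + j * wseries 2%:R 2%:R 4%:R (- 1) 3%:R 1).
Proof.
have R1 : z * T 1 0 - x * (u ^+ 3 * T 1 3) + z * (u ^+ 9 * T 1 6) = - z * (L3 - L1).
  have := @degenerate_triple 7 l7 10 h7 1 0 0 3 6 isT erefl erefl.
  rewrite (@tripleE 7 l7 0 0 3 6 _ 3 6 3 0 3 9) // Th6 !expr0z !mul1r => ->.
  by rewrite L6 -/z -/L3; ring.
have R2 : y * T 1 1 - z * (u ^+ 2 * T 1 3) + y * (u ^+ 6 * T 1 5) = j * y / x.
  have := @lambert_triple 7 l7 10 h7 1 0 1 3 5 isT erefl isT.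
  rewrite (@tripleE 7 l7 0 1 3 5 _ 2 4 2 0 2 6) // Th4 Th5 !expr0z !mul1r => ->.
  by rewrite -/x -/y -/z -/j; field; rewrite x0 y0 z0.
have R3 : x * T 1 2 - y * (u * T 1 3) + x * (u ^+ 3 * T 1 4) = j * x ^+ 2 / z ^+ 2.
  have := @lambert_triple 7 l7 10 h7 1 0 2 3 4 isT erefl isT.
  rewrite (@tripleE 7 l7 0 2 3 4 _ 1 2 1 0 1 3) // Th4 !expr0z !mul1r => ->.
  by rewrite -/x -/y -/z -/j; field; rewrite y0 z0.
rewrite /lambert_total !big_ord_recl big_ord0 /=.
rewrite (@class_factorE 7 1 0 0 0) //=.
rewrite (@class_factorE 7 1 1 3 0) //=.
rewrite (@class_factorE 7 1 2 2 1) //=.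
rewrite (@class_factorE 7 1 3 4 2) //=.
rewrite (@class_factorE 7 1 4 2 4) //=.
rewrite (@class_factorE 7 1 5 3 6) //=.
rewrite (@class_factorE 7 1 6 0 9) //=.
rewrite -/u -[lambert_sum _ _ _ _]/(T 1 0) -[lambert_sum _ _ _ 1]/(T 1 1)
  -[lambert_sum _ _ _ 2]/(T 1 2) -[lambert_sum _ _ _ 3]/(T 1 3)
  -[lambert_sum _ _ _ 4]/(T 1 4) -[lambert_sum _ _ _ 5]/(T 1 5)
  -[lambert_sum _ _ _ 6]/(T 1 6).
move: (T 1 0) (T 1 1) (T 1 2) (T 1 3) (T 1 4) (T 1 5) (T 1 6) R1 R2 R3.
move=> f0 f1 f2 f3 f4 f5 f6 R1 R2 R3.
have key : - 7%:R * (L3 - L1) + 2%:R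
    = j * (2%:R * z / x ^+ 2 - u * x / y ^+ 2 + 4%:R * u * y / z ^+ 2).
  transitivity (2%:R * (1 + 2%:R * L1 + L2 + L3) + (2%:R * L2 - L1 - L3)
    - 4%:R * (L2 + 2%:R * L3 - L1)); first by ring.
  by rewrite W1 W2 W3; ring.
transitivity (7%:R * (u ^+ 2 * f3 * (u * C - q ^+ 3 * B + q ^+ 2 * A - q ^+ 4))
  + (- 7%:R * (L3 - L1) + 2%:R) + 7%:R * (j * (q ^+ 2 * u * x / z ^+ 2
  - q ^+ 3 / x))).
  transitivity (7%:R * (u ^+ 2 * f3 * (u * C - q ^+ 3 * B + q ^+ 2 * A - q ^+ 4))
    + (- 7%:R * (L3 - L1) + 2%:R) + 7%:R * (j * (q ^+ 2 * u * x / z ^+ 2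
    - q ^+ 3 / x)) + 7%:R * ((z * f0 - x * (u ^+ 3 * f3) + z * (u ^+ 9 * f6)
    - - z * (L3 - L1)) / z - q ^+ 3 * ((y * f1 - z * (u ^+ 2 * f3)
    + y * (u ^+ 6 * f5) - j * y / x) / y) + q ^+ 2 * u * ((x * f2 - y * (u * f3)
    + x * (u ^+ 3 * f4) - j * x ^+ 2 / z ^+ 2) / x))).
    by rewrite /A /B /C; field; rewrite x0 y0 z0.
  by rewrite R1 R2 R3 !(subrr, mul0r, mulr0, addr0).
have sE : u ^+ 2 * f3 * (u * C - q ^+ 3 * B + q ^+ 2 * A - q ^+ 4) = g * (q ^+ 2 * (u ^+ 2 * f3)).
  by rewrite -?q7 /g; ring.
rewrite sE key [g * (_ + _)]mulrDr [g * (7%:R * _)]mulrCA -addrA; congr (_ + _).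
pose ex := (y ^+ 3 * z - x * z ^+ 3) / (x ^+ 3 * y).
pose k := C * 4%:R * (y / (x * z)) + C * (- 1) * (q / y) + C * 3%:R * (q ^+ 2 / z)
  + C * 1 * (q ^+ 4 * x / (y * z)) - B * 1 * (x / (y * z)) - 1 * (q * x / (y * z)).
transitivity (g * (j * wseries 2%:R 2%:R 4%:R (- 1) 3%:R 1) - j * k * (q ^+ 7 - ex)); last first.
  by have -> : q ^+ 7 - ex = 0; [apply/eqP; rewrite subr_eq0 q7 [u]klein | rewrite mulr0 subr0].
rewrite klein /k /ex /g /wseries /A /B /C; field.
by rewrite x0 y0 z0.
Qed.

Lemma lambert7_2 : 7%:R * lambert_total l7 h7 2 + 1%:R
  = g * (7%:R * (q ^+ 6 * (u ^+ 6 * T 2 5)) + j * wseries 1 1 2%:R 3%:R (- 2%:R) 4%:R).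
Proof.
have R1 : y * T 2 0 - y * (u ^+ 3 * T 2 3) + z * (u ^+ 7 * T 2 5) = - y * (L3 - L2).
  have := @degenerate_triple 7 l7 10 h7 2 0 0 3 5 isT erefl erefl.
  rewrite (@tripleE 7 l7 0 0 3 5 _ 2 5 3 0 3 7) // Th5 !expr0z !mul1r => ->.
  by rewrite L5 -/y -/L3; ring.
have R2 : z * T 2 1 - z * (u * T 2 2) + x * (u ^+ 7 * T 2 5) = j * z ^+ 2 / y ^+ 2.
  have := @lambert_triple 7 l7 10 h7 2 0 1 2 5 isT erefl isT.
  rewrite (@tripleE 7 l7 0 1 2 5 _ 3 4 1 0 1 7) // Th4 Th5 !expr0z !mul1r => ->.
  by rewrite -/x -/y -/z -/j; field; rewrite x0 y0.
have R3 : x * (u ^+ 4 * T 2 4) - y * (u ^+ 6 * T 2 5) + x * (u ^+ 9 * T 2 6) = j * x / z.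
  (* 4 + 5 + 6 exceeds h - b = 8 by 7, hence [d = -1]. *)
  have := @lambert_triple 7 l7 10 h7 2 (- 1) 4 5 6 isT erefl isT.
  rewrite (@tripleE 7 l7 (- 1) 4 5 6 _ 1 2 1 4 6 9) // Th4 Th5 Th6 => ->.
  by rewrite -/x -/y -/z -/j; field; rewrite x0 y0 z0.
rewrite /lambert_total !big_ord_recl big_ord0 /=.
rewrite (@class_factorE 7 2 0 0 0) //=.
rewrite (@class_factorE 7 2 1 4 0) //=.
rewrite (@class_factorE 7 2 2 4 1) //=.
rewrite (@class_factorE 7 2 3 0 3) //=.
rewrite (@class_factorE 7 2 4 6 4) //=.
rewrite (@class_factorE 7 2 5 1 7) //=.
rewrite (@class_factorE 7 2 6 6 9) //=.
rewrite -/u -[lambert_sum _ _ _ _]/(T 2 0) -[lambert_sum _ _ _ 1]/(T 2 1)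
  -[lambert_sum _ _ _ 2]/(T 2 2) -[lambert_sum _ _ _ 3]/(T 2 3)
  -[lambert_sum _ _ _ 4]/(T 2 4) -[lambert_sum _ _ _ 5]/(T 2 5)
  -[lambert_sum _ _ _ 6]/(T 2 6).
move: (T 2 0) (T 2 1) (T 2 2) (T 2 3) (T 2 4) (T 2 5) (T 2 6) R1 R2 R3.
move=> f0 f1 f2 f3 f4 f5 f6 R1 R2 R3.
have key : - 7%:R * (L3 - L2) + 1%:R
    = j * (z / x ^+ 2 - 4%:R * u * x / y ^+ 2 + 2%:R * u * y / z ^+ 2).
  transitivity ((1 + 2%:R * L1 + L2 + L3) + 4%:R * (2%:R * L2 - L1 - L3)
    - 2%:R * (L2 + 2%:R * L3 - L1)); first by ring.
  by rewrite W1 W2 W3; ring.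
transitivity (7%:R * (u ^+ 6 * f5 * (- u * B + q ^+ 4 * u * C + q ^+ 6 * A - q * u))
  + (- 7%:R * (L3 - L2) + 1%:R) + 7%:R * (j * (q ^+ 6 / z - q ^+ 4 * z / y ^+ 2))).
  transitivity (7%:R * (u ^+ 6 * f5 * (- u * B + q ^+ 4 * u * C + q ^+ 6 * A
    - q * u)) + (- 7%:R * (L3 - L2) + 1%:R) + 7%:R * (j * (q ^+ 6 / z
    - q ^+ 4 * z / y ^+ 2)) + 7%:R * ((y * f0 - y * (u ^+ 3 * f3)
    + z * (u ^+ 7 * f5) - - y * (L3 - L2)) / y - q ^+ 4 * ((z * f1 - z * (u * f2)
    + x * (u ^+ 7 * f5) - j * z ^+ 2 / y ^+ 2) / z) + q ^+ 6 * ((x * (u ^+ 4 * f4)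
    - y * (u ^+ 6 * f5) + x * (u ^+ 9 * f6) - j * x / z) / x))).
    by rewrite /A /B /C; field; rewrite x0 y0 z0.
  by rewrite R1 R2 R3 !(subrr, mul0r, mulr0, addr0).
have sE : u ^+ 6 * f5 * (- u * B + q ^+ 4 * u * C + q ^+ 6 * A - q * u)
    = g * (q ^+ 6 * (u ^+ 6 * f5)).
  by rewrite -?q7 /g; ring.
rewrite sE key [g * (_ + _)]mulrDr [g * (7%:R * _)]mulrCA -addrA; congr (_ + _).
pose ex := (y ^+ 3 * z - x * z ^+ 3) / (x ^+ 3 * y).
pose k := C * 2%:R * (y / (x * z)) + C * 3%:R * (q / y) + C * (- 2%:R) * (q ^+ 2 / z)
  + C * 4%:R * (q ^+ 4 * x / (y * z)) - B * 4%:R * (x / (y * z)) - 4%:R * (q * x / (y * z)).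
transitivity (g * (j * wseries 1 1 2%:R 3%:R (- 2%:R) 4%:R) - j * k * (q ^+ 7 - ex)); last first.
  by have -> : q ^+ 7 - ex = 0; [apply/eqP; rewrite subr_eq0 q7 [u]klein | rewrite mulr0 subr0].
rewrite klein /k /ex /g /wseries /A /B /C; field.
by rewrite x0 y0 z0.
Qed.
Lemma class7_0 n m : n = (7 * m + 5)%N ->
  7 * ((tail_class 7 7 n)%:Z - (tail_class 7 1 n)%:Z) + (3 * npart n)%N%:Z = 0.
Proof.
move=> nE; have := @extract_class 7 l7 10 h7 0 3 5 n m isT nE; apply.
rewrite lambert7_0 divide_pentagonal7.
set c := (F 1)^-1.
have -> : c * (7%:R * T 0 1 + j * wseries (- 4%:R) 3%:R (- 1) 2%:R 1 (- 2%:R))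
  = c * ((7%:R * T 0 1 + j * ((- 4%:R) * (z / (x * y))))) * q ^+ 0
    + c * (j * (3%:R * (x^-1))) * q ^+ 1
    + c * (j * ((- 1) * (y / (x * z)))) * q ^+ 2
    + c * (j * (2%:R * (y^-1))) * q ^+ 3
    + c * (j * (1 * (z^-1))) * q ^+ 4
    + c * (j * ((- 2%:R) * (x / (y * z)))) * q ^+ 6.
  by rewrite /wseries expr0 expr1; ring.
have cc : cls 7 0 c by prove_cls0.
have cT := cls_T 0 1.
have pR := res_compl_periodic l7 (r := 5).
repeat (apply: (gradedD l7 pR); last by prove_monomial).
by prove_monomial.
Qed.

Lemma class7_1 n m : n = (7 * m + 5)%N ->
  7 * ((tail_class 7 6 n)%:Z - (tail_class 7 2 n)%:Z) + (2 * npart n)%N%:Z = 0.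
Proof.
move=> nE; have := @extract_class 7 l7 10 h7 1 2 5 n m isT nE; apply.
rewrite lambert7_1 divide_pentagonal7.
set c := (F 1)^-1.
have -> : c * (7%:R * (q ^+ 2 * (u ^+ 2 * T 1 3)) + j * wseries 2%:R 2%:R 4%:R (- 1) 3%:R 1)
  = c * (j * (2%:R * (z / (x * y)))) * q ^+ 0
    + c * (j * (2%:R * (x^-1))) * q ^+ 1
    + c * ((7%:R * (u ^+ 2 * T 1 3) + j * (4%:R * (y / (x * z))))) * q ^+ 2
    + c * (j * ((- 1) * (y^-1))) * q ^+ 3
    + c * (j * (3%:R * (z^-1))) * q ^+ 4
    + c * (j * (1 * (x / (y * z)))) * q ^+ 6.
  by rewrite /wseries expr0 expr1; ring.
have cc : cls 7 0 c by prove_cls0.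
have cT := cls_T 1 3.
have pR := res_compl_periodic l7 (r := 5).
repeat (apply: (gradedD l7 pR); last by prove_monomial).
by prove_monomial.
Qed.

Lemma class7_2 n m : n = (7 * m + 5)%N ->
  7 * ((tail_class 7 5 n)%:Z - (tail_class 7 3 n)%:Z) + (1 * npart n)%N%:Z = 0.
Proof.
move=> nE; have := @extract_class 7 l7 10 h7 2 1 5 n m isT nE; apply.
rewrite lambert7_2 divide_pentagonal7.
set c := (F 1)^-1.
have -> : c * (7%:R * (q ^+ 6 * (u ^+ 6 * T 2 5)) + j * wseries 1 1 2%:R 3%:R (- 2%:R) 4%:R)
  = c * (j * (1 * (z / (x * y)))) * q ^+ 0
    + c * (j * (1 * (x^-1))) * q ^+ 1
    + c * (j * (2%:R * (y / (x * z)))) * q ^+ 2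
    + c * (j * (3%:R * (y^-1))) * q ^+ 3
    + c * (j * ((- 2%:R) * (z^-1))) * q ^+ 4
    + c * ((7%:R * (u ^+ 6 * T 2 5) + j * (4%:R * (x / (y * z))))) * q ^+ 6.
  by rewrite /wseries expr0 expr1; ring.
have cc : cls 7 0 c by prove_cls0.
have cT := cls_T 2 5.
have pR := res_compl_periodic l7 (r := 5).
repeat (apply: (gradedD l7 pR); last by prove_monomial).
by prove_monomial.
Qed.

End Mod7.

(** * Equidistribution of ranks *)

Section RankClasses.
Variables (l n : nat).
Hypothesis l_gt0 : (0 < l)%N.
Let p : int := (npart n)%:Z.
Let V s : int := (tail_class l s n)%:Z.
Hypothesis n_gt0 : (0 < n)%N.
Hypothesis tail_classE : forall b, (b < l)%N ->
  2 * l%:Z * (V (l - b) - V b.+1) + (l%:Z - 1 - 2 * b%:Z) * p = 0.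

Let N_tail s : (\sum_(j < n.+1) (N (s + l * j)%N n)%:Z : int) = V s - V s.+1.
Proof.
rewrite /V /tail_class !(big_morph Posz PoszD (erefl 0%:Z)) -sumrB; apply: eq_bigr => j _.
have := N_rank_ge (s + l * j)%N n.
by have -> : (s + l * j)%N%:Z + 1 = (s.+1 + l * j)%N%:Z :> int; lia.
Qed.

Let V_shift s : V s = (rank_ge n s)%:Z + V (s + l).
Proof.
rewrite /V /tail_class big_ord_recl muln0 addn0 PoszD; congr (_ + Posz _).
rewrite [RHS]big_ord_recr /= rank_ge0 ?addn0; try nia.
by apply: eq_bigr => j _; congr (rank_ge n (Posz _)); rewrite /bump; lia.
Qed.

(** Ranks congruent to [k] are k + lj and -(l - k + lj), counted alike by symmetry. For [k > 0],
    [tail_classE] at [k] is subtracted from its instance at [k - 1]; for [k = 0] the missing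
    equation is [npart_rank]. *)
Lemma rank_class k : (k < l)%N ->
  l%:Z * (\sum_(j < n.+1) (N (k + l * j)%N n)%:Z
    + \sum_(j < n.+1) (N (l - k + l * j)%N n)%:Z) = p.
Proof.
move=> lt_kl; rewrite !N_tail; case: k lt_kl => [|k] lt_kl.
  have e := tail_classE l_gt0; have e0 := V_shift 0; have e1 := V_shift 1.
  have pE : p = (rank_ge n 0)%:Z + (rank_ge n 1)%:Z by rewrite /p -npart_rank.
  rewrite subn0 add0n add1n in e e0 e1 *.
  transitivity (l%:Z * p + (2 * l%:Z * (V l - V 1) + (l%:Z - 1 - 2 * 0) * p)
    - (l%:Z - 1) * p); last by rewrite e; ring.
  by rewrite e0 e1 pE; ring.
have := tail_classE lt_kl; have := tail_classE (ltnW lt_kl).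
have -> : ((l - k.+1).+1 = l - k)%N by lia.
by move=> e1 e2; have : 2 * (l%:Z * (V k.+1 - V k.+2 + (V (l - k.+1) - V (l - k)%N))) = 2 * p; lia.
Qed.

End RankClasses.

Section TwoSided.
Variables (l a : nat) (f : int -> int).
Hypothesis l_gt0 : (0 < l)%N.
Hypothesis f0 : forall m, a%:Z <= `|m| -> f m = 0.

Let extend (g : nat -> int) B B' : (forall j, (B <= j)%N -> g j = 0) -> (B <= B')%N ->
  \sum_(j < B') g j = \sum_(j < B) g j.
Proof.
move=> g0 BB'; rewrite -(subnKC BB') big_split_ord /= addrC big1 ?add0r // => j _.
by apply: g0; rewrite leq_addr.
Qed.

Lemma progression_split m : (a <= m)%N ->
  \sum_(j < (a + m).+1) f (m%:Z - (l * j)%N%:Z)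
  = \sum_(j < a.+1) f (m %% l + l * j)%N
    + \sum_(j < a.+1) f (- (l - m %% l + l * j)%N%:Z).
Proof.
move=> le_am; have mE := divn_eq m l; have lt := ltn_pmod m l_gt0.
set k := (m %% l)%N in mE lt *; set t := (m %/ l)%N in mE.
have tm : (t <= m)%N by nia.
have -> : ((a + m).+1 = t.+1 + (a + m - t))%N by lia.
rewrite big_split_ord /=; congr (_ + _).
  transitivity (\sum_(j < t.+1) f (k + l * j)%N).
    rewrite (reindex_inj rev_ord_inj) /=; apply: eq_bigr => j _; congr f.
    by have := ltn_ord j; rewrite mE; nia.
  case: (leqP t a) => ta; [symmetry|]; apply: (extend (g := fun j => f (k + l * j)%N));
    by [move=> j lej; apply: f0; nia | lia].
transitivity (\sum_(j < a + m - t) f (- (l - k + l * j)%N%:Z)).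
  by apply: eq_bigr => j _; congr f; case: j => j /= _; move: mE lt; clear; nia.
case: (leqP (a + m - t) a) => ta; [symmetry|];
  apply: (extend (g := fun j => f (- (l - k + l * j)%N%:Z)));
  by [move=> j lej; apply: f0; nia | lia].
Qed.
End TwoSided.

(** * Division by the cyclotomic polynomial *)

Section Division.
Variables (l a : nat) (c : int -> int) (C : int).
Hypothesis l_gt0 : (0 < l)%N.
Hypothesis c0 : forall m, a%:Z <= `|m| -> c m = 0.
Hypothesis class_sum : forall m : nat, (a <= m)%N ->
  l%:Z * \sum_(j < (a + m).+1) c (m%:Z - (l * j)%N%:Z) = C.

(* The coefficients of [(1 - X) A / (1 - X^l)], where [A] is the numerator below. *)
Definition quotient_coef (i : nat) : int :=
  \sum_(j < i.+1) (c (i%:Z - a%:Z - (l * j)%N%:Z)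
                   - c (i%:Z - a%:Z - 1 - (l * j)%N%:Z)).

Definition numerator : {poly int} := \poly_(i < a.*2.+1) c (i%:Z - a%:Z).

(** Beyond the top of the numerator both sums run over a complete residue class, and the two class
    sums agree. Here equidistribution becomes divisibility. *)
Lemma quotient_coef_high i : (a.*2 < i)%N -> quotient_coef i = 0.
Proof.
move=> lt_i; rewrite /quotient_coef sumrB.
have l0 : l%:Z != 0 :> int by lia.
apply: (mulfI l0); rewrite mulr0 mulrBr.
have iE : ((a + (i - a)).+1 = i.+1)%N by lia.
have := class_sum (m := (i - a)%N) ltac:(lia); rewrite iE => e1.
have iE' : ((a + (i.-1 - a)).+1 = i)%N by lia.
have := class_sum (m := (i.-1 - a)%N) ltac:(lia); rewrite iE' => e2.
have e3 : \sum_(j < i.+1) c (i%:Z - a%:Z - (l * j)%N%:Z)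
    = \sum_(j < i.+1) c ((i - a)%N%:Z - (l * j)%N%:Z).
  by apply: eq_bigr => j _; congr c; lia.
rewrite e3 e1 big_ord_recr /= [X in _ - _ * (_ + X)]c0 ?addr0; last by nia.
rewrite -e2; apply/eqP; rewrite subr_eq0; apply/eqP; congr (_ * _).
by apply: eq_bigr => j _; congr c; lia.
Qed.

Lemma quotient_coef_rec i :
  quotient_coef i - (if (i < l)%N then 0 else quotient_coef (i - l))
  = c (i%:Z - a%:Z) - c (i%:Z - a%:Z - 1).
Proof.
rewrite /quotient_coef big_ord_recl /= muln0 !subr0 -addrA -[RHS]addr0; congr (_ + _).
case: ltnP => [lt_il | le_li].
  by rewrite subr0 big1 // => j _; rewrite !c0 ?subr0 // /bump; nia.
have iE : (i = (i - l).+1 + l.-1)%N by lia.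
pose G j := c (i%:Z - a%:Z - (l * j.+1)%N%:Z) - c (i%:Z - a%:Z - 1 - (l * j.+1)%N%:Z).
have -> : \sum_(j < i) G j = \sum_(j < (i - l).+1 + l.-1) G j by rewrite -iE.
rewrite big_split_ord /= [X in _ + X - _]big1 ?addr0; last first.
  by move=> j _; rewrite /G !c0 ?subr0 //; nia.
rewrite -sumrB big1 // => j _; apply/eqP; rewrite subr_eq0 /G; apply/eqP.
by congr (c _ - c _); nia.
Qed.

Lemma coef_numerator i : numerator`_i = c (i%:Z - a%:Z).
Proof. by rewrite coef_poly; case: ltnP => // le_i; rewrite c0 //; lia. Qed.

Lemma numerator_factor :
  numerator = (\sum_(i < l) 'X^i) * \poly_(i < a.*2.+1) quotient_coef i.
Proof.
have X1 : 1 - 'X != 0 :> {poly int}.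
  by rewrite -oppr_eq0 opprB polyXsubC_eq0.
apply: (mulfI X1); rewrite mulrA.
have -> : (1 - 'X) * \sum_(i < l) 'X^i = 1 - 'X^l :> {poly int}.
  rewrite -[in RHS](expr1n _ l) subrXX; congr (_ * _).
  by apply: eq_bigr => i _; rewrite expr1n mul1r.
apply/polyP => i; rewrite !mulrBl !mul1r !coefB coefXM coefXnM !coef_numerator.
rewrite !coef_poly.
have pE k : (if (k < a.*2.+1)%N then quotient_coef k else 0) = quotient_coef k.
  by case: ltnP => // /quotient_coef_high ->.
rewrite !pE quotient_coef_rec; congr (_ - _).
case: i => [|i] /=; first by rewrite c0 //; lia.
by congr c; lia.
Qed.

Lemma quotient_coef_ge0 : (forall m, c (- m) = c m) ->
  (forall m : nat, c (m%:Z + 1) <= c m%:Z) -> forall i, 0 <= quotient_coef i.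
Proof.
move=> cN dec i; have [le_ia | lt_ai] := leqP i a.
  apply: sumr_ge0 => j _; rewrite subr_ge0 -cN -[leRHS]cN.
  have := dec (a - i + l * j)%N; congr (c _ <= c _); lia.
(* Descending induction from the zeros above [2 a]: the coefficient at [i] is the one at [i + l]
   plus a descent of [c] to the right of the centre. *)
have [k] := ubnP (a.*2.+1 - i); elim: k i lt_ai => // k IH i lt_ai lt_k.
have [/quotient_coef_high -> //|le_i] := ltnP (a.*2) i.
have := quotient_coef_rec (i + l); rewrite ltnNge leq_addl /= addnK => e.
have d := dec (i + l - a - 1)%N.
have : 0 <= quotient_coef (i + l) by apply: IH; lia.
have e1 : (i + l)%N%:Z - a%:Z = (i + l - a - 1)%N%:Z + 1 by lia.
have e2 : (i + l)%N%:Z - a%:Z - 1 = (i + l - a - 1)%N%:Z by lia.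
by rewrite e2 e1 in e; lia.
Qed.
End Division.

Lemma expfz_subn (F : fieldType) (z : F) (i a : nat) : z != 0 ->
  z ^ (i%:Z - a%:Z) = z ^+ i / z ^+ a.
Proof. by move=> z0; rewrite expfzDr // -exprnN -exprnP. Qed.

Lemma laurent_quotient l a (c : int -> int) C : (0 < l)%N ->
    (forall m, a%:Z <= `|m| -> c m = 0) ->
    (forall m : nat, (a <= m)%N ->
      l%:Z * \sum_(j < (a + m).+1) c (m%:Z - (l * j)%N%:Z) = C) ->
    (forall i, (i <= a.*2)%N -> 0 <= quotient_coef l a c i) ->
  nonneg_laurent ((\sum_(i < a.*2.+1) (c (i%:Z - a%:Z))%:~R * zeta ^ (i%:Z - a%:Z)) / Phi l).
Proof.
move=> l_gt0 c0 class_sum ge0.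
exists a, (\poly_(i < a.*2.+1) quotient_coef l a c i); split.
  by apply/polyOverP => i; rewrite coef_poly; case: ltnP => // lt_i; apply: ge0.
have z0 : zeta != 0 by rewrite tofrac_eq0 polyX_eq0.
have PhiE : Phi l = tofrac (\sum_(i < l) 'X^i).
  by rewrite rmorph_sum; apply: eq_bigr => i _; rewrite rmorphXn.
have Phi0 : Phi l != 0.
  rewrite PhiE tofrac_eq0; apply/eqP => /(congr1 (fun p : {poly int} => p`_0)).
  case: l l_gt0 {c0 class_sum ge0 PhiE} => // l _.
  rewrite big_ord_recl coefD coef_sum big1 ?coefXn ?coef0 // => i _.
  by rewrite coefXn.
have -> : \sum_(i < a.*2.+1) (c (i%:Z - a%:Z))%:~R * zeta ^ (i%:Z - a%:Z)
    = tofrac (numerator a c) / zeta ^+ a.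
  rewrite /numerator poly_def (big_morph _ (@tofracD _) (tofrac0 _)) mulr_suml.
  apply: eq_bigr => i _; rewrite -mul_polyC tofracM tofracXn -/zeta -[c _ in RHS]intz !rmorph_int.
  by rewrite -mulrA -(expfz_subn i a z0).
rewrite (numerator_factor l_gt0 c0 class_sum) tofracM -PhiE.
by rewrite mulrAC [_ * tofrac _]mulrC mulfK.
Qed.

(** * Computation of the small cases *)

Fixpoint rank_ge_from (pt : seq nat) d n s : nat :=
  if d is d'.+1 then
    if (s < n)%N then (nth 0 pt (n - s.+1) - rank_ge_from pt d' (n - s.+1) (s + 3))%N
    else (s == 0%N)
  else 0%N.

(** To compute the tails at [n], Dyson's recursion consults p only below [n], and p(n) is the sum of
    the tails at 0 and 1; so the table grows by itself. *)
Fixpoint npart_table m : seq nat :=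
  if m is m'.+1 then
    let pt := npart_table m' in
    rcons pt (rank_ge_from pt m m' 0 + rank_ge_from pt m m' 1)
  else [::].

Lemma rank_ge_fromE pt d n s : (n < d)%N ->
    (forall k, (k < n)%N -> nth 0%N pt k = npart k) ->
  rank_ge_from pt d n s = rank_ge n s.
Proof.
elim: d n s => // d IH n s lt_nd ptE /=; case: ltnP => [lt_sn | le_ns].
  rewrite ptE ?IH; try lia; last by move=> k lt_k; apply: ptE; lia.
  by rewrite -(rank_ge_rec lt_sn) addnK.
case: s le_ns => [|s] le_ns; last by rewrite rank_ge0.
by move: le_ns; rewrite leqn0 => /eqP ->; rewrite rank_ge_00.
Qed.

Lemma size_npart_table m : size (npart_table m) = m.
Proof. by elim: m => //= m IH; rewrite size_rcons IH. Qed.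

Lemma npart_tableE m k : (k < m)%N -> nth 0%N (npart_table m) k = npart k.
Proof.
elim: m k => // m IH k; rewrite ltnS.
set r := rank_ge_from (npart_table m) m.+1 m.
rewrite -[npart_table _]/(rcons (npart_table m) (r 0%N + r 1%N)%N).
rewrite nth_rcons size_npart_table.
case: ltngtP => // [lt_km _|-> _]; first exact: IH.
by rewrite /r !rank_ge_fromE //; apply: npart_rank.
Qed.

(* Coefficients of the modified rank, for [rank_n] with coefficients [N]. *)
Definition star_coef (n : nat) (N : int -> int) (m : int) : int :=
  N m + (m == n%:Z - 2)%:Z + (m == 2 - n%:Z)%:Z
    - (m == n%:Z - 1)%:Z - (m == 1 - n%:Z)%:Z.

Definition N_from (rt : seq nat) (m : int) : int :=
  (nth 0%N rt `|m|)%:Z - (nth 0%N rt `|m|.+1)%:Z.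

(** Sums are folds over [iota], so that the test reduces by computation. *)
Definition small_check (l n : nat) : bool :=
  let pt := npart_table n in
  let rt := mkseq (rank_ge_from pt n.+1 n) n.+1 in
  let c m := if (n <= `|m|)%N then 0 else star_coef n (N_from rt) m in
  let i_ok i := (0 : int) <= foldr (fun j s => c (i%:Z - n%:Z - (l * j)%N%:Z)
     - c (i%:Z - n%:Z - 1 - (l * j)%N%:Z) + s) 0 (iota 0 i.+1) in
  all i_ok (iota 0 n.*2.+1).

Lemma N_small n m : (0 < n)%N -> n%:Z <= `|m| -> N m n = 0%N.
Proof.
move=> n0; have pos (k : nat) : (n <= k)%N -> N k%:Z n = 0%N.
  by move=> le_nk; have := N_rank_ge k n; rewrite rank_ge0 //; lia.
case: m => k le_nk; first by apply: pos; lia.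
by rewrite NegzE N_opp; apply: pos; lia.
Qed.

Lemma star_coef0 n m : (3 < n)%N -> n%:Z <= `|m| ->
  star_coef n (fun m => (N m n)%:Z) m = 0.
Proof. by move=> n3 le_nm; rewrite /star_coef N_small //; lia. Qed.

Lemma N_fromE n m : `|m| < n%:Z ->
  N_from (mkseq (rank_ge_from (npart_table n) n.+1 n) n.+1) m = (N m n)%:Z.
Proof.
move=> lt_mn; rewrite /N_from !nth_mkseq; try lia.
have geE s : rank_ge_from (npart_table n) n.+1 n s = rank_ge n s.
  by apply: rank_ge_fromE => // k; apply: npart_tableE.
rewrite !geE; have -> : N m n = N `|m|%N n.
  by case: m {lt_mn} => k //; rewrite NegzE N_opp; congr (N (Posz _) _); lia.
have := N_rank_ge `|m|%N n; have -> : `|m|%N%:Z + 1 = (`|m|.+1)%N%:Z :> int by lia.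
lia.
Qed.

Lemma foldr_sum (G : nat -> int) M :
  foldr (fun j s => G j + s) 0 (iota 0 M) = \sum_(j < M) G j.
Proof. by rewrite -(big_mkord xpredT G) unlock /index_iota subn0. Qed.

Lemma small_checkP l n : (3 < n)%N -> small_check l n -> forall i, (i <= n.*2)%N ->
  0 <= quotient_coef l n (star_coef n (fun m => (N m n)%:Z)) i.
Proof.
move=> n3 /allP chk i le_i; have := chk i; rewrite mem_iota => /(_ le_i).
rewrite foldr_sum /quotient_coef; congr (0 <= _); apply: eq_bigr => j _.
have cE k : (if (n <= `|k|)%N then 0 else star_coef n
      (N_from (mkseq (rank_ge_from (npart_table n) n.+1 n) n.+1)) k)
    = star_coef n (fun m => (N m n)%:Z) k.
  case: leqP => [le_nk | lt_kn]; first by rewrite star_coef0 //; lia.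
  by rewrite /star_coef N_fromE //; lia.
by rewrite !cE.
Qed.

(** * Class sums and monotonicity of the modified rank *)

Lemma indicator_sum l a (v : int) (m : nat) : (0 < l)%N -> `|v| <= a%:Z -> (a <= m)%N ->
  \sum_(j < (a + m).+1) (m%:Z - (l * j)%N%:Z == v)%:Z
  = (l%:Z %| m%:Z - v)%Z%:Z.
Proof.
move=> l0 va am; case: dvdzP => [[k kE] | ndv].
  have k0 : 0 <= k by nia.
  have lt : (`|k| < (a + m).+1)%N by nia.
  rewrite (bigD1 (Ordinal lt)) //= big1 ?addr0 => [|j].
    by rewrite (_ : _ == v = true) //; lia.
  by rewrite -val_eqE /= => nj; rewrite (_ : _ == v = false) //; apply/eqP; nia.
rewrite big1 // => j _; rewrite (_ : _ == v = false) //.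
by apply/eqP => e; apply: ndv; exists (j : nat)%:Z; rewrite -e; lia.
Qed.

(** As [l] divides 2n - 3, n - 2 is congruent to 1 - n and 2 - n to n - 1: in every class an added
    monomial meets a subtracted one. *)
Lemma star_class_sum l n : (3 < n)%N -> (0 < l)%N -> (l%:Z %| 2 * n%:Z - 3)%Z ->
    (forall b, (b < l)%N ->
      2 * l%:Z * ((tail_class l (l - b) n)%:Z - (tail_class l b.+1 n)%:Z)
      + (l%:Z - 1 - 2 * b%:Z) * (npart n)%:Z = 0) ->
  forall m : nat, (n <= m)%N ->
    l%:Z * \sum_(j < (n + m).+1) star_coef n (fun m => (N m n)%:Z) (m%:Z - (l * j)%N%:Z)
    = (npart n)%:Z.
Proof.
move=> n3 l0 dv tailE m le_nm; rewrite /star_coef !big_split /= !sumrN.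
have [le2 le2' le1 le1'] : [/\ `|n%:Z - 2| <= n%:Z, `|2 - n%:Z| <= n%:Z,
    `|n%:Z - 1| <= n%:Z & `|1 - n%:Z| <= n%:Z] by split; lia.
rewrite !(indicator_sum l0 _ le_nm) //.
have -> : (l%:Z %| m%:Z - (1 - n%:Z))%Z = (l%:Z %| m%:Z - (n%:Z - 2))%Z.
  have -> : m%:Z - (1 - n%:Z) = m%:Z - (n%:Z - 2) + (2 * n%:Z - 3) by ring.
  by rewrite rpredDr.
have -> : (l%:Z %| m%:Z - (2 - n%:Z))%Z = (l%:Z %| m%:Z - (n%:Z - 1))%Z.
  have -> : m%:Z - (2 - n%:Z) = m%:Z - (n%:Z - 1) + (2 * n%:Z - 3) by ring.
  by rewrite rpredDr.
rewrite addrK addrK -[RHS](rank_class l0 _ tailE (ltn_pmod m l0)); last by lia.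
congr (_ * _).
rewrite (progression_split l0 (f := fun m => (N m n)%:Z) (a := n)) //; last first.
  by move=> k lek; rewrite N_small //; lia.
by congr (_ + _); apply: eq_bigr => j _; rewrite N_opp.
Qed.

(** The values of N at n - 3, n - 2, n - 1 are 1, 0, 1, the only ascent to the right of the centre.
    The modification changes them to 1, 1, 0. *)
Lemma star_coef_dec n : (39 <= n)%N ->
    (forall m : int, 0 <= m -> m <= n%:Z - 3 -> (N (m + 1) n <= N m n)%N) ->
  forall m : nat, star_coef n (fun m => (N m n)%:Z) (m%:Z + 1)
     <= star_coef n (fun m => (N m n)%:Z) m%:Z.
Proof.
move=> n39 dec m; rewrite /star_coef.
have p0 : npart 0 = 1%N by rewrite -(npart_tableE (m := 3)).
have p1 : npart 1 = 1%N by rewrite -(npart_tableE (m := 3)).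
have p2 : npart 2 = 2%N by rewrite -(npart_tableE (m := 3)).
have g0 : rank_ge n n = 0%N by apply: rank_ge0; lia.
have g1 : rank_ge n (n - 1)%N = 1%N.
  have := rank_ge_rec (n := n) (s := n - 1) ltac:(lia).
  have -> : (n - (n - 1).+1 = 0)%N by lia.
  by rewrite [X in (_ + X)%N]rank_ge0 //; lia.
have g2 : rank_ge n (n - 2)%N = 1%N.
  have := rank_ge_rec (n := n) (s := n - 2) ltac:(lia).
  have -> : (n - (n - 2).+1 = 1)%N by lia.
  by rewrite [X in (_ + X)%N]rank_ge0 //; lia.
have g3 : rank_ge n (n - 3)%N = 2%N.
  have := rank_ge_rec (n := n) (s := n - 3) ltac:(lia).
  have -> : (n - (n - 3).+1 = 2)%N by lia.
  by rewrite [X in (_ + X)%N]rank_ge0 //; lia.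
have NE k : (k < n)%N -> (N (n - k.+1)%N n + rank_ge n (n - k)%N = rank_ge n (n - k.+1)%N)%N.
  move=> lt_kn; have := N_rank_ge (n - k.+1)%N n.
  by have -> : (n - k.+1)%N%:Z + 1 = (n - k)%N by lia.
have := NE 0%N ltac:(lia); have := NE 1%N ltac:(lia); have := NE 2%N ltac:(lia).
rewrite subn0 g0 g1 g2 g3 => N3' N2' N1'.
have [N1 N2 N3] : [/\ N (n - 1)%N n = 1%N, N (n - 2)%N n = 0%N & N (n - 3)%N n = 1%N].
  by split; lia.
have [le_nm|lt_mn] := leqP n m; first by rewrite !N_small; lia.
have [m1|] := eqVneq m (n - 1)%N; first by rewrite N_small ?m1 ?N1; lia.
have [m2|] := eqVneq m (n - 2)%N.
  have -> : m%:Z + 1 = (n - 1)%N by lia.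
  by rewrite m2 N1 N2; lia.
have [m3|] := eqVneq m (n - 3)%N.
  have -> : m%:Z + 1 = (n - 2)%N by lia.
  by rewrite m3 N2 N3; lia.
by move=> *; have := dec m; lia.
Qed.

Lemma star_coefN n m : (3 < n)%N ->
  star_coef n (fun m => (N m n)%:Z) (- m) = star_coef n (fun m => (N m n)%:Z) m.
Proof. by move=> n3; rewrite /star_coef N_opp; lia. Qed.

Lemma monomial_sum a (v : int) : `|v| <= a%:Z ->
  \sum_(i < a.*2.+1) (i%:Z - a%:Z == v)%:Z%:~R * zeta ^ (i%:Z - a%:Z) = zeta ^ v.
Proof.
move=> va; have lt : (`|(v + a%:Z)%R| < a.*2.+1)%N by lia.
have vE : `|(v + a%:Z)%R|%N%:Z - a%:Z = v by lia.
rewrite (bigD1 (Ordinal lt)) //= big1 ?addr0 => [|i].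
  by rewrite vE eqxx mul1r.
rewrite -val_eqE /= => ni; rewrite (_ : _ == v = false) ?mul0r //.
by apply/eqP => e; move/eqP: ni; apply; lia.
Qed.

Lemma rank_starE l n : (3 < l * n + beta l)%N ->
  rank_star l n = \sum_(i < (l * n + beta l).*2.+1)
    (star_coef (l * n + beta l) (fun m => (N m (l * n + beta l))%:Z)
      (i%:Z - (l * n + beta l)%N%:Z))%:~R * zeta ^ (i%:Z - (l * n + beta l)%N%:Z).
Proof.
rewrite /rank_star /rank_poly; move: (l * n + beta l)%N => a a3.
transitivity (\sum_(i < a.*2.+1) (N (i%:Z - a%:Z) a)%:R * zeta ^ (i%:Z - a%:Z)
  + \sum_(i < a.*2.+1) (i%:Z - a%:Z == a%:Z - 2)%:Z%:~R * zeta ^ (i%:Z - a%:Z)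
  + \sum_(i < a.*2.+1) (i%:Z - a%:Z == 2 - a%:Z)%:Z%:~R * zeta ^ (i%:Z - a%:Z)
  - \sum_(i < a.*2.+1) (i%:Z - a%:Z == a%:Z - 1)%:Z%:~R * zeta ^ (i%:Z - a%:Z)
  - \sum_(i < a.*2.+1) (i%:Z - a%:Z == 1 - a%:Z)%:Z%:~R * zeta ^ (i%:Z - a%:Z)).
  by rewrite !monomial_sum; try lia; congr (_ - _); rewrite addrAC.
rewrite -!big_split -!sumrB; apply: eq_bigr => i _.
by rewrite /star_coef !rmorphB !rmorphD /= !mulrBl !mulrDl.
Qed.

Lemma rank_star_quotient l n a : a = (l * n + beta l)%N ->
    (3 < a)%N -> (0 < l)%N -> (l%:Z %| 2 * a%:Z - 3)%Z ->
    (forall b, (b < l)%N ->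
      2 * l%:Z * ((tail_class l (l - b) a)%:Z - (tail_class l b.+1 a)%:Z)
      + (l%:Z - 1 - 2 * b%:Z) * (npart a)%:Z = 0) ->
    (forall (m : int) (n : nat), (39 <= n)%N -> 0 <= m -> m <= n%:Z - 3 ->
      (N (m + 1) n <= N m n)%N) ->
    ((a < 39)%N -> small_check l a) ->
  nonneg_laurent (rank_star l n / Phi l).
Proof.
move=> aE a3 l0 dv tailE dec chk; rewrite rank_starE -aE //.
have c0 m : a%:Z <= `|m| -> star_coef a (fun m => (N m a)%:Z) m = 0 by exact: star_coef0.
have cs := star_class_sum a3 l0 dv tailE.
apply: (laurent_quotient l0 c0 cs) => i le_i.
have [/chk /(small_checkP a3)|n39] := ltnP a 39; first exact.
apply: (quotient_coef_ge0 l0 c0 cs) => m; first exact: star_coefN.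
by apply: star_coef_dec => // k; apply: dec.
Qed.

Theorem theorem1p5
  (hN : forall (m : int) (n : nat),
     (39 <= n)%N -> 0 <= m -> m <= n%:Z - 3 -> (N (m + 1) n <= N m n)%N)
  (n : nat) :
  nonneg_laurent (rank_star 5 n / Phi 5) /\
  nonneg_laurent (rank_star 7 n / Phi 7).
Proof.
split.
- apply: (@rank_star_quotient 5 n (5 * n + 4)) => //; try lia.
  + have e0 := class5_0 (erefl (5 * n + 4)%N); have e1 := class5_1 (erefl (5 * n + 4)%N).
    (* The relation is odd under b -> 4 - b, so [b = 3, 4] repeat [e1], [e0], and [b = 2] is
       trivial. *)
    by case=> [|[|[|[|[|b]]]]] //= _; rewrite ?subSS ?subn0; lia.
  by case: n => [|[|[|[|[|[|[|n]]]]]]] // lt; try (exfalso; lia); vm_compute.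
apply: (@rank_star_quotient 7 n (7 * n + 5)) => //; try lia.
- have e0 := class7_0 (erefl (7 * n + 5)%N); have e1 := class7_1 (erefl (7 * n + 5)%N).
  have e2 := class7_2 (erefl (7 * n + 5)%N).
  by case=> [|[|[|[|[|[|[|b]]]]]]] //= _; rewrite ?subSS ?subn0; lia.
by case: n => [|[|[|[|[|n]]]]] // lt; try (exfalso; lia); vm_compute.
Qed.
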